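(* Let $F$ be a field of characteristic not two, $F^{\mathrm{sep}}$ a separable closure, $\Gamma$ the absolute Galois group of $F$, and $\mathbb{G}$ an affine group superscheme over $F$. (1) Sending an irreducible representation $W$ of $\mathbb{G}$ to the $\Gamma$-orbit of an irreducible subrepresentation of $W\otimes_F F^{\mathrm{sep}}$ gives a well-defined bijection between the set of isomorphism classes of irreducible representations of $\mathbb{G}$ and the set of $\Gamma$-orbits (for the Galois twist action) of isomorphism classes of irreducible representations of $\mathbb{G}\otimes_F F^{\mathrm{sep}}$. This bijection respects the parity change $\Pi$. (2) Let $V$ be an irreducible representation of $\mathbb{G}\otimes_F F^{\mathrm{sep}}$, and let $V_F$ be the irreducible representation of $\mathbb{G}$ corresponding to the orbit of $V$ under (1). (i) The division algebra $\mathrm{End}_{\mathbb{G}}(V_F)$ (resp. the division superalgebra $\underline{\mathrm{End}}_{\mathbb{G}}(V_F)$) is central over $F$ if and only if $\mathrm{End}_{\mathbb{G}\otimes_F F^{\mathrm{sep}}}(V)=F^{\mathrm{sep}}\,\mathrm{id}_V$ and for every $\sigma\in\Gamma$ one has ${}^\sigma V\cong V$ (resp. ${}^\sigma V\cong V$ or ${}^\sigma V\cong \Pi V$). (ii) Let $F'$ be the even part of the center of $\underline{\mathrm{End}}_{\mathbb{G}}(V_F)$. Suppose that $F'$ is a separable extension of $F$. Then $V_F$ is the restriction $\mathrm{Res}_{F'/F}V_{F'}$ of $V_{F'}$ for a fixed embedding of $F'$ into $F^{\mathrm{sep}}$ over $F$. Moreover, the division superalgebra $\underline{\mathrm{End}}_{\mathbb{G}\otimes_F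 F'}(V_{F'})$ is central (over $F'$), and it is equal to $\underline{\mathrm{End}}_{\mathbb{G}}(V_F)$.
   Context: A superalgebra is a $\mathbb{Z}/2$-graded associative unital algebra $A=A_{\bar 0}\oplus A_{\bar 1}$. An affine group superscheme $\mathbb{G}$ over $F$ is a representable group-valued functor on commutative superalgebras over $F$, i.e. it is given by a commutative Hopf superalgebra $F[\mathbb{G}]$. A representation of $\mathbb{G}$ is a right $F[\mathbb{G}]$-supercomodule (a vector superspace with parity-preserving coaction); homomorphisms preserve parity; irreducible means nonzero with no proper nonzero sub-supercomodule. $\Pi V$ is the parity change of $V$: the representation obtained from $V$ by interchanging the even and odd parts. $\mathrm{Hom}_{\mathbb{G}}(V,W)$ is the space of (parity-preserving) homomorphisms, $\mathrm{End}_{\mathbb{G}}(V)=\mathrm{Hom}_{\mathbb{G}}(V,V)$, and $\underline{\mathrm{End}}_{\mathbb{G}}(V)$ is the superalgebra (under composition) with even part $\mathrm{End}_{\mathbb{G}}(V)$ and odd part $\mathrm{Hom}_{\mathbb{G}}(V,\Pi V)$. For $V$ irreducible these are a division algebra and a division superalgebra (every nonzero homogeneous element is invertible). The even part of the center of a superalgebra $A$ is $\{a\in A_{\bar 0}: ab=ba\ \forall b\in A\}$; a superalgebra $A$ over $F$ is called central if this equals $F$. For $\sigma\in\Gamma$ and a representation $V$ of $\mathbb{G}\otimes_F F^{\mathrm{sep}}$, the Galois twist ${}^\sigma V$ is the base change of $V$ along $\sigma$, viewed again as a representation of $\mathbb{G}\otimes_F F^{\mathrm{sep}}$. For a finite extension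 $F'/F$ with an embedding $F'\hookrightarrow F^{\mathrm{sep}}$ over $F$, $V_{F'}$ denotes the irreducible representation of $\mathbb{G}\otimes_F F'$ corresponding to $V$ under the bijection of (1) applied to $\mathbb{G}\otimes_F F'$ over $F'$, with $F^{\mathrm{sep}}$ regarded as a separable closure of $F'$ via the embedding. For a representation $W$ of $\mathbb{G}\otimes_F F'$, $\mathrm{Res}_{F'/F}W$ is $W$ regarded as a representation of $\mathbb{G}$ over $F$. *)

(* Defs.v *)
From HB Require Import structures.
From mathcomp Require Import all_boot all_algebra.
From mathcomp Require Import generic_quotient separable.
From mathcomp Require Import boolp classical_sets functions.
Set Implicit Arguments. Unset Strict Implicit. Unset Printing Implicit Defensive.
Import GRing.Theory.
Local Open Scope ring_scope.

Section Tensor.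
Local Open Scope quotient_scope.
Variables (F : fieldType) (V W : lmodType F).

(* V (x)_F W is the quotient of the formal sums of pairs (v, w) by the relation of
   having the same image under every balanced map to an abelian group. *)
Definition balanced (U : zmodType) (g : V -> W -> U) : Prop :=
  [/\ forall w, {morph g^~ w : v v' / v + v'},
      forall v, {morph g v : w w' / w + w'} &
      forall c v w, g (c *: v) w = g v (c *: w)].

Definition fsum (U : zmodType) (g : V -> W -> U) (s : seq (V * W)) : U :=
  \sum_(p <- s) g p.1 p.2.

Definition trel : rel (seq (V * W)) := fun s t =>
  `[< forall (U : zmodType) (g : V -> W -> U), balanced g -> fsum g s = fsum g t >].

Lemma trel_equiv : equiv_class_of trel.
Proof.
split=> [s|s t|t s u].
- by apply/asboolP.
- by apply/asboolP/asboolP => h U g /h.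
- by move=> /asboolP h1 /asboolP h2; apply/asboolP => U g gb; rewrite h1 ?h2.
Qed.
Canonical trel_equiv_rel := EquivRelPack trel_equiv.

Definition tens : Type := {eq_quot trel}.
HB.instance Definition _ := Choice.on tens.
HB.instance Definition _ := EqQuotient.on tens.

Definition tcls (s : seq (V * W)) : tens := \pi_tens s.
Definition tmk (v : V) (w : W) : tens := tcls [:: (v, w)].

(* The additive map induced by g; meaningful only when g is balanced. *)
Definition tlift (U : zmodType) (g : V -> W -> U) (t : tens) : U :=
  fsum g (repr t).

Lemma tcls_eq s t :
  (forall (U : zmodType) (g : V -> W -> U), balanced g -> fsum g s = fsum g t) ->
  tcls s = tcls t.
Proof. by move=> h; apply/eqmodP/asboolP. Qed.

Lemma tlift_cls (U : zmodType) (g : V -> W -> U) s :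
  balanced g -> tlift g (tcls s) = fsum g s.
Proof.
move=> gb; rewrite /tlift.
have /eqmodP/asboolP h : repr (\pi_tens s) = s %[mod tens] by rewrite reprK.
exact: h.
Qed.

Lemma tcls_repr t : tcls (repr t) = t.
Proof. by rewrite /tcls reprK. Qed.

Lemma tens_eq (x y : tens) :
  (forall (U : zmodType) (g : V -> W -> U), balanced g -> tlift g x = tlift g y) ->
  x = y.
Proof.
by move=> h; rewrite -(tcls_repr x) -(tcls_repr y); apply: tcls_eq => U g /h.
Qed.

Definition tadd (x y : tens) := tcls (repr x ++ repr y).
Definition topp (x : tens) := tcls [seq (- p.1, p.2) | p <- repr x].
Definition tscale (c : F) (x : tens) := tcls [seq (c *: p.1, p.2) | p <- repr x].

Lemma bal0l (U : zmodType) (g : V -> W -> U) w : balanced g -> g 0 w = 0.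
Proof. by case=> h _ _; apply: (addIr (g 0 w)); rewrite -h !add0r. Qed.
Lemma bal0r (U : zmodType) (g : V -> W -> U) v : balanced g -> g v 0 = 0.
Proof. by case=> _ h _; apply: (addIr (g v 0)); rewrite -h !add0r. Qed.
Lemma balN (U : zmodType) (g : V -> W -> U) v w : balanced g -> g (- v) w = - g v w.
Proof.
move=> gb; apply: (addIr (g v w)); case: (gb) => h _ _.
by rewrite -h !addNr (bal0l _ gb).
Qed.

Lemma balZ (U : zmodType) (g : V -> W -> U) c :
  balanced g -> balanced (fun v w => g (c *: v) w).
Proof.
case=> h1 h2 h3; split=> [w v v'|v w w'|d v w] /=.
- by rewrite scalerDr h1.
- by rewrite h2.
- by rewrite -!h3 !scalerA mulrC.
Qed.

Lemma tlift_add (U : zmodType) (g : V -> W -> U) x y :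
  balanced g -> tlift g (tadd x y) = tlift g x + tlift g y.
Proof. by move=> gb; rewrite /tadd tlift_cls // /tlift /fsum big_cat. Qed.
Lemma tlift_opp (U : zmodType) (g : V -> W -> U) x :
  balanced g -> tlift g (topp x) = - tlift g x.
Proof.
move=> gb; rewrite /topp tlift_cls // /tlift /fsum big_map -sumrN.
by apply: eq_bigr => p _ /=; rewrite balN.
Qed.
Lemma tlift_scale0 (U : zmodType) (g : V -> W -> U) c x :
  balanced g -> tlift g (tscale c x) = tlift (fun v w => g (c *: v) w) x.
Proof. by move=> gb; rewrite /tscale tlift_cls // /tlift /fsum big_map. Qed.

Lemma taddA : associative tadd.
Proof. by move=> x y z; apply: tens_eq => U g gb; rewrite !tlift_add // addrA. Qed.
Lemma taddC : commutative tadd.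
Proof. by move=> x y; apply: tens_eq => U g gb; rewrite !tlift_add // addrC. Qed.
Lemma tadd0 : left_id (tcls [::]) tadd.
Proof.
by move=> x; apply: tens_eq => U g gb; rewrite !tlift_add // tlift_cls // /fsum big_nil add0r.
Qed.
Lemma taddN : left_inverse (tcls [::]) topp tadd.
Proof.
move=> x; apply: tens_eq => U g gb.
by rewrite !tlift_add // tlift_cls // tlift_opp // addNr /fsum big_nil.
Qed.
HB.instance Definition _ := GRing.isZmodule.Build tens taddA taddC tadd0 taddN.

Lemma tliftD (U : zmodType) (g : V -> W -> U) :
  balanced g -> {morph tlift g : x y / x + y}.
Proof. by move=> gb x y; apply: tlift_add. Qed.

Lemma tscaleA a b x : tscale a (tscale b x) = tscale (a * b) x.
Proof.
apply: tens_eq => U g gb; rewrite !tlift_scale0 //; last exact: balZ.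
by rewrite /tlift /fsum; apply: eq_bigr => p _ /=; rewrite scalerA mulrC.
Qed.
Lemma tscale1 : left_id 1 tscale.
Proof.
move=> x; apply: tens_eq => U g gb; rewrite tlift_scale0 //.
by rewrite /tlift /fsum; apply: eq_bigr => p _ /=; rewrite scale1r.
Qed.
Lemma tscaleDr : right_distributive tscale +%R.
Proof.
move=> c x y; apply: tens_eq => U g gb.
rewrite tliftD // !tlift_scale0 // tliftD //; exact: balZ.
Qed.
Lemma tscaleDl x : {morph tscale^~ x : a b / a + b}.
Proof.
move=> a b; apply: tens_eq => U g gb; rewrite tliftD // !tlift_scale0 //.
rewrite /tlift /fsum -big_split; apply: eq_bigr => p _ /=.
by case: gb => h _ _; rewrite scalerDl h.
Qed.
HB.instance Definition _ := GRing.Zmodule_isLmodule.Build F tens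
  tscaleA tscale1 tscaleDr tscaleDl.

Lemma tliftE (U : zmodType) (g : V -> W -> U) v w :
  balanced g -> tlift g (tmk v w) = g v w.
Proof. by move=> gb; rewrite /tmk tlift_cls // /fsum big_seq1. Qed.

Lemma balanced_tmk : balanced tmk.
Proof.
split=> [w v v'|v w w'|c v w]; apply: tens_eq => U g gb;
  rewrite ?tliftD // !tliftE //; by case: gb => h1 h2 h3; rewrite ?h1 ?h2 ?h3.
Qed.

Lemma tensP (t : tens) : t = \sum_(p <- repr t) tmk p.1 p.2.
Proof.
apply: tens_eq => U g gb.
rewrite (big_morph (tlift g) (tliftD gb) (_ : tlift g 0 = 0)); last first.
  by apply: (addIr (tlift g 0)); rewrite -(tliftD gb) !add0r.
by rewrite {1}/tlift /fsum; apply: eq_bigr => p _; rewrite tliftE.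
Qed.

Lemma tmkZl c v w : tmk (c *: v) w = c *: tmk v w.
Proof.
by apply: tens_eq => U g gb; rewrite tlift_scale0 // !tliftE //; apply: balZ.
Qed.
End Tensor.

Notation "v '\ot' w" := (tmk v w) (at level 40, left associativity).

Definition addmap (U V : zmodType) (f : U -> V) : Prop := {morph f : x y / x + y}.

Definition semilin (F E : fieldType) (iota : F -> E) (V : lmodType F)
    (M : lmodType E) (f : V -> M) : Prop :=
  forall c u v, f (c *: u + v) = iota c *: f u + f v.

Section Aux.

Lemma addmap0 (U V : zmodType) (f : U -> V) : addmap f -> f 0 = 0.
Proof. by move=> h; apply: (addIr (f 0)); rewrite -h !add0r. Qed.

Lemma addmap_sum (U V : zmodType) (f : U -> V) (I : Type) (r : seq I) (P : pred I) (g : I -> U) :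
  addmap f -> f (\sum_(i <- r | P i) g i) = \sum_(i <- r | P i) f (g i).
Proof. by move=> h; apply: big_morph => //; apply: addmap0. Qed.

Lemma addmap_comp (U V W : zmodType) (f : V -> W) (g : U -> V) :
  addmap f -> addmap g -> addmap (fun x => f (g x)).
Proof. by move=> h k x y; rewrite k h. Qed.

Lemma addmap_add (U V : zmodType) (f g : U -> V) :
  addmap f -> addmap g -> addmap (fun x => f x + g x).
Proof. by move=> h k x y; rewrite k h addrACA. Qed.

Lemma tens_ext (F : fieldType) (V W : lmodType F) (U : zmodType) (f g : tens V W -> U) :
  addmap f -> addmap g -> (forall v w, f (v \ot w) = g (v \ot w)) -> f =1 g.
Proof.
move=> hf hg h t; rewrite (tensP t) !addmap_sum //.
by apply: eq_bigr.
Qed.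

Section Semilin.
Variables (F E : fieldType) (iota : {rmorphism F -> E}) (V : lmodType F) (M : lmodType E).
Variables (f : V -> M) (fl : semilin iota f).
Lemma semilinD : addmap f.
Proof. by move=> u v; rewrite -{1}(scale1r u) fl rmorph1 scale1r. Qed.
Lemma semilin0 : f 0 = 0. Proof. exact: addmap0 semilinD. Qed.
Lemma semilinZ c u : f (c *: u) = iota c *: f u.
Proof. by rewrite -{1}(addr0 (c *: u)) fl semilin0 addr0. Qed.
End Semilin.

Lemma semilinP (F E : fieldType) (iota : F -> E) (V : lmodType F) (M : lmodType E) (f : V -> M) :
  addmap f -> (forall c u, f (c *: u) = iota c *: f u) -> semilin iota f.
Proof. by move=> h k c u v; rewrite h k. Qed.

Lemma semilin_id (F : fieldType) (V : lmodType F) : semilin idfun (@id V).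
Proof. by []. Qed.

Lemma semilin_comp (F E K : fieldType) (i1 : F -> E) (i2 : E -> K) (i3 : F -> K)
  (V : lmodType F) (M : lmodType E) (N : lmodType K) (f : V -> M) (g : M -> N) :
  (forall c, i3 c = i2 (i1 c)) ->
  semilin i1 f -> semilin i2 g -> semilin i3 (fun x => g (f x)).
Proof. by move=> h k l c u v; rewrite k l h. Qed.

Lemma semilin_compl (F E : fieldType) (i1 : F -> E)
  (V : lmodType F) (M N : lmodType E) (f : V -> M) (g : M -> N) :
  semilin i1 f -> semilin idfun g -> semilin i1 (fun x => g (f x)).
Proof. exact: semilin_comp. Qed.

Lemma semilin_compr (F E : fieldType) (i1 : F -> E)
  (V U : lmodType F) (N : lmodType E) (f : V -> U) (g : U -> N) :
  semilin idfun f -> semilin i1 g -> semilin i1 (fun x => g (f x)).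
Proof. exact: semilin_comp. Qed.

Lemma semilin_add (F E : fieldType) (i1 : F -> E) (V : lmodType F) (M : lmodType E) (f g : V -> M) :
  semilin i1 f -> semilin i1 g -> semilin i1 (fun x => f x + g x).
Proof. by move=> h k c u v; rewrite k h scalerDr addrACA. Qed.

Lemma semilin_scale (F : fieldType) (M : lmodType F) c : semilin idfun (fun v : M => c *: v).
Proof. by move=> d u v; rewrite scalerDr !scalerA mulrC. Qed.

Lemma balanced_semi (F E : fieldType) (iota : {rmorphism F -> E}) (V W : lmodType F)
  (V' W' : lmodType E) (f : V -> V') (k : W -> W') (U : zmodType) (g : V' -> W' -> U) :
  semilin iota f -> semilin iota k -> balanced g -> balanced (fun v w => g (f v) (k w)).
Proof.
move=> fl kl [h1 h2 h3]; split=> [w v v'|v w w'|c v w] /=.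
- by rewrite (semilinD fl) h1.
- by rewrite (semilinD kl) h2.
- by rewrite (semilinZ fl) (semilinZ kl) h3.
Qed.

Lemma balanced_post (F : fieldType) (V W : lmodType F) (U U' : zmodType) (g : V -> W -> U) (h : U -> U') :
  addmap h -> balanced g -> balanced (fun v w => h (g v w)).
Proof.
by move=> hD [h1 h2 h3]; split=> [w v v'|v w w'|c v w] /=; rewrite ?h1 ?h2 ?h3 ?hD.
Qed.

Lemma balanced_add (F : fieldType) (V W : lmodType F) (U : zmodType) (g h : V -> W -> U) :
  balanced g -> balanced h -> balanced (fun v w => g v w + h v w).
Proof.
by move=> [h1 h2 h3] [k1 k2 k3]; split=> [w v v'|v w w'|c v w] /=;
  rewrite ?h1 ?h2 ?h3 ?k1 ?k2 ?k3 // addrACA.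
Qed.

Lemma tlift_add_fun (F : fieldType) (V W : lmodType F) (U : zmodType) (g h : V -> W -> U) t :
  tlift (fun v w => g v w + h v w) t = tlift g t + tlift h t.
Proof. by rewrite /tlift /fsum big_split. Qed.

Lemma eq_tlift (F : fieldType) (V W : lmodType F) (U : zmodType) (g h : V -> W -> U) t :
  (forall v w, g v w = h v w) -> tlift g t = tlift h t.
Proof. by move=> e; rewrite /tlift /fsum; apply: eq_bigr. Qed.

Lemma tlift_comp (F : fieldType) (V W : lmodType F) (U U' : zmodType) (g : V -> W -> U) (h : U -> U') t :
  addmap h -> h (tlift g t) = tlift (fun v w => h (g v w)) t.
Proof. by move=> hD; rewrite /tlift /fsum addmap_sum. Qed.

Lemma tlift_semilin (F E : fieldType) (iota : {rmorphism F -> E}) (V W : lmodType F)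
  (M : lmodType E) (g : V -> W -> M) :
  balanced g -> (forall c v w, g (c *: v) w = iota c *: g v w) -> semilin iota (tlift g).
Proof.
move=> gb h; apply: semilinP => [|c]; first exact: tliftD.
apply: tens_ext => [x y|x y|v w]; rewrite ?scalerDr ?tliftD // ?scalerDr //.
by rewrite -tmkZl !tliftE.
Qed.

Lemma balanced_tlift (F : fieldType) (V W X : lmodType F) (U : zmodType) (g : X -> V -> W -> U) :
  (forall x, balanced (g x)) ->
  (forall v w, addmap (fun x => g x v w)) ->
  (forall c x v w, g x (c *: v) w = g (c *: x) v w) ->
  balanced (fun p x => tlift (g x) p).
Proof.
move=> h1 h2 h3; split=> [x p q|p x y|c p x] /=.
- exact: tliftD.
- by rewrite -tlift_add_fun; apply: eq_tlift => v w; rewrite h2.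
- move: p; apply: (@tens_ext _ _ _ _ (fun p => tlift (g x) (c *: p)) (tlift (g (c *: x)))) => [p q|p q|v w].
  + by rewrite scalerDr tliftD.
  + exact: tliftD.
  + by rewrite -tmkZl !tliftE.
Qed.

Lemma tmkDl (F : fieldType) (V W : lmodType F) (w : W) : addmap (fun v : V => v \ot w).
Proof. by case: (@balanced_tmk F V W) => h _ _; apply: h. Qed.
Lemma tmkDr (F : fieldType) (V W : lmodType F) (v : V) : addmap (fun w : W => v \ot w).
Proof. by case: (@balanced_tmk F V W) => _ h _; apply: h. Qed.
Lemma tmkZr (F : fieldType) (V W : lmodType F) c (v : V) (w : W) : v \ot (c *: w) = c *: (v \ot w).
Proof. by rewrite -tmkZl; case: (@balanced_tmk F V W) => _ _ ->. Qed.
Lemma semilin_tmkl (F E : fieldType) (iota : F -> E) (U : lmodType F) (V W : lmodType E) (f : U -> V) (w : W) :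
  semilin iota f -> semilin iota (fun u => f u \ot w).
Proof. by move=> h c u v; rewrite h tmkDl tmkZl. Qed.
Lemma semilin_tmkr (F E : fieldType) (iota : F -> E) (U : lmodType F) (V W : lmodType E) (f : U -> W) (v : V) :
  semilin iota f -> semilin iota (fun u => v \ot f u).
Proof. by move=> h c u u'; rewrite h tmkDr tmkZr. Qed.
End Aux.

(* f and k may be semilinear along a field morphism F -> E. *)
Definition tmap (F E : fieldType) (V W : lmodType F) (V' W' : lmodType E)
    (f : V -> V') (k : W -> W') : tens V W -> tens V' W' :=
  tlift (fun v w => f v \ot k w).

Definition tassoc (F : fieldType) (U V W : lmodType F) :
    tens (tens U V) W -> tens U (tens V W) :=
  tlift (fun p w => tlift (fun u v => u \ot (v \ot w)) p).

Section Tmap.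
Variables (F E : fieldType) (iota : {rmorphism F -> E}) (V W : lmodType F) (V' W' : lmodType E).
Variables (f : V -> V') (k : W -> W').
Hypotheses (fl : semilin iota f) (kl : semilin iota k).
Lemma balanced_tmap : balanced (fun v w => f v \ot k w).
Proof. exact: balanced_semi fl kl (@balanced_tmk _ _ _). Qed.
Lemma tmapE v w : tmap f k (v \ot w) = f v \ot k w.
Proof. by rewrite /tmap tliftE //; apply: balanced_tmap. Qed.
Lemma semilin_tmap : semilin iota (tmap f k).
Proof.
apply: tlift_semilin; first exact: balanced_tmap.
by move=> c v w; rewrite (semilinZ fl) tmkZl.
Qed.
Lemma tmapD : addmap (tmap f k). Proof. exact: semilinD semilin_tmap. Qed.
End Tmap.

Section Tmap2.
Lemma eq_tmap (F E : fieldType) (V W : lmodType F) (V' W' : lmodType E)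
  (f f' : V -> V') (k k' : W -> W') t : f =1 f' -> k =1 k' -> tmap f k t = tmap f' k' t.
Proof. by move=> h1 h2; apply: eq_tlift => v w; rewrite h1 h2. Qed.

Lemma tmap_comp (F E K : fieldType) (i1 : {rmorphism F -> E}) (i2 : {rmorphism E -> K})
  (V W : lmodType F) (V' W' : lmodType E) (V'' W'' : lmodType K)
  (f : V -> V') (k : W -> W') (f' : V' -> V'') (k' : W' -> W'') t :
  semilin i1 f -> semilin i1 k -> semilin i2 f' -> semilin i2 k' ->
  tmap f' k' (tmap f k t) = tmap (fun v => f' (f v)) (fun v => k' (k v)) t.
Proof.
move=> h1 h2 h3 h4.
have h5 : semilin (i2 \o i1) (fun v => f' (f v)) by apply: (semilin_comp _ h1 h3).
have h6 : semilin (i2 \o i1) (fun v => k' (k v)) by apply: (semilin_comp _ h2 h4).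
move: t; apply: tens_ext.
- exact: addmap_comp (tmapD h3 h4) (tmapD h1 h2).
- exact: tmapD h5 h6.
- by move=> v w; rewrite (tmapE h1 h2) (tmapE h3 h4) (tmapE h5 h6).
Qed.

Lemma tmap_id (F : fieldType) (V W : lmodType F) (t : tens V W) : tmap id id t = t.
Proof.
move: t; apply: tens_ext => //; first exact: (@tmapD _ _ idfun).
by move=> v w; rewrite (@tmapE _ _ idfun).
Qed.

Lemma tmap_addl (F E : fieldType) (V W : lmodType F) (V' W' : lmodType E)
  (f f' : V -> V') (k : W -> W') t :
  tmap (fun v => f v + f' v) k t = tmap f k t + tmap f' k t.
Proof. by rewrite /tmap -tlift_add_fun; apply: eq_tlift => v w; rewrite tmkDl. Qed.
Lemma tmap_addr (F E : fieldType) (V W : lmodType F) (V' W' : lmodType E)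
  (f : V -> V') (k k' : W -> W') t :
  tmap f (fun v => k v + k' v) t = tmap f k t + tmap f k' t.
Proof. by rewrite /tmap -tlift_add_fun; apply: eq_tlift => v w; rewrite tmkDr. Qed.

Lemma tmap0l (F E : fieldType) (V W : lmodType F) (V' W' : lmodType E)
  (f : V -> V') (k : W -> W') t : (forall v, f v = 0) -> tmap f k t = 0.
Proof.
move=> h; rewrite /tmap /tlift /fsum big1 // => p _.
by rewrite h; apply: (addmap0 (tmkDl _)).
Qed.
Lemma tmap0r (F E : fieldType) (V W : lmodType F) (V' W' : lmodType E)
  (f : V -> V') (k : W -> W') t : (forall v, k v = 0) -> tmap f k t = 0.
Proof.
move=> h; rewrite /tmap /tlift /fsum big1 // => p _.
by rewrite h; apply: (addmap0 (tmkDr _)).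
Qed.

Section Assoc.
Variables (F : fieldType) (U V W : lmodType F).
Lemma balanced_tassoc1 (w : W) : balanced (fun (u : U) (v : V) => u \ot (v \ot w)).
Proof.
apply: (@balanced_semi F F idfun U V U (tens V W) id (fun v => v \ot w)) => //.
- exact: semilin_tmkl (@semilin_id _ _).
- exact: balanced_tmk.
Qed.
Lemma balanced_tassoc : balanced (fun (p : tens U V) (w : W) => tlift (fun u v => u \ot (v \ot w)) p).
Proof.
apply: balanced_tlift; first exact: balanced_tassoc1.
- by move=> u v w w'; rewrite -!tmkDr.
- by move=> c w u v; rewrite tmkZl !tmkZr.
Qed.
Lemma tassocE u v w : tassoc ((u \ot v) \ot w) = u \ot (v \ot w) :> tens U (tens V W).
Proof.
by rewrite /tassoc tliftE; [rewrite tliftE //; apply: balanced_tassoc1|apply: balanced_tassoc].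
Qed.
Lemma semilin_tassoc : semilin idfun (@tassoc F U V W).
Proof.
apply: (@tlift_semilin _ _ idfun); first exact: balanced_tassoc.
move=> c p w /=; apply: (@semilinZ _ _ idfun).
apply: tlift_semilin; first exact: balanced_tassoc1.
by move=> d u v; rewrite tmkZl.
Qed.

Definition tassocV : tens U (tens V W) -> tens (tens U V) W :=
  tlift (fun u p => tlift (fun v w => (u \ot v) \ot w) p).
Lemma balanced_tassocV1 (u : U) : balanced (fun (v : V) (w : W) => (u \ot v) \ot w).
Proof.
apply: (@balanced_semi F F idfun V W (tens U V) W (fun v => u \ot v) id) => //.
- exact: semilin_tmkr (@semilin_id _ _).
- exact: balanced_tmk.
Qed.
Lemma balanced_tassocV :
  balanced (fun (u : U) (p : tens V W) => tlift (fun v w => (u \ot v) \ot w) p).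
Proof.
split=> [p u u'|u p q|c u p] /=.
- by rewrite -tlift_add_fun; apply: eq_tlift => v w; rewrite -!tmkDl.
- exact: (tliftD (@balanced_tassocV1 u)).
- move: p; apply: (@tens_ext _ _ _ _ (tlift _) (fun p => tlift _ (c *: p))).
  + exact: (tliftD (@balanced_tassocV1 _)).
  + by move=> x y; rewrite scalerDr; apply: (tliftD (@balanced_tassocV1 _)).
  + move=> v w; rewrite -tmkZl (tliftE _ _ (@balanced_tassocV1 _)).
    by rewrite (tliftE _ _ (@balanced_tassocV1 _)) tmkZl tmkZr.
Qed.
Lemma tassocVE u v w : tassocV (u \ot (v \ot w)) = (u \ot v) \ot w.
Proof. by rewrite /tassocV (tliftE _ _ balanced_tassocV) (tliftE _ _ (@balanced_tassocV1 _)). Qed.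
Lemma tassocVS : semilin idfun tassocV.
Proof.
apply: (@tlift_semilin _ _ idfun); first exact: balanced_tassocV.
move=> c u p /=; rewrite tlift_comp; last by move=> x y; rewrite scalerDr.
by apply: eq_tlift => v w; rewrite -!tmkZl.
Qed.
End Assoc.

Lemma tens3_ext (F : fieldType) (V W X : lmodType F) (U : zmodType) (f g : tens (tens V W) X -> U) :
  addmap f -> addmap g -> (forall v w x, f ((v \ot w) \ot x) = g ((v \ot w) \ot x)) -> f =1 g.
Proof.
move=> hf hg h; apply: tens_ext => // p x; move: p; apply: tens_ext => //.
- by apply: (addmap_comp hf (tmkDl _)).
- by apply: (addmap_comp hg (tmkDl _)).
Qed.

Lemma tassoc_nat (F E : fieldType) (i : {rmorphism F -> E}) (U V W : lmodType F) (U' V' W' : lmodType E)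
  (f : U -> U') (g : V -> V') (h : W -> W') t :
  semilin i f -> semilin i g -> semilin i h ->
  tassoc (tmap (tmap f g) h t) = tmap f (tmap g h) (tassoc t).
Proof.
move=> fl gl hl; have fg := semilin_tmap fl gl; have gh := semilin_tmap gl hl.
move: t; apply: tens3_ext.
- exact: addmap_comp (semilinD (@semilin_tassoc _ _ _ _)) (tmapD fg hl).
- exact: addmap_comp (tmapD fl gh) (semilinD (@semilin_tassoc _ _ _ _)).
- by move=> u v w; rewrite (tmapE fg hl) (tmapE fl gl) !tassocE (tmapE fl gh) (tmapE gl hl).
Qed.
End Tmap2.

(* V = V_0 (+) V_1, given by the two projections; V_i is the set of v with
   gcomp i v = v. *)
Record grading (F : fieldType) (V : lmodType F) := Grading {
  gcomp : bool -> V -> V;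
  gcomp_linear : forall i, linear (gcomp i);
  gcompK : forall i j v, gcomp i (gcomp j v) = if i == j then gcomp i v else 0;
  gcompD : forall v, gcomp false v + gcomp true v = v }.

Definition homog (F : fieldType) (V : lmodType F) (g : grading V) (i : bool) (v : V) : Prop :=
  gcomp g i v = v.

Definition tcomp (F : fieldType) (V W : lmodType F) (gV : grading V) (gW : grading W)
    (i : bool) (t : tens V W) : tens V W :=
  tmap (gcomp gV false) (gcomp gW i) t + tmap (gcomp gV true) (gcomp gW (~~ i)) t.

Record superalg (F : fieldType) := Superalg {
  sa_alg :> algType F;
  sa_gr : grading sa_alg;
  sa_one_even : homog sa_gr false 1;
  sa_mul_homog : forall i j a b,
    homog sa_gr i a -> homog sa_gr j b -> homog sa_gr (i (+) j) (a * b) }.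

(* The product of the superalgebra A (x) A:
   (a (x) b)(c (x) d) = (-1)^(|b||c|) ac (x) bd. *)
Definition tsmul (F : fieldType) (A : superalg F) (t u : tens A A) : tens A A :=
  tlift (fun a b => tlift (fun c d =>
    \sum_(i : bool) \sum_(j : bool)
      (-1) ^+ (i && j) *: ((a * gcomp (sa_gr A) j c) \ot (gcomp (sa_gr A) i b * d))) u) t.

(* A commutative Hopf superalgebra over F, i.e. the coordinate ring F[G] of an
   affine group superscheme G over F; the group itself is not a separate object. *)
Record hopf_superalg (F : fieldType) := HopfSuperalg {
  hs_alg :> superalg F;
  hs_comm : forall i j (a b : hs_alg),
    homog (sa_gr hs_alg) i a -> homog (sa_gr hs_alg) j b ->
    a * b = (-1) ^+ (i && j) * (b * a);
  comul : hs_alg -> tens hs_alg hs_alg;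
  counit : hs_alg -> F;
  antip : hs_alg -> hs_alg;
  comul_linear : linear comul;
  counit_linear : scalar counit;
  antip_linear : linear antip;
  comul_even : forall i a,
    comul (gcomp (sa_gr hs_alg) i a) =
    tcomp (sa_gr hs_alg) (sa_gr hs_alg) i (comul a);
  counit_even : forall a, counit (gcomp (sa_gr hs_alg) true a) = 0;
  antip_even : forall i a,
    antip (gcomp (sa_gr hs_alg) i a) = gcomp (sa_gr hs_alg) i (antip a);
  comul1 : comul 1 = 1 \ot 1;
  comulM : forall a b, comul (a * b) = tsmul (comul a) (comul b);
  counit1 : counit 1 = 1;
  counitM : forall a b, counit (a * b) = counit a * counit b;
  coassoc : forall a, tassoc (tmap comul id (comul a)) = tmap id comul (comul a);
  counitl : forall a, tlift (fun b c => counit b *: c) (comul a) = a;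
  counitr : forall a, tlift (fun b c => counit c *: b) (comul a) = a;
  antipl : forall a, tlift (fun b c => antip b * c) (comul a) = (counit a)%:A;
  antipr : forall a, tlift (fun b c => b * antip c) (comul a) = (counit a)%:A }.

Definition rscal (F E : fieldType) (iota : {rmorphism F -> E}) (M : lmodType E) : Type := M.

Section Rscal.
Variables (F E : fieldType) (iota : {rmorphism F -> E}) (M : lmodType E).
HB.instance Definition _ := GRing.Zmodule.copy (rscal iota M) M.
Definition rscale (c : F) (x : rscal iota M) : rscal iota M := (iota c *: (x : M)).
Lemma rscaleA a b v : rscale a (rscale b v) = rscale (a * b) v.
Proof. by rewrite /rscale scalerA rmorphM. Qed.
Lemma rscale1 : left_id 1 rscale.
Proof. by move=> v; rewrite /rscale rmorph1 scale1r. Qed.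
Lemma rscaleDr : right_distributive rscale +%R.
Proof. by move=> c x y; rewrite /rscale; apply: scalerDr. Qed.
Lemma rscaleDl v : {morph rscale^~ v : a b / a + b}.
Proof. by move=> a b; rewrite /rscale rmorphD; apply: scalerDl. Qed.
HB.instance Definition _ := GRing.Zmodule_isLmodule.Build F (rscal iota M)
  rscaleA rscale1 rscaleDr rscaleDl.
Lemma rscalE c (x : rscal iota M) : c *: x = (iota c *: (x : M)) :> M.
Proof. by []. Qed.
End Rscal.

(* E (x)_F V as a vector space over E. *)
Definition bc (F E : fieldType) (iota : {rmorphism F -> E}) (V : lmodType F) : Type :=
  tens (rscal iota E^o) V.

Section Bc.
Variables (F E : fieldType) (iota : {rmorphism F -> E}) (V : lmodType F).
HB.instance Definition _ := GRing.Zmodule.copy (bc iota V) (tens (rscal iota E^o) V).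
Definition bcscale (e : E) (x : bc iota V) : bc iota V :=
  tmap (fun d : rscal iota E^o => e * d : rscal iota E^o) id x.
Lemma semilin_mul e : semilin idfun (fun d : rscal iota E^o => e * d : rscal iota E^o).
Proof.
move=> c u v; rewrite mulrDr; congr (_ + _).
rewrite !rscalE; exact: (@scalerAr _ E^o).
Qed.
Lemma bcscaleE e d v : bcscale e ((d : rscal iota E^o) \ot v) = ((e * d : E) : rscal iota E^o) \ot v.
Proof. by rewrite /bcscale (tmapE (semilin_mul e) (@semilin_id _ _)). Qed.
Lemma bcscaleDr : right_distributive bcscale +%R.
Proof. by move=> c; exact: (tmapD (semilin_mul c) (@semilin_id _ _)). Qed.
Lemma bcscaleA a b v : bcscale a (bcscale b v) = bcscale (a * b) v.
Proof.
move: v; apply: tens_ext.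
- exact: addmap_comp (bcscaleDr a) (bcscaleDr b).
- exact: bcscaleDr.
- by move=> d v; rewrite !bcscaleE mulrA.
Qed.
Lemma bcscale1 : left_id 1 bcscale.
Proof.
apply: tens_ext => //; first exact: (bcscaleDr 1).
by move=> d v; rewrite bcscaleE mul1r.
Qed.
Lemma bcscaleDl v : {morph bcscale^~ v : a b / a + b}.
Proof.
move=> a b; move: v; apply: tens_ext.
- exact: bcscaleDr.
- exact: addmap_add (bcscaleDr a) (bcscaleDr b).
- by move=> d v; rewrite !bcscaleE mulrDl; apply: tmkDl.
Qed.
HB.instance Definition _ := GRing.Zmodule_isLmodule.Build E (bc iota V)
  bcscaleA bcscale1 bcscaleDr bcscaleDl.

Definition bj (v : V) : bc iota V := (1 : rscal iota E^o) \ot v.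

Lemma semilin_bj : semilin iota bj.
Proof.
move=> c u v; rewrite /bj (tmkDr _ (c *: u) v); congr (_ + _).
rewrite tmkZr -tmkZl /GRing.scale /= /GRing.scale /= bcscaleE mulr1.
by rewrite /rscale /GRing.scale /= mulr1.
Qed.

Lemma bjE (d : E) v : ((d : rscal iota E^o) \ot v : bc iota V) = d *: bj v.
Proof. by rewrite [RHS]bcscaleE mulr1. Qed.

Lemma bc_ext0 (U : zmodType) (f g : bc iota V -> U) :
  addmap f -> addmap g -> (forall e v, f (e *: bj v) = g (e *: bj v)) -> f =1 g.
Proof. by move=> h1 h2 h3; apply: tens_ext => // d v; rewrite bjE. Qed.

Lemma bc_ext (K : fieldType) (s : {rmorphism E -> K}) (M : lmodType K) (f g : bc iota V -> M) :
  semilin s f -> semilin s g -> (forall v, f (bj v) = g (bj v)) -> f =1 g.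
Proof.
move=> h1 h2 h3; apply: bc_ext0; [exact: semilinD h1|exact: semilinD h2|].
by move=> e v; rewrite (semilinZ h1) (semilinZ h2) h3.
Qed.

(* The E-linear extension of a semilinear map. *)
Definition bclift (M : lmodType E) (h : V -> M) : bc iota V -> M :=
  tlift (fun (e : rscal iota E^o) v => (e : E) *: h v).

Section Lift.
Variables (M : lmodType E) (h : V -> M).
Hypothesis (hl : semilin iota h).
Lemma balanced_bclift : balanced (fun (e : rscal iota E^o) v => (e : E) *: h v).
Proof.
split=> [v d e|d v w|c e v] /=.
- by apply: scalerDl.
- by rewrite (semilinD hl) scalerDr.
- by rewrite (semilinZ hl) scalerA mulrC.
Qed.
Lemma bcliftE v : bclift h (bj v) = h v.
Proof. by rewrite /bclift tliftE ?scale1r //; apply: balanced_bclift. Qed.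
Lemma bcliftD : addmap (bclift h).
Proof. exact: (tliftD balanced_bclift). Qed.
Lemma semilin_bclift : semilin idfun (bclift h).
Proof.
apply: semilinP => [|c]; first exact: bcliftD.
apply: bc_ext0.
- move=> x y; rewrite scalerDr; exact: bcliftD.
- by move=> x y; rewrite bcliftD scalerDr.
- move=> e v; rewrite scalerA -!bjE /bclift !tliftE ?scalerA //; exact: balanced_bclift.
Qed.
End Lift.
Lemma eq_bclift (M : lmodType E) (h k : V -> M) x : h =1 k -> bclift h x = bclift k x.
Proof. by move=> e; apply: eq_tlift => d v; rewrite e. Qed.
End Bc.
Arguments bj {F E} iota {V} v.
Arguments bclift {F E} iota {V M} h.
Arguments semilin_bj {F E} iota V.

Section GradingFacts.
Variables (F : fieldType).
Lemma gcompS (V : lmodType F) (g : grading V) i : semilin idfun (gcomp g i).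
Proof. exact: gcomp_linear. Qed.

Arguments gcompS {V} g i.
Lemma tcompS (V W : lmodType F) (gV : grading V) (gW : grading W) i :
  semilin idfun (tcomp gV gW i).
Proof.
by apply: semilin_add; apply: semilin_tmap; apply: gcompS.
Qed.

Lemma tcompE (V W : lmodType F) (gV : grading V) (gW : grading W) i v w :
  tcomp gV gW i (v \ot w) =
  gcomp gV false v \ot gcomp gW i w + gcomp gV true v \ot gcomp gW (~~ i) w.
Proof. by rewrite /tcomp !(tmapE (gcompS _ _) (gcompS _ _)). Qed.
End GradingFacts.

Lemma tcomp_nat (F E : fieldType) (i : {rmorphism F -> E}) (V W : lmodType F) (V' W' : lmodType E)
  (gV : grading V) (gW : grading W) (gV' : grading V') (gW' : grading W')
  (f : V -> V') (k : W -> W') b t :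
  semilin i f -> semilin i k ->
  (forall b v, f (gcomp gV b v) = gcomp gV' b (f v)) ->
  (forall b v, k (gcomp gW b v) = gcomp gW' b (k v)) ->
  tmap f k (tcomp gV gW b t) = tcomp gV' gW' b (tmap f k t).
Proof.
move=> fl kl fe ke; move: t; apply: tens_ext.
- exact: addmap_comp (tmapD fl kl) (semilinD (tcompS _ _ _)).
- exact: addmap_comp (semilinD (tcompS _ _ _)) (tmapD fl kl).
- by move=> v w; rewrite tcompE (tmapD fl kl) !(tmapE fl kl) tcompE !fe !ke.
Qed.

Section BcGrading.
Variables (F E : fieldType) (iota : {rmorphism F -> E}) (V : lmodType F) (g : grading V).
Definition bccomp (i : bool) : bc iota V -> bc iota V :=
  bclift iota (fun v => bj iota (gcomp g i v)).
Lemma semilin_bjcomp i : semilin iota (fun v => bj iota (gcomp g i v)).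
Proof. exact: semilin_compr (gcompS g i) (semilin_bj _ _). Qed.
Lemma bccomp_lin i : semilin idfun (bccomp i).
Proof. exact: semilin_bclift (semilin_bjcomp i). Qed.
Lemma bccompE i v : bccomp i (bj iota v) = bj iota (gcomp g i v).
Proof. exact: bcliftE (semilin_bjcomp i) _. Qed.
Lemma bccompK i j x : bccomp i (bccomp j x) = if i == j then bccomp i x else 0.
Proof.
move: x; apply: (@bc_ext _ _ _ _ _ idfun).
- exact: semilin_compl (bccomp_lin j) (bccomp_lin i).
- case: (i == j); first exact: bccomp_lin.
  by move=> c u v; rewrite scaler0 addr0.
- move=> v; rewrite !bccompE gcompK; case: (i == j) => //.
  exact: semilin0 (semilin_bj _ _).
Qed.
Lemma bccompD x : bccomp false x + bccomp true x = x.
Proof.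
move: x; apply: (@bc_ext _ _ _ _ _ idfun) => //.
- by apply: semilin_add; apply: bccomp_lin.
- by move=> v; rewrite !bccompE -(semilinD (semilin_bj _ _)) gcompD.
Qed.
Definition bc_grading : grading (bc iota V) := Grading bccomp_lin bccompK bccompD.
End BcGrading.

Section SuperalgFacts.
Variables (F : fieldType) (A : superalg F).
Notation cp := (gcomp (sa_gr A)).
Lemma comp_mul i j (a b : A) : cp (i (+) j) (cp i a * cp j b) = cp i a * cp j b.
Proof. by apply: sa_mul_homog; rewrite /homog gcompK eqxx. Qed.

Definition tsm1 (c d a b : A) : tens A A :=
  \sum_(i : bool) \sum_(j : bool)
      (-1) ^+ (i && j) *: ((a * cp j c) \ot (cp i b * d)).

Lemma mulSl (b : A) : semilin idfun (fun a : A => a * b).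
Proof. by move=> c u v; rewrite mulrDl scalerAl. Qed.
Lemma mulSr (b : A) : semilin idfun (fun a : A => b * a).
Proof. by move=> c u v; rewrite mulrDr scalerAr. Qed.

Lemma balanced_sum (V W : lmodType F) (U : zmodType) (I : finType) (g : I -> V -> W -> U) :
  (forall i, balanced (g i)) -> balanced (fun v w => \sum_i g i v w).
Proof.
move=> h; split=> [w v v'|v w w'|c v w] /=; rewrite -?big_split; apply: eq_bigr => i _ /=;
by case: (h i) => h1 h2 h3; rewrite ?h1 ?h2 ?h3.
Qed.

Lemma balanced_tsm1 c d : balanced (tsm1 c d).
Proof.
apply: balanced_sum => i; apply: balanced_sum => j.
apply: (balanced_post (h := fun x => (-1) ^+ (i && j) *: x)).
  by move=> x y; rewrite scalerDr.
apply: (@balanced_semi _ _ idfun _ _ _ _ (fun a => a * cp j c) (fun b => cp i b * d)).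
- exact: mulSl.
- exact: semilin_compl (gcompS _ i) (mulSl d).
- exact: balanced_tmk.
Qed.
Arguments balanced_tsm1 c d : clear implicits.
Lemma balanced_tsm2 a b : balanced (fun c d => tsm1 c d a b).
Proof.
apply: balanced_sum => i; apply: balanced_sum => j.
apply: (balanced_post (h := fun x => (-1) ^+ (i && j) *: x)).
  by move=> x y; rewrite scalerDr.
apply: (@balanced_semi _ _ idfun _ _ _ _ (fun c => a * cp j c) (fun d => cp i b * d)).
- exact: semilin_compl (gcompS _ j) (mulSr a).
- exact: mulSr.
- exact: balanced_tmk.
Qed.
Arguments balanced_tsm2 a b : clear implicits.
Lemma balanced_tsm3 (u : tens A A) : balanced (fun a b => tlift (fun c d => tsm1 c d a b) u).
Proof.
split=> [b a a'|a b b'|e a b] /=.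
- rewrite -tlift_add_fun; apply: eq_tlift => c d.
  by case: (@balanced_tsm1 c d) => h _ _; apply: h.
- rewrite -tlift_add_fun; apply: eq_tlift => c d.
  by case: (balanced_tsm1 c d) => _ h _; apply: h.
- apply: eq_tlift => c d.
  by case: (balanced_tsm1 c d) => _ _ h; apply: h.
Qed.
Arguments balanced_tsm3 u : clear implicits.
Lemma tsmulDl (u : tens A A) : addmap (fun t => tsmul t u).
Proof. exact: tliftD (balanced_tsm3 u). Qed.
Lemma tsmulDr (t : tens A A) : addmap (tsmul t).
Proof.
move=> u v; rewrite -tlift_add_fun; apply: eq_tlift => a b.
exact: (tliftD (balanced_tsm2 a b)).
Qed.
Lemma tsmulE (a b c d : A) : tsmul (a \ot b) (c \ot d) = tsm1 c d a b.
Proof.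
by rewrite /tsmul (tliftE _ _ (balanced_tsm3 _)) (tliftE _ _ (balanced_tsm2 _ _)).
Qed.
Lemma tsmulZl e (t u : tens A A) : tsmul (e *: t) u = e *: tsmul t u.
Proof.
move: t; apply: tens_ext => [x y|x y|a b].
- by rewrite scalerDr tsmulDl.
- by rewrite tsmulDl scalerDr.
- rewrite -tmkZl; move: u; apply: tens_ext.
  + exact: tsmulDr.
  + by move=> x y; rewrite tsmulDr scalerDr.
  + move=> c d; rewrite !tsmulE /tsm1 scaler_sumr; apply: eq_bigr => i _.
    rewrite scaler_sumr; apply: eq_bigr => j _.
    rewrite scalerA mulrC -scalerA. congr (_ *: _).
    by rewrite -tmkZl scalerAl.
Qed.
Lemma tsmulZr e (t u : tens A A) : tsmul t (e *: u) = e *: tsmul t u.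
Proof.
move: t; apply: tens_ext => [x y|x y|a b].
- by rewrite tsmulDl.
- by rewrite tsmulDl scalerDr.
- move: u; apply: tens_ext => [x y|x y|c d].
  + by rewrite scalerDr tsmulDr.
  + by rewrite tsmulDr scalerDr.
  + rewrite -tmkZl !tsmulE /tsm1 scaler_sumr; apply: eq_bigr => i _.
    rewrite scaler_sumr; apply: eq_bigr => j _.
    rewrite scalerA mulrC -scalerA; congr (_ *: _).
    by rewrite -tmkZl (semilinZ (gcompS _ _)) scalerAr.
Qed.
End SuperalgFacts.

Section HopfFacts.
Variables (F : fieldType) (A : hopf_superalg F).
Lemma comulS : semilin idfun (@comul F A). Proof. exact: comul_linear. Qed.
Lemma antipS : semilin idfun (@antip F A). Proof. exact: antip_linear. Qed.
Lemma counitS : semilin idfun (fun a : A => counit a : F^o). Proof. exact: counit_linear. Qed.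
Lemma balanced_counitl (V : lmodType F) : balanced (fun (a : A) (v : V) => counit a *: v).
Proof.
split=> [v a b|a v w|c a v] /=.
- by rewrite (semilinD counitS) scalerDl.
- by rewrite scalerDr.
- by rewrite (semilinZ counitS) scalerA mulrC.
Qed.
Lemma balanced_counitr (V : lmodType F) : balanced (fun (v : V) (a : A) => counit a *: v).
Proof.
split=> [a v w|v a b|c a v] /=.
- by rewrite scalerDr.
- by rewrite (semilinD counitS) scalerDl.
- by rewrite (semilinZ counitS) scalerA mulrC.
Qed.
Lemma balanced_antipl : balanced (fun a b : A => antip a * b).
Proof.
split=> [v a b|a v w|c a v] /=.
- by rewrite (semilinD antipS) mulrDl.
- by rewrite mulrDr.
- by rewrite (semilinZ antipS) -scalerAl scalerAr.
Qed.
Lemma balanced_antipr : balanced (fun a b : A => a * antip b).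
Proof.
split=> [v a b|a v w|c a v] /=.
- by rewrite mulrDl.
- by rewrite (semilinD antipS) mulrDr.
- by rewrite (semilinZ antipS) -scalerAl scalerAr.
Qed.
Lemma counitZA e (a : A) : counit (e *: a) = e * counit a.
Proof. exact: (semilinZ counitS). Qed.
End HopfFacts.

(* bc iota A again; the ring structure needs the counit of A, which shows that
   1 (x) 1 is nonzero. *)
Definition bcA (F E : fieldType) (iota : {rmorphism F -> E}) (A : hopf_superalg F) : Type :=
  bc iota A.

Section BcHopf.
Variables (F E : fieldType) (iota : {rmorphism F -> E}) (A : hopf_superalg F).
Notation B := (bcA iota A).
Notation j := (bj iota).
HB.instance Definition _ := GRing.Lmodule.copy B (bc iota A).
Lemma bchS : semilin iota (j : A -> B).
Proof. exact: semilin_bj iota A. Qed.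

Definition bcmul (x y : B) : B :=
  bclift iota (fun a : A => bclift iota (fun b : A => (j (a * b) : B)) y) x.
Lemma bcm1S (a : A) : semilin iota (fun b : A => j (a * b) : B).
Proof. exact: semilin_compr (mulSr a) bchS. Qed.
Lemma bcm2S (y : B) : semilin iota (fun a : A => bclift iota (fun b : A => (j (a * b) : B)) y).
Proof.
move=> c u v; move: y; apply: (@bc_ext _ _ _ _ _ idfun).
- exact: semilin_bclift (bcm1S _).
- apply: semilin_add; last exact: semilin_bclift (bcm1S _).
  exact: semilin_compl (semilin_bclift (bcm1S _)) (@semilin_scale _ _ _).
- by move=> b; rewrite !(bcliftE (bcm1S _)) mulrDl -scalerAl bchS.
Qed.
Lemma bcmulSl y : semilin idfun (fun x => bcmul x y).
Proof. exact: semilin_bclift (bcm2S y). Qed.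
Lemma bcmulSr x : semilin idfun (bcmul x).
Proof.
move=> c u v; move: x; apply: (@bc_ext _ _ _ _ _ idfun).
- exact: bcmulSl.
- apply: semilin_add; last exact: bcmulSl.
  exact: semilin_compl (bcmulSl _) (@semilin_scale _ _ _).
- by move=> a; rewrite /bcmul !(bcliftE (bcm2S _)) (semilin_bclift (bcm1S a)).
Qed.
Lemma bcmulE (a b : A) : bcmul (j a) (j b) = j (a * b).
Proof. by rewrite /bcmul (bcliftE (bcm2S _)) (bcliftE (bcm1S _)). Qed.

Lemma bcmulA : associative bcmul.
Proof.
move=> x y z; move: x; apply: (@bc_ext _ _ _ _ _ idfun).
- exact: bcmulSl.
- exact: semilin_compl (bcmulSl y) (bcmulSl z).
move=> a; move: y; apply: (@bc_ext _ _ _ _ _ idfun).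
- exact: semilin_compl (bcmulSl z) (bcmulSr (j a)).
- exact: semilin_compl (bcmulSr (j a)) (bcmulSl z).
move=> b; move: z; apply: (@bc_ext _ _ _ _ _ idfun).
- exact: semilin_compl (bcmulSr _) (bcmulSr (j a)).
- exact: bcmulSr.
by move=> c; rewrite !bcmulE mulrA.
Qed.
Lemma bcmul1l : left_id (j (1 : A)) bcmul.
Proof.
move=> x; move: x; apply: (@bc_ext _ _ _ _ _ idfun) => //; first exact: bcmulSr.
by move=> a; rewrite bcmulE mul1r.
Qed.
Lemma bcmul1r : right_id (j (1 : A)) bcmul.
Proof.
move=> x; move: x; apply: (@bc_ext _ _ _ _ _ idfun) => //; first exact: bcmulSl.
by move=> a; rewrite bcmulE mulr1.
Qed.
Lemma bcmulDl : left_distributive bcmul +%R.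
Proof. by move=> x y z; apply: (semilinD (bcmulSl z)). Qed.
Lemma bcmulDr : right_distributive bcmul +%R.
Proof. by move=> x y z; apply: (semilinD (bcmulSr x)). Qed.

Definition bccounit : B -> E := bclift iota (fun a : A => iota (counit a) : E^o).
Lemma bccounit0S : semilin iota (fun a : A => iota (counit a) : E^o).
Proof. by move=> c u v; rewrite counit_linear rmorphD rmorphM. Qed.
Lemma bccounitE a : bccounit (j a) = iota (counit a).
Proof. exact: bcliftE bccounit0S a. Qed.
Lemma bccounitS : semilin idfun (bccounit : B -> E^o).
Proof. exact: semilin_bclift bccounit0S. Qed.

Lemma bc1_neq0 : (j (1 : A) : B) != 0.
Proof.
apply/eqP => /(congr1 bccounit); rewrite bccounitE counit1 rmorph1 (semilin0 bccounitS).
by move/eqP; rewrite oner_eq0.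
Qed.
HB.instance Definition _ := GRing.Zmodule_isNzRing.Build B
  bcmulA bcmul1l bcmul1r bcmulDl bcmulDr bc1_neq0.
Lemma bcscalerAl (c : E) (x y : B) : c *: (x * y) = (c *: x) * y.
Proof. by rewrite [RHS](semilinZ (bcmulSl y)). Qed.
HB.instance Definition _ := GRing.Lmodule_isLalgebra.Build E B bcscalerAl.
Lemma bcscalerAr (c : E) (x y : B) : c *: (x * y) = x * (c *: y).
Proof. by rewrite [RHS](semilinZ (bcmulSr x)). Qed.
HB.instance Definition _ := GRing.Lalgebra_isAlgebra.Build E B bcscalerAr.

Lemma bjM (a b : A) : (j a : B) * j b = j (a * b).
Proof. exact: bcmulE. Qed.
Lemma bj1 : (j (1 : A) : B) = 1.
Proof. by []. Qed.

Notation gB := (bc_grading iota (sa_gr A) : grading B).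

Lemma gBE i (a : A) : gcomp gB i (j a) = j (gcomp (sa_gr A) i a).
Proof. exact: bccompE. Qed.

Lemma bc_one_even : homog gB false 1.
Proof. by rewrite /homog -bj1 gBE; congr (j _); apply: sa_one_even. Qed.
Lemma bc_mul_homog i k (x y : B) :
  homog gB i x -> homog gB k y -> homog gB (i (+) k) (x * y).
Proof.
rewrite /homog => <- <-; move: x; apply: (@bc_ext _ _ _ _ _ idfun).
- apply: semilin_compl (gcompS gB _).
  exact: semilin_compl (gcompS gB i) (bcmulSl _).
- exact: semilin_compl (gcompS gB i) (bcmulSl _).
move=> a; move: y; apply: (@bc_ext _ _ _ _ _ idfun).
- apply: semilin_compl (gcompS gB _).
  exact: semilin_compl (gcompS gB k) (bcmulSr _).
- exact: semilin_compl (gcompS gB k) (bcmulSr _).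
by move=> b; rewrite !gBE bjM gBE comp_mul.
Qed.
Definition bcSA : superalg E := Superalg bc_one_even bc_mul_homog.

Lemma bc_comm i k (x y : bcSA) :
  homog (sa_gr bcSA) i x -> homog (sa_gr bcSA) k y ->
  x * y = (-1) ^+ (i && k) * (y * x).
Proof.
have sgnE (C : algType E) (z : C) : (-1) ^+ (i && k) * z = (-1 : E) ^+ (i && k) *: z.
  by case: (i && k); rewrite ?expr0 ?expr1 ?mul1r ?scale1r ?mulN1r ?scaleN1r.
have sgnE' (z : A) : (-1) ^+ (i && k) * z = (-1 : F) ^+ (i && k) *: z.
  by case: (i && k); rewrite ?expr0 ?expr1 ?mul1r ?scale1r ?mulN1r ?scaleN1r.
rewrite /homog sgnE => <- <-; move: x; apply: (@bc_ext _ _ _ _ _ idfun).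
- exact: semilin_compl (gcompS gB i) (bcmulSl _).
- apply: semilin_compl (@semilin_scale _ _ _).
  exact: semilin_compl (gcompS gB i) (bcmulSr _).
move=> a; move: y; apply: (@bc_ext _ _ _ _ _ idfun).
- exact: semilin_compl (gcompS gB k) (bcmulSr _).
- apply: semilin_compl (@semilin_scale _ _ _).
  exact: semilin_compl (gcompS gB k) (bcmulSl _).
move=> b; rewrite [gcomp _ i _]gBE [gcomp _ k _]gBE !bjM (@hs_comm _ A i k).
- by rewrite sgnE' (semilinZ bchS) rmorphXn rmorphN rmorph1.
- by rewrite /homog gcompK eqxx.
- by rewrite /homog gcompK eqxx.
Qed.

Notation jj := (tmap (j : A -> bcSA) (j : A -> bcSA)).
Lemma bchhS : semilin iota jj.
Proof. exact: semilin_tmap bchS bchS. Qed.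

Definition bccomul : bcSA -> tens bcSA bcSA := bclift iota (fun a : A => jj (comul a)).
Lemma bccomul0S : semilin iota (fun a : A => jj (comul a)).
Proof. exact: semilin_compr (@comulS _ A) bchhS. Qed.
Lemma bccomulE a : bccomul (j a) = jj (comul a).
Proof. exact: bcliftE bccomul0S a. Qed.
Lemma bccomulS : semilin idfun bccomul.
Proof. exact: semilin_bclift bccomul0S. Qed.

Definition bcantip : bcSA -> bcSA := bclift iota (fun a : A => j (antip a)).
Lemma bcantip0S : semilin iota (fun a : A => j (antip a)).
Proof. exact: semilin_compr (@antipS _ A) bchS. Qed.
Lemma bcantipE a : bcantip (j a) = j (antip a).
Proof. exact: bcliftE bcantip0S a. Qed.
Lemma bcantipS : semilin idfun bcantip.
Proof. exact: semilin_bclift bcantip0S. Qed.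

Lemma bccomul_even i x :
  bccomul (gcomp (sa_gr bcSA) i x) = tcomp (sa_gr bcSA) (sa_gr bcSA) i (bccomul x).
Proof.
move: x; apply: (@bc_ext _ _ _ _ _ idfun).
- exact: semilin_compl (gcompS gB i) bccomulS.
- exact: semilin_compl bccomulS (tcompS _ _ _).
move=> a; rewrite [gcomp _ _ _]gBE !bccomulE comul_even.
by apply: (tcomp_nat _ _ bchS bchS) => b c; rewrite [RHS]gBE.
Qed.
Lemma bccounit_even x : bccounit (gcomp (sa_gr bcSA) true x) = 0.
Proof.
move: x; apply: (@bc_ext _ _ _ _ _ idfun E^o).
- exact: semilin_compl (gcompS gB true) bccounitS.
- by move=> c u v; rewrite scaler0 addr0.
by move=> a; rewrite [gcomp _ _ _]gBE bccounitE counit_even rmorph0.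
Qed.
Lemma bcantip_even i x :
  bcantip (gcomp (sa_gr bcSA) i x) = gcomp (sa_gr bcSA) i (bcantip x).
Proof.
move: x; apply: (@bc_ext _ _ _ _ _ idfun).
- exact: semilin_compl (gcompS gB i) bcantipS.
- exact: semilin_compl bcantipS (gcompS gB i).
by move=> a; rewrite [gcomp _ _ _]gBE !bcantipE antip_even [RHS]gBE.
Qed.
Lemma bccomul1 : bccomul 1 = 1 \ot 1.
Proof. by rewrite -[X in bccomul X]bj1 bccomulE comul1 (tmapE bchS bchS). Qed.

Lemma jj_tsmul t u : jj (tsmul t u) = tsmul (jj t) (jj u).
Proof.
move: t; apply: tens_ext.
- exact: addmap_comp (semilinD bchhS) (tsmulDl u).
- exact: addmap_comp (tsmulDl (jj u)) (semilinD bchhS).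
move=> a b; move: u; apply: tens_ext.
- exact: addmap_comp (semilinD bchhS) (tsmulDr _).
- exact: addmap_comp (tsmulDr _) (semilinD bchhS).
move=> c d; rewrite tsmulE !(tmapE bchS bchS) tsmulE /tsm1 (addmap_sum _ _ _ (semilinD bchhS)).
apply: eq_bigr => i _; rewrite (addmap_sum _ _ _ (semilinD bchhS)); apply: eq_bigr => k _.
rewrite (semilinZ bchhS) (tmapE bchS bchS) rmorphXn rmorphN rmorph1.
by rewrite ![gcomp (sa_gr bcSA) _ _]gBE !bjM.
Qed.

Lemma bccomulM x y : bccomul (x * y) = tsmul (bccomul x) (bccomul y).
Proof.
move: x; apply: (@bc_ext _ _ _ _ _ idfun).
- exact: semilin_compl (bcmulSl y) bccomulS.
- apply: semilinP => [|c u].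
    exact: addmap_comp (tsmulDl _) (semilinD bccomulS).
  by rewrite (semilinZ bccomulS) tsmulZl.
move=> a; move: y; apply: (@bc_ext _ _ _ _ _ idfun).
- exact: semilin_compl (bcmulSr _) bccomulS.
- apply: semilinP => [|c u].
    exact: addmap_comp (tsmulDr _) (semilinD bccomulS).
  by rewrite (semilinZ bccomulS) tsmulZr.
by move=> b; rewrite bjM !bccomulE comulM jj_tsmul.
Qed.
Lemma bccounit1 : bccounit 1 = 1.
Proof. by rewrite -[X in bccounit X]bj1 bccounitE counit1 rmorph1. Qed.
Lemma bccounitM x y : bccounit (x * y) = bccounit x * bccounit y.
Proof.
move: x; apply: (@bc_ext _ _ _ _ _ idfun E^o).
- exact: semilin_compl (bcmulSl y) bccounitS.
- move=> c u v; rewrite bccounitS mulrDl; congr (_ + _).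
  by rewrite /GRing.scale /= mulrA.
move=> a; move: y; apply: (@bc_ext _ _ _ _ _ idfun E^o).
- exact: semilin_compl (bcmulSr _) bccounitS.
- move=> c u v; rewrite bccounitS mulrDr; congr (_ + _).
  by rewrite /GRing.scale /= mulrCA.
by move=> b; rewrite bjM !bccounitE counitM rmorphM.
Qed.

Lemma bccoassoc x : tassoc (tmap bccomul id (bccomul x)) = tmap id bccomul (bccomul x).
Proof.
have idS := @semilin_id E bcSA.
move: x; apply: (@bc_ext _ _ _ _ _ idfun).
- apply: semilin_compl (@semilin_tassoc _ _ _ _).
  exact: semilin_compl bccomulS (semilin_tmap bccomulS idS).
- exact: semilin_compl bccomulS (semilin_tmap idS bccomulS).
move=> a; rewrite !bccomulE (tmap_comp _ bchS bchS bccomulS idS) (tmap_comp _ bchS bchS idS bccomulS).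
rewrite (@eq_tmap _ _ _ _ _ _ _ (fun b => jj (comul b)) _ j); [|exact: bccomulE|by []].
rewrite (@eq_tmap _ _ _ _ _ _ (fun v => id (j v)) j _ (fun b => jj (comul b))); [|by []|exact: bccomulE].
have idA := @semilin_id F A; have cS := @comulS F A.
rewrite -(tmap_comp _ cS idA bchhS bchS) -(tmap_comp _ idA cS bchS bchhS).
by rewrite (tassoc_nat _ bchS bchS bchS) coassoc.
Qed.
Lemma bccounitl x : tlift (fun b c => bccounit b *: c) (bccomul x) = x.
Proof.
have bal : balanced (fun (b c : bcSA) => bccounit b *: c).
  split=> [v a b|a v w|c a v] /=.
  - by rewrite (semilinD bccounitS) scalerDl.
  - by rewrite scalerDr.
  - by rewrite (semilinZ bccounitS) scalerA mulrC.
move: x; apply: (@bc_ext _ _ _ _ _ idfun) => //.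
- apply: semilin_compl bccomulS _; apply: tlift_semilin => // c v w.
  by rewrite (semilinZ bccounitS) scalerA.
move=> a; rewrite bccomulE -[in RHS](counitl a).
have balA := @balanced_counitl F A A.
move: (comul a); apply: tens_ext.
- exact: addmap_comp (tliftD bal) (semilinD bchhS).
- exact: addmap_comp (semilinD bchS) (tliftD balA).
by move=> b c; rewrite (tmapE bchS bchS) (tliftE _ _ bal) (tliftE _ _ balA) (semilinZ bchS) bccounitE.
Qed.
Lemma bccounitr x : tlift (fun b c => bccounit c *: b) (bccomul x) = x.
Proof.
have bal : balanced (fun (b c : bcSA) => bccounit c *: b).
  split=> [v a b|a v w|c a v] /=.
  - by rewrite scalerDr.
  - by rewrite (semilinD bccounitS) scalerDl.
  - by rewrite (semilinZ bccounitS) scalerA mulrC.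
move: x; apply: (@bc_ext _ _ _ _ _ idfun) => //.
- apply: semilin_compl bccomulS _; apply: tlift_semilin => // c v w.
  by rewrite !scalerA mulrC.
move=> a; rewrite bccomulE -[in RHS](counitr a).
have balA := @balanced_counitr F A A.
move: (comul a); apply: tens_ext.
- exact: addmap_comp (tliftD bal) (semilinD bchhS).
- exact: addmap_comp (semilinD bchS) (tliftD balA).
by move=> b c; rewrite (tmapE bchS bchS) (tliftE _ _ bal) (tliftE _ _ balA) (semilinZ bchS) bccounitE.
Qed.
Lemma bcantipl x : tlift (fun b c => bcantip b * c) (bccomul x) = (bccounit x)%:A.
Proof.
have bal : balanced (fun (b c : bcSA) => bcantip b * c).
  split=> [v a b|a v w|c a v] /=.
  - by rewrite (semilinD bcantipS) mulrDl.
  - by rewrite mulrDr.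
  - by rewrite (semilinZ bcantipS) -scalerAl scalerAr.
move: x; apply: (@bc_ext _ _ _ _ _ idfun) => //.
- apply: semilin_compl bccomulS _; apply: tlift_semilin => // c v w.
  by rewrite (semilinZ bcantipS) scalerAl.
- by move=> c u v; rewrite bccounitS scalerDl scalerA.
move=> a; rewrite bccomulE bccounitE -[X in _ = _ *: X]bj1 -(semilinZ bchS) -antipl.
have balA := @balanced_antipl F A.
move: (comul a); apply: tens_ext.
- exact: addmap_comp (tliftD bal) (semilinD bchhS).
- exact: addmap_comp (semilinD bchS) (tliftD balA).
by move=> b c; rewrite (tmapE bchS bchS) (tliftE _ _ bal) (tliftE _ _ balA) bcantipE bjM.
Qed.
Lemma bcantipr x : tlift (fun b c => b * bcantip c) (bccomul x) = (bccounit x)%:A.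
Proof.
have bal : balanced (fun (b c : bcSA) => b * bcantip c).
  split=> [v a b|a v w|c a v] /=.
  - by rewrite mulrDl.
  - by rewrite (semilinD bcantipS) mulrDr.
  - by rewrite (semilinZ bcantipS) -scalerAl scalerAr.
move: x; apply: (@bc_ext _ _ _ _ _ idfun) => //.
- apply: semilin_compl bccomulS _; apply: tlift_semilin => // c v w.
  by rewrite scalerAl.
- by move=> c u v; rewrite bccounitS scalerDl scalerA.
move=> a; rewrite bccomulE bccounitE -[X in _ = _ *: X]bj1 -(semilinZ bchS) -antipr.
have balA := @balanced_antipr F A.
move: (comul a); apply: tens_ext.
- exact: addmap_comp (tliftD bal) (semilinD bchhS).
- exact: addmap_comp (semilinD bchS) (tliftD balA).
by move=> b c; rewrite (tmapE bchS bchS) (tliftE _ _ bal) (tliftE _ _ balA) bcantipE bjM.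
Qed.

Definition base_changeH : hopf_superalg E :=
  HopfSuperalg bc_comm bccomulS bccounitS bcantipS bccomul_even bccounit_even
    bcantip_even bccomul1 bccomulM bccounit1 bccounitM bccoassoc bccounitl bccounitr
    bcantipl bcantipr.
End BcHopf.

Notation hs_gr A := (sa_gr (hs_alg A)).

(* Right supercomodules over A, which stands for F[G]; no finiteness of the
   dimension is assumed. *)
Record rep (F : fieldType) (A : hopf_superalg F) := Rep {
  rep_mod :> lmodType F;
  rep_gr : grading rep_mod;
  coact : rep_mod -> tens rep_mod A;
  coact_linear : linear coact;
  coact_even : forall i v,
    coact (gcomp rep_gr i v) = tcomp rep_gr (hs_gr A) i (coact v);
  coact_assoc : forall v, tassoc (tmap coact id (coact v)) = tmap id (@comul F A) (coact v);
  coact_counit : forall v, tlift (fun w (a : A) => counit a *: w) (coact v) = v }.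

Lemma coactS (F : fieldType) (A : hopf_superalg F) (V : rep A) : semilin idfun (@coact F A V).
Proof. exact: coact_linear. Qed.

Arguments coactS {F A} V.

Section Parity.
Variables (F : fieldType) (A : hopf_superalg F) (V : rep A).
Definition par_comp (i : bool) : V -> V := gcomp (rep_gr V) (~~ i).
Lemma par_comp_linear i : linear (par_comp i).
Proof. exact: gcomp_linear. Qed.
Lemma par_compK i j v : par_comp i (par_comp j v) = if i == j then par_comp i v else 0.
Proof. by rewrite /par_comp gcompK (inj_eq negb_inj). Qed.
Lemma par_compD v : par_comp false v + par_comp true v = v.
Proof. by rewrite /par_comp addrC gcompD. Qed.
Definition par_gr : grading V := Grading par_comp_linear par_compK par_compD.
Lemma par_coact_even i v :
  coact (gcomp par_gr i v) = tcomp par_gr (hs_gr A) i (coact v).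
Proof. by rewrite /= /par_comp coact_even /tcomp /= /par_comp negbK addrC. Qed.
Definition parity_change : rep A :=
  Rep (@coact_linear _ _ V) par_coact_even (@coact_assoc _ _ V) (@coact_counit _ _ V).
End Parity.

Section BcRep.
Variables (F E : fieldType) (iota : {rmorphism F -> E}) (A : hopf_superalg F) (V : rep A).
Notation B := (base_changeH iota A).
Notation jV := (bj iota : V -> bc iota V).
Notation jA := (bj iota : A -> B).
Lemma bcr_jVS : semilin iota jV.
Proof. exact: semilin_bj iota V. Qed.
Lemma bcr_jAS : semilin iota jA.
Proof. exact: semilin_bj iota A. Qed.
Notation jj := (tmap jV jA).
Lemma bcr_jjS : semilin iota jj.
Proof. exact: semilin_tmap bcr_jVS bcr_jAS. Qed.
Definition bccoact : bc iota V -> tens (bc iota V) B := bclift iota (fun v => jj (coact v)).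
Lemma bccoact0S : semilin iota (fun v => jj (coact v)).
Proof. exact: semilin_compr (coactS V) bcr_jjS. Qed.
Lemma bccoactE v : bccoact (jV v) = jj (coact v).
Proof. exact: bcliftE bccoact0S v. Qed.
Lemma bccoactS : semilin idfun bccoact.
Proof. exact: semilin_bclift bccoact0S. Qed.
Notation gB := (bc_grading iota (rep_gr V)).
Lemma bccoact_even i x : bccoact (gcomp gB i x) = tcomp gB (hs_gr B) i (bccoact x).
Proof.
move: x; apply: (@bc_ext _ _ _ _ _ idfun).
- exact: semilin_compl (gcompS gB i) bccoactS.
- exact: semilin_compl bccoactS (tcompS _ _ _).
move=> v; rewrite [gcomp _ _ _]bccompE !bccoactE coact_even.
by apply: (tcomp_nat _ _ bcr_jVS bcr_jAS) => b c; rewrite [RHS]bccompE.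
Qed.
Lemma bccoact_assoc x : tassoc (tmap bccoact id (bccoact x)) = tmap id (@comul _ B) (bccoact x).
Proof.
have idB := @semilin_id E B; have idV := @semilin_id E (bc iota V).
have cB := @comulS E B.
move: x; apply: (@bc_ext _ _ _ _ _ idfun).
- apply: semilin_compl (@semilin_tassoc _ _ _ _).
  exact: semilin_compl bccoactS (semilin_tmap bccoactS idB).
- exact: semilin_compl bccoactS (semilin_tmap idV cB).
move=> v; rewrite !bccoactE (tmap_comp _ bcr_jVS bcr_jAS bccoactS idB) (tmap_comp _ bcr_jVS bcr_jAS idV cB).
rewrite (@eq_tmap _ _ _ _ _ _ _ (fun b => jj (coact b)) _ jA); [|exact: bccoactE|by []].
rewrite (@eq_tmap _ _ _ _ _ _ (fun v => id (jV v)) jV _ (fun b => tmap jA jA (comul b)));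
  [|by []|by move=> a; apply: bccomulE].
have idA := @semilin_id F A; have idV0 := @semilin_id F V.
rewrite -(tmap_comp _ (coactS V) idA bcr_jjS bcr_jAS).
rewrite -(tmap_comp _ idV0 (@comulS F A) bcr_jVS (semilin_tmap bcr_jAS bcr_jAS)).
by rewrite (tassoc_nat _ bcr_jVS bcr_jAS bcr_jAS) coact_assoc.
Qed.
Lemma bccoact_counit x : tlift (fun w (a : B) => counit a *: w) (bccoact x) = x.
Proof.
have bal := @balanced_counitr E B (bc iota V).
have balA := @balanced_counitr F A V.
move: x; apply: (@bc_ext _ _ _ _ _ idfun) => //.
- apply: semilin_compl bccoactS _; apply: tlift_semilin => // c v w.
  by rewrite !scalerA mulrC.
move=> v; rewrite bccoactE -[in RHS](coact_counit v).
move: (coact v); apply: tens_ext.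
- exact: addmap_comp (tliftD bal) (semilinD bcr_jjS).
- exact: addmap_comp (semilinD bcr_jVS) (tliftD balA).
move=> b c; rewrite (tmapE bcr_jVS bcr_jAS) (tliftE _ _ bal) (tliftE _ _ balA) (semilinZ bcr_jVS).
by congr (_ *: _); apply: bccounitE.
Qed.
Definition base_changeR : rep B := Rep bccoactS bccoact_even bccoact_assoc bccoact_counit.
End BcRep.

Record hopf_mor (F : fieldType) (A B : hopf_superalg F) := HopfMor {
  hm_fun :> A -> B;
  hm_linear : linear hm_fun;
  hm_even : forall i a, hm_fun (gcomp (hs_gr A) i a) = gcomp (hs_gr B) i (hm_fun a);
  hm1 : hm_fun 1 = 1;
  hmM : forall a b, hm_fun (a * b) = hm_fun a * hm_fun b;
  hm_comul : forall a, comul (hm_fun a) = tmap hm_fun hm_fun (comul a);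
  hm_counit : forall a, counit (hm_fun a) = counit a }.

Section Push.
Variables (F : fieldType) (A B : hopf_superalg F) (phi : hopf_mor A B) (V : rep A).
Lemma push_phiS : semilin idfun phi.
Proof. exact: (@hm_linear _ _ _ phi). Qed.
Lemma push_idV : semilin idfun (@id V).
Proof. exact: (@semilin_id F V). Qed.
Definition push_coact (v : V) : tens V B := tmap id phi (coact v).
Lemma push_mapS : semilin idfun (tmap (@id V) phi).
Proof. exact: semilin_tmap push_idV push_phiS. Qed.
Lemma push_coact_linear : linear push_coact.
Proof. exact: semilin_compl (coactS V) push_mapS. Qed.
Lemma push_coact_even i v :
  push_coact (gcomp (rep_gr V) i v) = tcomp (rep_gr V) (hs_gr B) i (push_coact v).
Proof.
rewrite /push_coact coact_even; apply: (tcomp_nat _ _ push_idV push_phiS) => // b a.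
exact: hm_even.
Qed.
Lemma push_coact_assoc v :
  tassoc (tmap push_coact id (push_coact v)) = tmap id (@comul _ B) (push_coact v).
Proof.
have idB := @semilin_id F B; have idA := @semilin_id F A.
have cB := @comulS F B; have cA := @comulS F A.
have pcS : semilin idfun push_coact := push_coact_linear.
rewrite {2 3}/push_coact (tmap_comp _ push_idV push_phiS pcS idB) (tmap_comp _ push_idV push_phiS push_idV cB).
rewrite (@eq_tmap _ _ _ _ _ _ _ (fun b => tmap (@id V) phi (coact b)) _ phi) //.
rewrite (@eq_tmap _ _ _ _ _ _ (fun v => id (id v)) id _ (fun b => tmap phi phi (comul b))) //;
  last exact: hm_comul.
rewrite -(tmap_comp _ (coactS V) idA push_mapS push_phiS).
rewrite -(tmap_comp _ push_idV cA push_idV (semilin_tmap push_phiS push_phiS)).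
by rewrite (tassoc_nat _ push_idV push_phiS push_phiS) coact_assoc.
Qed.
Lemma push_coact_counit v : tlift (fun w (b : B) => counit b *: w) (push_coact v) = v.
Proof.
have bal := @balanced_counitr F B V; have balA := @balanced_counitr F A V.
rewrite -[RHS](coact_counit v) /push_coact; move: (coact v); apply: tens_ext.
- exact: addmap_comp (tliftD bal) (semilinD push_mapS).
- exact: tliftD balA.
by move=> w a; rewrite (tmapE push_idV push_phiS) (tliftE _ _ bal) (tliftE _ _ balA) hm_counit.
Qed.
Definition pushforward : rep B :=
  Rep push_coact_linear push_coact_even push_coact_assoc push_coact_counit.
End Push.

Section BcHopfE.
Variables (F E : fieldType) (iota : {rmorphism F -> E}) (A : hopf_superalg F).
Lemma comul_bj (a : A) :
  comul (bj iota a : base_changeH iota A) =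
  tmap (bj iota : A -> base_changeH iota A) (bj iota : A -> base_changeH iota A) (comul a).
Proof. exact: bccomulE. Qed.
Lemma counit_bj (a : A) : counit (bj iota a : base_changeH iota A) = iota (counit a).
Proof. exact: bccounitE. Qed.
Lemma gcomp_bj b (a : A) :
  gcomp (hs_gr (base_changeH iota A)) b (bj iota a) = bj iota (gcomp (hs_gr A) b a).
Proof. exact: bccompE. Qed.
End BcHopfE.

Section Fold.
Variables (F E K : fieldType) (i : {rmorphism F -> E}) (s : {rmorphism E -> K})
  (k : {rmorphism F -> K}) (hk : forall c, s (i c) = k c) (A : hopf_superalg F).

Notation ji := (bj i : A -> base_changeH i A).
Notation jk := (bj k : A -> base_changeH k A).
Notation js := (bj s : base_changeH i A -> base_changeH s (base_changeH i A)).

Definition bcmap : base_changeH i A -> base_changeH k A :=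
  tlift (fun (c : rscal i E^o) a => s c *: jk a).
Lemma fold_jiS : semilin i ji.
Proof. exact: semilin_bj i A. Qed.
Lemma fold_jkS : semilin k jk.
Proof. exact: semilin_bj k A. Qed.
Lemma fold_jsS : semilin s js.
Proof. exact: semilin_bj s (base_changeH i A). Qed.
Lemma fold_jsiS : semilin k (fun a : A => js (ji a)).
Proof. exact: (semilin_comp (fun c => esym (hk c)) fold_jiS fold_jsS). Qed.
Lemma balanced_bcmap : balanced (fun (c : rscal i E^o) (a : A) => s c *: jk a).
Proof.
split=> [v d e|d v w|c e v] /=.
- by rewrite rmorphD scalerDl.
- by rewrite (semilinD fold_jkS) scalerDr.
- rewrite (semilinZ fold_jkS) scalerA -hk -rmorphM mulrC; congr (s _ *: _).
Qed.
Lemma bcmapS : semilin s bcmap.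
Proof.
have bD := tliftD balanced_bcmap.
apply: semilinP => // c; apply: bc_ext0.
- by move=> x y; rewrite scalerDr; apply: bD.
- by move=> x y; rewrite [X in _ *: X](bD x y) scalerDr.
move=> e v; rewrite scalerA -!bjE /bcmap !(tliftE _ _ balanced_bcmap).
by rewrite rmorphM scalerA.
Qed.
Lemma bcmapE a : bcmap (ji a) = jk a.
Proof. by rewrite /bcmap (tliftE _ _ balanced_bcmap) rmorph1 scale1r. Qed.

Lemma bc_ext2 (L : fieldType) (t : {rmorphism K -> L}) (M : lmodType L)
  (f g : base_changeH s (base_changeH i A) -> M) :
  semilin t f -> semilin t g ->
  (forall a : A, f (js (ji a)) = g (js (ji a))) -> f =1 g.
Proof.
move=> foldS gS h; apply: (bc_ext foldS gS) => x; move: x.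
apply: (@bc_ext _ _ _ _ _ (t \o s)) => //.
- exact: semilin_comp fold_jsS foldS.
- exact: semilin_comp fold_jsS gS.
Qed.

Definition fold0 : base_changeH s (base_changeH i A) -> base_changeH k A := bclift s bcmap.
Lemma fold_linear : linear fold0. Proof. exact: semilin_bclift bcmapS. Qed.
Lemma foldS : semilin idfun fold0.
Proof. exact: fold_linear. Qed.
Lemma foldE a : fold0 (js (ji a)) = jk a.
Proof. by rewrite /fold0 (bcliftE bcmapS) bcmapE. Qed.
Lemma fold_even b x :
  fold0 (gcomp (hs_gr (base_changeH s (base_changeH i A))) b x) = gcomp (hs_gr (base_changeH k A)) b (fold0 x).
Proof.
move: x; apply: (@bc_ext2 _ idfun).
- exact: semilin_compl (gcompS _ b) foldS.
- exact: semilin_compl foldS (gcompS _ b).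
by move=> a; rewrite !gcomp_bj !foldE gcomp_bj.
Qed.
Lemma fold1 : fold0 1 = 1. Proof. exact: (foldE 1). Qed.
Lemma foldM x y : fold0 (x * y) = fold0 x * fold0 y.
Proof.
move: x; apply: (@bc_ext2 _ idfun).
- exact: semilin_compl (mulSl y) foldS.
- exact: semilin_compl foldS (mulSl (fold0 y)).
move=> a; move: y; apply: (@bc_ext2 _ idfun).
- exact: semilin_compl (mulSr _) foldS.
- exact: semilin_compl foldS (mulSr _).
by move=> b; rewrite !bjM !foldE bjM.
Qed.
Lemma fold_comul x : comul (fold0 x) = tmap fold0 fold0 (comul x).
Proof.
move: x; apply: (@bc_ext2 _ idfun).
- exact: semilin_compl foldS (@comulS _ _).
- exact: semilin_compl (@comulS _ _) (semilin_tmap foldS foldS).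
move=> a; rewrite foldE !comul_bj.
rewrite (tmap_comp _ fold_jiS fold_jiS fold_jsS fold_jsS).
have jsi' : semilin (s \o i) (fun a : A => js (ji a)).
  exact: (semilin_comp _ fold_jiS fold_jsS).
rewrite (tmap_comp _ jsi' jsi' foldS foldS).
by apply: eq_tmap => b; rewrite foldE.
Qed.
Lemma fold_counit x : counit (fold0 x) = counit x.
Proof.
move: x; apply: (@bc_ext2 _ idfun K^o).
- exact: semilin_compl foldS (@counitS _ (base_changeH k A)).
- exact: (@counitS _ (base_changeH s (base_changeH i A))).
by move=> a; rewrite foldE !counit_bj hk.
Qed.
(* d (x) (c (x) a) |-> d s(c) (x) a *)
Definition bc_fold : hopf_mor (base_changeH s (base_changeH i A)) (base_changeH k A) :=
  HopfMor fold_linear fold_even fold1 foldM fold_comul fold_counit.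

Definition unfold0 : base_changeH k A -> base_changeH s (base_changeH i A) := bclift k (fun a : A => js (ji a)).
Lemma unfold_linear : linear unfold0. Proof. exact: (@semilin_bclift _ _ k A (base_changeH s (base_changeH i A)) _ fold_jsiS). Qed.
Lemma unfoldS : semilin idfun unfold0.
Proof. exact: unfold_linear. Qed.
Lemma unfoldE a : unfold0 (jk a) = js (ji a).
Proof. exact: (@bcliftE _ _ k A (base_changeH s (base_changeH i A)) _ fold_jsiS a). Qed.
Lemma unfold_even b x :
  unfold0 (gcomp (hs_gr (base_changeH k A)) b x) = gcomp (hs_gr (base_changeH s (base_changeH i A))) b (unfold0 x).
Proof.
move: x; apply: (@bc_ext _ _ _ _ _ idfun).
- exact: semilin_compl (gcompS _ b) unfoldS.
- exact: semilin_compl unfoldS (gcompS _ b).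
by move=> a; rewrite gcomp_bj !unfoldE !gcomp_bj.
Qed.
Lemma unfold1 : unfold0 1 = 1. Proof. exact: (unfoldE 1). Qed.
Lemma unfoldM x y : unfold0 (x * y) = unfold0 x * unfold0 y.
Proof.
move: x; apply: (@bc_ext _ _ _ _ _ idfun).
- exact: semilin_compl (mulSl y) unfoldS.
- exact: semilin_compl unfoldS (mulSl (unfold0 y)).
move=> a; move: y; apply: (@bc_ext _ _ _ _ _ idfun).
- exact: semilin_compl (mulSr _) unfoldS.
- exact: semilin_compl unfoldS (mulSr _).
by move=> b; rewrite bjM !unfoldE !bjM.
Qed.
Lemma unfold_comul x : comul (unfold0 x) = tmap unfold0 unfold0 (comul x).
Proof.
move: x; apply: (@bc_ext _ _ _ _ _ idfun).
- exact: semilin_compl unfoldS (@comulS _ _).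
- exact: semilin_compl (@comulS _ _) (semilin_tmap unfoldS unfoldS).
move=> a; rewrite unfoldE !comul_bj.
rewrite (tmap_comp _ fold_jiS fold_jiS fold_jsS fold_jsS) (tmap_comp _ fold_jkS fold_jkS unfoldS unfoldS).
by apply: eq_tmap => b; rewrite unfoldE.
Qed.
Lemma unfold_counit x : counit (unfold0 x) = counit x.
Proof.
move: x; apply: (@bc_ext _ _ _ _ _ idfun K^o).
- exact: semilin_compl unfoldS (@counitS _ (base_changeH s (base_changeH i A))).
- exact: (@counitS _ (base_changeH k A)).
by move=> a; rewrite unfoldE !counit_bj hk.
Qed.
(* c (x) a |-> c (x) (1 (x) a), the inverse of bc_fold *)
Definition bc_unfold : hopf_mor (base_changeH k A) (base_changeH s (base_changeH i A)) :=
  HopfMor unfold_linear unfold_even unfold1 unfoldM unfold_comul unfold_counit.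
End Fold.

Section Res.
Variables (F E : fieldType) (iota : {rmorphism F -> E}) (A : hopf_superalg F).
Notation B := (base_changeH iota A).

Lemma tensB_ext (Y : zmodType) (M : lmodType E) (f g : tens M B -> Y) :
  addmap f -> addmap g ->
  (forall u (a : A), f (u \ot bj iota a) = g (u \ot bj iota a)) -> f =1 g.
Proof.
move=> fD gD h; apply: tens_ext => // u b; move: b; apply: bc_ext0.
- exact: addmap_comp fD (tmkDr u).
- exact: addmap_comp gD (tmkDr u).
by move=> e a; rewrite tmkZr -tmkZl h.
Qed.

Section Module.
Variable U : lmodType E.
Notation R := (rscal iota U).

(* res2 is the isomorphism U (x)_E (E (x)_F A) -> U (x)_F A sending
   u (x) (e (x) a) to eu (x) a. *)
Definition res1 (u : U) : B -> tens R A :=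
  tlift (fun (e : rscal iota E^o) (a : A) => ((e : E) *: u : R) \ot a).
Definition res2 : tens U B -> tens R A := tlift (fun u b => res1 u b).

Lemma balanced_res1 u : balanced (fun (e : rscal iota E^o) (a : A) => ((e : E) *: u : R) \ot a).
Proof.
split=> [v d e|d v w|c e v] /=.
- rewrite -tmkDl; congr (_ \ot _). exact: (@scalerDl E U u d e).
- by rewrite -tmkDr.
- rewrite tmkZr -tmkZl; congr (_ \ot _); exact: (esym (@scalerA E U (iota c) e u)).
Qed.
Lemma res1E u e a : res1 u (e *: bj iota a) = (e *: u : R) \ot a.
Proof. by rewrite -bjE /res1 (tliftE _ _ (balanced_res1 u)). Qed.
Lemma res1Dr u : addmap (res1 u). Proof. exact: tliftD (balanced_res1 u). Qed.
Lemma res1Dl b : addmap (res1^~ b).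
Proof.
move=> u v; rewrite -tlift_add_fun; apply: eq_tlift => e a.
by rewrite -tmkDl; congr (_ \ot _); exact: (@scalerDr E U e u v).
Qed.
Lemma res1Z c u b : res1 (c *: u) b = res1 u (c *: b).
Proof.
move: b; apply: bc_ext0.
- exact: res1Dr.
- by move=> x y; rewrite scalerDr res1Dr.
- by move=> e a; rewrite res1E [c *: (e *: _)]scalerA res1E; congr (_ \ot _); rewrite mulrC -scalerA.
Qed.
Lemma balanced_res2 : balanced (fun u b => res1 u b).
Proof. by split=> [b u v|u b c|c u b]; [apply: res1Dl|apply: res1Dr|apply: res1Z]. Qed.
Lemma res2E u b : res2 (u \ot b) = res1 u b.
Proof. exact: (tliftE _ _ balanced_res2). Qed.
Lemma res2D : addmap res2. Proof. exact: (tliftD balanced_res2). Qed.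
Lemma res1bj u a : res1 u (bj iota a) = (u : R) \ot a.
Proof. by rewrite -[bj iota a]scale1r res1E scale1r. Qed.

Lemma res2Z (c : F) (t : tens U B) : res2 (iota c *: t) = c *: res2 t.
Proof.
move: t; apply: tensB_ext.
- by move=> x y; rewrite scalerDr res2D.
- by move=> x y; rewrite res2D scalerDr.
- by move=> u a; rewrite -tmkZl !res2E !res1bj -tmkZl.
Qed.
End Module.
Arguments balanced_res1 {U} u.
Arguments res1E {U}.

Variable U : rep (base_changeH iota A).
Notation R := (rscal iota U).
Definition res_coact (u : R) : tens R A := res2 (coact (u : U)).

Lemma semilin_rs (M N : lmodType E) (f : M -> N) :
  semilin idfun f -> semilin idfun (f : rscal iota M -> rscal iota N).
Proof. by move=> h c u v; exact: (h (iota c) u v). Qed.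

Lemma res_coact_linear : linear res_coact.
Proof.
move=> c u v; rewrite /res_coact rscalE.
rewrite [coact _](coactS U (iota c) u v) res2D; congr (_ + _).
exact: res2Z.
Qed.
Lemma res_coactS : semilin idfun res_coact.
Proof. exact: res_coact_linear. Qed.

Lemma res_comp_linear i : linear (gcomp (rep_gr U) i : R -> R).
Proof. exact: semilin_rs (gcompS (rep_gr U) i). Qed.
Definition res_gr : grading R :=
  Grading res_comp_linear (@gcompK _ _ (rep_gr U)) (@gcompD _ _ (rep_gr U)).

Lemma res_coact_even i v :
  res_coact (gcomp res_gr i v) = tcomp res_gr (hs_gr A) i (res_coact v).
Proof.
rewrite /res_coact [gcomp res_gr i v]/(gcomp (rep_gr U) i v) coact_even.
move: (coact _); apply: tensB_ext.
- have h1 := semilinD (tcompS (rep_gr U) (hs_gr B) i).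
  by move=> x y; rewrite h1 res2D.
- have h1 := semilinD (tcompS res_gr (hs_gr A) i).
  by move=> x y; rewrite res2D h1.
move=> u a; rewrite tcompE res2D !res2E !gcomp_bj !res1bj.
by rewrite tcompE.
Qed.


Lemma res_idS : semilin iota (id : R -> U). Proof. by []. Qed.
Lemma res_jS : semilin iota (bj iota : A -> B).
Proof. exact: semilin_bj iota A. Qed.
Notation kap := (tmap (id : R -> U) (bj iota : A -> B)).

Lemma kap_res (v : R) : kap (res_coact v) = coact (v : U).
Proof.
rewrite /res_coact; move: (coact _); apply: tensB_ext => //.
- exact: addmap_comp (tmapD res_idS res_jS) (@res2D U).
- by move=> u a; rewrite res2E res1bj (tmapE res_idS res_jS).
Qed.

Notation kap2 := (tmap (id : R -> U) (tmap (bj iota : A -> B) (bj iota : A -> B))).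
Lemma res_jjS : semilin iota (tmap (bj iota : A -> B) (bj iota : A -> B)).
Proof. exact: semilin_tmap res_jS res_jS. Qed.

Lemma kap2_inj : injective kap2.
Proof.
have r2S : semilin idfun (res2 (U := U) : rscal iota (tens U B) -> tens R A).
  by apply: semilinP; [exact: res2D|exact: res2Z].
have idA := @semilin_id F A.
pose lam x := tassoc (tmap (res2 (U := U) : rscal iota (tens U B) -> tens R A) id
  (res2 (tassocV x))).
have lamD : addmap lam.
  move=> x y; rewrite /lam.
  rewrite (semilinD (@tassocVS _ U B B)) (@res2D (tens U B)) (tmapD r2S idA).
  by rewrite (semilinD (@semilin_tassoc _ R A A)).
suff h : forall t, lam (kap2 t) = t by exact: (can_inj h).
apply: (@tens_ext _ _ _ _ (fun t => lam (kap2 t)) id) => //.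
  exact: (addmap_comp lamD (tmapD res_idS res_jjS)).
move=> u p; rewrite (tmapE res_idS res_jjS); move: p.
apply: (@tens_ext _ _ _ _ (fun p => lam (_ \ot tmap _ _ p)) (fun p => _ \ot p)).
- by move=> x y; rewrite (tmapD res_jS res_jS) tmkDr lamD.
- exact: tmkDr.
move=> a b; rewrite (tmapE res_jS res_jS) /lam tassocVE res2E res1bj (tmapE r2S idA) res2E res1bj.
exact: tassocE.
Qed.

Lemma res_coact_assoc v :
  tassoc (tmap res_coact id (res_coact v)) = tmap id (@comul _ A) (res_coact v).
Proof.
have idA := @semilin_id F A; have idB := @semilin_id E B.
have idR := @semilin_id F R; have idU := @semilin_id E U.
have cA := @comulS F A; have cB := @comulS E B.
apply: kap2_inj.
rewrite -(tassoc_nat _ res_idS res_jS res_jS) (tmap_comp _ res_coactS idA (semilin_tmap res_idS res_jS) res_jS).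
have -> : tmap (fun w : R => kap (res_coact w)) (fun a : A => bj iota (id a) : B) (res_coact v) =
          tmap (@coact _ _ U) id (kap (res_coact v)).
  rewrite (tmap_comp _ res_idS res_jS (coactS U) idB); apply: eq_tmap => // w.
  exact: kap_res.
rewrite kap_res coact_assoc -kap_res (tmap_comp _ res_idS res_jS idU cB).
rewrite (tmap_comp _ idR cA res_idS res_jjS); apply: eq_tmap => // a.
exact: bccomulE.
Qed.

Lemma res_coact_counit v : tlift (fun w (a : A) => counit a *: w) (res_coact v) = v.
Proof.
have bal := @balanced_counitr E B U; have balA := @balanced_counitr F A R.
rewrite -[RHS](coact_counit (v : U)) -kap_res; move: (res_coact v); apply: tens_ext.
- exact: tliftD balA.
- exact: addmap_comp (tliftD bal) (tmapD res_idS res_jS).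
move=> u a; rewrite (tmapE res_idS res_jS) (tliftE _ _ bal) (tliftE _ _ balA) rscalE.
by rewrite counit_bj.
Qed.

Definition restriction : rep A :=
  Rep res_coact_linear res_coact_even res_coact_assoc res_coact_counit.
End Res.

(* The type of representations is too large for the library's set and set_bij. *)
Definition bij_between (X Y : Type) (D : X -> Prop) (R : Y -> Prop) (f : X -> Y) : Prop :=
  [/\ forall x, D x -> R (f x),
      forall x x', D x -> D x' -> f x = f x' -> x = x' &
      forall y, R y -> exists2 x, D x & f x = y].

Local Open Scope classical_set_scope.

Section Representations.
Variables (F : fieldType) (A : hopf_superalg F).

Definition HomG (V W : rep A) : set (V -> W) :=
  [set f | [/\ linear f,
               forall i v, f (gcomp (rep_gr V) i v) = gcomp (rep_gr W) i (f v) &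
               forall v, coact (f v) = tmap f id (coact v)]].
Arguments HomG : clear implicits.

Definition iso (V W : rep A) : Prop := exists2 f, HomG V W f & bijective f.

(* V is isomorphic to a subrepresentation of W, the image of f. *)
Definition embeds (V W : rep A) : Prop := exists2 f, HomG V W f & injective f.

(* The last condition says that coact maps U into U (x) A. *)
Definition subrep (V : rep A) (U : set V) : Prop :=
  [/\ U 0,
      forall c u v, U u -> U v -> U (c *: u + v),
      forall i v, U v -> U (gcomp (rep_gr V) i v) &
      forall v, U v -> exists2 s : seq (V * A),
        {in s, forall p, U p.1} & coact v = \sum_(p <- s) p.1 \ot p.2].

Definition irreducible (V : rep A) : Prop :=
  (exists v : V, v != 0) /\
  (forall U : set V, subrep U -> U = [set 0] \/ U = setT).

Definition iso_class (V : rep A) : rep A -> Prop := fun W => iso V W.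

Definition irr_classes : (rep A -> Prop) -> Prop :=
  fun C => exists2 V : rep A, irreducible V & C = iso_class V.

(* A superalgebra of endomorphisms of the vector space underlying V, under
   composition, is given by its even part D false and its odd part D true. *)
Definition even_center (V : rep A) (D : bool -> set (V -> V)) : set (V -> V) :=
  [set f | D false f /\ forall i g, D i g -> f \o g = g \o f].

Definition scalars (V : rep A) : set (V -> V) := range (fun (c : F) (v : V) => c *: v).
Arguments scalars : clear implicits.

Definition central (V : rep A) (D : bool -> set (V -> V)) : Prop :=
  even_center D = scalars V.

(* End_G(V) is regarded as a superalgebra concentrated in even degree. *)
Definition End_alg (V : rep A) (i : bool) : set (V -> V) :=
  if i then [set fun=> 0] else HomG V V.

(* The odd part consists of the homomorphisms from V to its parity change, which
   has the same underlying space as V. *)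
Definition End_superalg (V : rep A) (i : bool) : set (V -> V) :=
  if i then HomG V (parity_change V) else HomG V V.

Arguments End_superalg : clear implicits.

(* theta identifies the field E, with its subfield iota(F), with the even part
   of the center of End_superalg V. *)
Definition is_even_center (V : rep A) (E : fieldType) (iota : {rmorphism F -> E})
    (theta : E -> V -> V) : Prop :=
  [/\ set_bij setT (even_center (End_superalg V)) theta,
      forall c d v, theta (c + d) v = theta c v + theta d v,
      forall c d v, theta (c * d) v = theta c (theta d v) &
      forall c v, theta (iota c) v = c *: v].

End Representations.
Arguments irr_classes {F} A _.
Arguments scalars {F A} V.
Arguments HomG {F A} V W.
Arguments End_alg {F A} V i.
Arguments End_superalg {F A} V i.

(* iota makes K a (possibly infinite) separable algebraic extension of F. *)
Definition separable_over (F K : fieldType) (iota : {rmorphism F -> K}) : Prop :=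
  forall x : K, exists2 p : {poly F}, separable_poly p & root (map_poly iota p) x.

Definition separable_closure (F K : fieldType) (iota : {rmorphism F -> K}) : Prop :=
  separable_over iota /\
  (forall p : {poly K}, separable_poly p -> (1 < size p)%N -> exists x, root p x).

Record galaut (F K : fieldType) (iota : {rmorphism F -> K}) := GalAut {
  ga_mor :> {rmorphism K -> K};
  ga_bij : bijective ga_mor;
  ga_fix : forall c, ga_mor (iota c) = iota c }.

Section Galois.
Variables (F K : fieldType) (iota : {rmorphism F -> K}) (G : hopf_superalg F).

(* The base change of V along s is a representation of
   K (x)_s (K (x)_iota G), which is K (x)_iota G since s o iota = iota. *)
Definition gal_twist (s : galaut iota) (V : rep (base_changeH iota G)) : rep (base_changeH iota G) :=
  pushforward (bc_fold (ga_fix s) G) (base_changeR s V).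

Definition gal_orbit (V : rep (base_changeH iota G)) : (rep (base_changeH iota G) -> Prop) -> Prop :=
  fun C => exists s : galaut iota, C = iso_class (gal_twist s V).

Definition irr_orbits : ((rep (base_changeH iota G) -> Prop) -> Prop) -> Prop :=
  fun O => exists2 V : rep (base_changeH iota G), irreducible V & O = gal_orbit V.

(* The orbit of V is the orbit of an irreducible subrepresentation of the base
   change of W; as W is determined up to isomorphism, W is the V_F of V. *)
Definition corresponds (W : rep G) (V : rep (base_changeH iota G)) : Prop :=
  irreducible W /\
  exists V0, [/\ irreducible V0, embeds V0 (base_changeR iota W) & gal_orbit V0 = gal_orbit V].
End Galois.
Arguments irr_orbits {F K} iota G _.

(* Main.v *)
Require Import Defs.
From HB Require Import structures.
From mathcomp Require Import all_boot all_algebra.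
From mathcomp Require Import generic_quotient separable.
From mathcomp Require Import boolp classical_sets functions.
Set Implicit Arguments. Unset Strict Implicit. Unset Printing Implicit Defensive.
Import GRing.Theory.
Local Open Scope ring_scope.
Local Open Scope classical_set_scope.

(* A subspace of a supercomodule is a subcomodule iff it is stable under the
   operators (id (x) l) o coact, for linear functionals l on F[G], and under the
   two projections of the grading; after base change the functionals defined over
   F still suffice. So a representation over any extension of F is a vector space
   with a family of operators indexed by one fixed set, and parity change is an
   involution of this set.

   (1) A Galois-stable subspace of K (x) W is defined over F. So if W is
   irreducible, the Galois conjugates of any irreducible V in K (x) W have sum
   K (x) W, which is therefore semisimple with all constituents conjugate to V.
   If W and W' share a constituent then Hom(K (x) W, K (x) W') = K (x) Hom(W, W')
   is nonzero. Finally V is a quotient of K (x) W for any irreducible W in the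
   restriction of V to F, hence a constituent of it.

   (2)(i) The graded center of End(K (x) W) is the base change of that of End(W).
   If the latter is F, the projection onto the sum of the copies of V (and of its
   parity change) is a scalar, so all conjugates of V are isomorphic to V (or its
   parity change), and the even center of End(V) is K; as K is separably closed of
   characteristic not two, End(V) = K by the Jacobson-Noether theorem.

   (2)(ii) F' acts on Hom(V, K (x) W) by commuting operators, each killed by a
   separable polynomial; a common eigenvector gives the embedding e of F' in K and
   remains nonzero in the quotient K (x)_F' W of K (x)_F W. *)

(** * Semisimplicity and linear algebra *)

(** Schur's lemma, semisimplicity and descent use no relation between the operators. Even and odd
    homomorphisms, homomorphisms out of a Galois twist, and maps from [W] to its base change are all
    instances of [shom], which carries a field morphism and a parity bit, so one argument serves
    them all. Representations may be infinite-dimensional, and the base change of a Hom space is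
    never built. Instead, an F-linear functional on [K], applied to coefficients ([bproj]), turns a
    K-linear homomorphism of base changes into one over [F], and all functionals together lose
    nothing. Finite dimension comes from local finiteness of supercomodules: it provides irreducible
    subrepresentations and makes End(V) algebraic over [K] and F' finite over [F]. As [K] is only
    separably closed, a division algebra over it may be a purely inseparable field; the center of
    End(V) must be shown to be [K] before Jacobson-Noether applies. Characteristic not two serves
    there: conjugation by an odd automorphism is an involution of the center of the even part, and
    its eigenvalue -1 is excluded with the help of a square root in [K]. *)

Lemma zorn_above (T : Type) (P : set (set T)) (A0 : set T) :
  P A0 ->
  (forall C : set (set T), C !=set0 -> C `<=` P -> total_on C subset ->
    P (\bigcup_(X in C) X)) ->
  exists A, [/\ A0 `<=` A, P A & forall B, A `<=` B -> P B -> B `<=` A].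
Proof.
move=> PA0 chP.
(* The union of the empty chain need not satisfy [P]; adding [A0] to every set repairs this. *)
have [C CP Ct|A [PA Amax]] := @Zorn_bigcup T [set X | P (A0 `|` X)].
  have [->|/set0P[X0 CX0]] := eqVneq C set0; first by rewrite /= bigcup_set0 setU0.
  rewrite /=; suff -> : A0 `|` \bigcup_(X in C) X = \bigcup_(X in [set A0 `|` Y | Y in C]) X.
    apply: chP; first by exists (A0 `|` X0), X0.
      by move=> _ [X CX <-]; exact: CP.
    move=> _ _ [X CX <-] [Y CY <-].
    by have [h|h] := Ct _ _ CX CY; [left|right]; apply: setUS.
  apply/seteqP; split=> x /=.
    by case=> [xA|[X CX xX]]; [exists (A0 `|` X0); [exists X0|left]|exists (A0 `|` X); [exists X|right]].
  by case=> _ [X CX <-] [xA|xX]; [left|right; exists X].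
exists (A0 `|` A); split=> // B AB PB; apply: contrapT => nBA.
have /Amax : A `<` B.
  split; first exact: subset_trans AB.
  by move=> BA; apply: nBA => x /BA xA; right.
by apply; rewrite /= setUidr // => x xA; apply: AB; left.
Qed.

Section Sums.
Variable (V : zmodType).
Definition sums (P : set V) : set V :=
  [set x | exists2 s : seq V, {in s, forall y, P y} & x = \sum_(y <- s) y].

Lemma sums_ind (P U : set V) :
  U 0 -> (forall x y, U x -> U y -> U (x + y)) -> P `<=` U -> sums P `<=` U.
Proof.
move=> U0 UD PU _ [s sP ->]; elim: s sP => [|y s IH] sP; first by rewrite big_nil.
rewrite big_cons; apply: UD; first by apply: PU; apply: sP; rewrite inE eqxx.
by apply: IH => z zs; apply: sP; rewrite inE zs orbT.
Qed.
Lemma sums0 (P : set V) : sums P 0.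
Proof. by exists [::] => //; rewrite big_nil. Qed.
Lemma sums1 (P : set V) : P `<=` sums P.
Proof. by move=> x Px; exists [:: x]; [move=> y; rewrite inE => /eqP ->|rewrite big_seq1]. Qed.
Lemma sumsD (P : set V) x y : sums P x -> sums P y -> sums P (x + y).
Proof.
move=> [s sP ->] [t tP ->]; exists (s ++ t); last by rewrite big_cat.
by move=> z; rewrite mem_cat => /orP[/sP|/tP].
Qed.
End Sums.

(** The index type is independent of the field, so that modules over different fields share their
    operators and maps between them can be semilinear. *)
Record jmod (J : Type) (E : fieldType) := JMod {
  jm_sort :> lmodType E;
  jact : J -> jm_sort -> jm_sort;
  jact_linear : forall j, linear (jact j) }.

Section Jmod.
Variables (J : Type) (E : fieldType) (V : jmod J E).
Lemma jactS j : semilin idfun (@jact _ _ V j).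
Proof. exact: jact_linear. Qed.
Lemma jactD j : addmap (@jact _ _ V j).
Proof. exact: (@semilinD _ _ idfun _ _ _ (jactS j)). Qed.
Lemma jact0 j : jact j (0 : V) = 0.
Proof. exact: addmap0 (jactD j). Qed.
Lemma jactZ j c (v : V) : jact j (c *: v) = c *: jact j v.
Proof. exact: (@semilinZ _ _ idfun _ _ _ (jactS j)). Qed.
Lemma jactB j (u v : V) : jact j (u - v) = jact j u - jact j v.
Proof. by rewrite jactD -scaleN1r jactZ scaleN1r. Qed.
End Jmod.

Section Subspaces.
Variables (J : Type) (E : fieldType).

Definition subspace (V : lmodType E) (U : set V) : Prop :=
  U 0 /\ forall c u v, U u -> U v -> U (c *: u + v).

Definition stable (V : jmod J E) (U : set V) : Prop :=
  subspace U /\ forall j u, U u -> U (jact j u).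

Definition jirr (V : jmod J E) : Prop :=
  (exists v : V, v != 0) /\
  forall U : set V, stable U -> (exists2 u, U u & u != 0) -> forall v, U v.

Lemma subspaceD (V : lmodType E) (U : set V) : subspace U ->
  forall u v, U u -> U v -> U (u + v).
Proof. by move=> [_ h] u v Uu Uv; rewrite -[u]scale1r; apply: h. Qed.
Lemma subspaceZ (V : lmodType E) (U : set V) : subspace U ->
  forall c u, U u -> U (c *: u).
Proof. by move=> [h0 h] c u Uu; rewrite -[_ *: _]addr0; apply: h. Qed.
Lemma subspaceB (V : lmodType E) (U : set V) : subspace U ->
  forall u v, U u -> U v -> U (u - v).
Proof. by move=> h u v Uu Uv; apply: subspaceD => //; rewrite -scaleN1r; apply: subspaceZ. Qed.
Lemma subspace_sum (V : lmodType E) (U : set V) : subspace U ->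
  forall (I : Type) (r : seq I) (P : pred I) (f : I -> V),
  (forall i, P i -> U (f i)) -> U (\sum_(i <- r | P i) f i).
Proof. by move=> h I r P f hf; apply: big_ind => //; [case: h|apply: subspaceD]. Qed.

(* The sets L are minimal stable subsets whose sum is X, so X is semisimple. *)
Lemma stable_complement (X : jmod J E) (C : set (set X)) (U : set X) :
  (forall L, C L -> stable L) ->
  (forall L N, C L -> stable N -> (exists u, [/\ L u, N u & u != 0]) -> L `<=` N) ->
  (forall x, sums (\bigcup_(L in C) L) x) ->
  stable U ->
  exists N, [/\ stable N, forall x, U x -> N x -> x = 0 &
    forall x, exists u n, [/\ U u, N n & x = u + n]].
Proof.
move=> Cst Cmin Csp Ust.
pose P N := stable (N : set X) /\ forall x, U x -> N x -> x = 0.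
have P0 : P [set 0].
  split=> //; split; first by split=> // c u v -> ->; rewrite scaler0 addr0.
  by move=> j u ->; rewrite jact0.
have [|N [_ [Nst NU] Nmax]] := zorn_above P0.
  move=> D [N0 DN0] DP Dt; split; last by move=> x Ux [N DN Nx]; apply: (DP _ DN).2.
  split; last by move=> j u [N DN Nu]; exists N => //; apply: (DP _ DN).1.2.
  split; first by exists N0 => //; case: (DP _ DN0) => [[[]]].
  move=> c u v [N DN Nu] [M DM Mv].
  have [NM|MN] := Dt _ _ DN DM.
    by exists M => //; apply: (DP _ DM).1.1.2 => //; apply: NM.
  by exists N => //; apply: (DP _ DN).1.1.2 => //; apply: MN.
have sumst (A B : set X) : stable A -> stable B ->
    stable [set x | exists u n, [/\ A u, B n & x = u + n]].
  move=> [[A0 AZ] Aa] [[B0 BZ] Ba]; split; first split.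
  - by exists 0, 0; rewrite addr0.
  - move=> c _ _ [u [n [Au Bn ->]]] [u' [n' [Au' Bn' ->]]].
    by exists (c *: u + u'), (c *: n + n'); split; [exact: AZ|exact: BZ|rewrite scalerDr addrACA].
  - move=> j _ [u [n [Au Bn ->]]]; exists (jact j u), (jact j n); split; [exact: Aa|exact: Ba|].
    exact: jactD.
exists N; split=> // x.
have /(_ x) : forall x, sums (\bigcup_(L in C) L) x by [].
move: x; apply: sums_ind => /=.
- by exists 0, 0; rewrite addr0; split=> //; [case: Ust => [[]]|case: Nst => [[]]].
- exact: (subspaceD (sumst _ _ Ust Nst).1).
move=> x [L CL Lx] /=.
have [LN|nLN] := pselect (L `<=` N).
  by exists 0, x; rewrite add0r; split; [case: Ust => [[]]|exact: LN|].
suff /(_ x Lx) : L `<=` [set x | exists u n, [/\ U u, N n & x = u + n]] by [].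
apply: Cmin => //; first exact: sumst.
have Lst := Cst _ CL; have LNst := sumst _ _ Lst Nst.
(* As [L] is not inside [N], maximality makes [L + N] meet [U] in some nonzero [y = l + n]. Then
   [l = y - n] lies in [L] and in [U + N], and it is nonzero since [l = 0] would put [y] in both [U]
   and [N]. *)
have : ~ P [set x | exists u n, [/\ L u, N n & x = u + n]].
  move=> /Nmax h; apply: nLN => y Ly; apply: h; last by exists y, 0; rewrite addr0; split=> //; case: Nst => [[]].
  by move=> z Nz; exists 0, z; rewrite add0r; split=> //; case: Lst => [[]].
move=> /not_andP[//|] /existsNP[y] /not_implyP[Uy] /not_implyP[[l [n [Ll Nn ye]]] /eqP y0].
exists l; split=> //.
  exists y, (- n); split=> //; last by rewrite ye addrK.
  by rewrite -scaleN1r; apply: subspaceZ => //; case: Nst.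
apply/eqP => l0; move: y0; rewrite (NU y Uy) ?eqxx //.
by rewrite ye l0 add0r.
Qed.

Lemma stable_projection (X : jmod J E) (C : set (set X)) (U : set X) :
  (forall L, C L -> stable L) ->
  (forall L N, C L -> stable N -> (exists u, [/\ L u, N u & u != 0]) -> L `<=` N) ->
  (forall x, sums (\bigcup_(L in C) L) x) ->
  stable U ->
  exists p : X -> X, [/\ linear p, forall j x, p (jact j x) = jact j (p x),
    forall x, U (p x) & forall u, U u -> p u = u].
Proof.
move=> h1 h2 h3 Ust; have [N [Nst NU UN]] := stable_complement h1 h2 h3 Ust.
have /choice[p pP] : forall x, exists u, U u /\ N (x - u).
  by move=> x; have [u [n [Uu Nn ->]]] := UN x; exists u; rewrite addrC addKr.
have puniq x u : U u -> N (x - u) -> p x = u.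
  move=> Uu Nu; have [Up Np] := pP x.
  apply/eqP; rewrite -subr_eq0; apply/eqP; apply: NU; first exact: subspaceB Ust.1 _ _ Up Uu.
  have -> : p x - u = (x - u) - (x - p x) by rewrite opprB [RHS]addrC addrA subrK.
  exact: subspaceB Nst.1 _ _ Nu Np.
exists p; split.
- move=> c x y; apply: puniq.
    by apply: Ust.1.2; [exact: (pP x).1|exact: (pP y).1].
  rewrite opprD addrACA -scalerBr.
  by apply: Nst.1.2; [exact: (pP x).2|exact: (pP y).2].
- move=> j x; apply: puniq; first by apply: Ust.2; exact: (pP x).1.
  by rewrite -jactB; apply: Nst.2; exact: (pP x).2.
- by move=> x; exact: (pP x).1.
- by move=> u Uu; apply: puniq => //; rewrite subrr; exact: Nst.1.1.
Qed.
End Subspaces.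

Section LinearProjection.
Variables (F : fieldType) (V : lmodType F).

(** A vector space is a module without operators and the sum of its lines, so semisimplicity
    specializes to the existence of complements; this takes the place of bases in infinite
    dimension. *)
Lemma linear_projection (U : set V) : subspace U ->
  exists p : V -> V, [/\ linear p, forall x, U (p x) & forall u, U u -> p u = u].
Proof.
move=> Us.
pose X := @JMod Empty_set F V (fun _ => id) (fun _ c u v => erefl).
pose C : set (set X) := [set L | exists v : V, L = [set x | exists c, x = c *: v]].
have [|||//|p [pl _ pU pu]] := @stable_projection Empty_set F X C U; last by exists p.
- move=> _ [v ->]; split=> //; split; first by exists 0; rewrite scale0r.
  by move=> c _ _ [a ->] [b ->]; exists (c * a + b); rewrite scalerDl scalerA.
- move=> _ N [v ->] [[N0 NZ] _] [_ [[c ->] Ncv cv0]] _ [d ->].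
  have c0 : c != 0 by apply: contraNneq cv0 => ->; rewrite scale0r.
  have -> : d *: v = (d / c) *: (c *: v) + 0 by rewrite scalerA divfK // addr0.
  exact: NZ.
- move=> x; apply: sums1; exists [set y | exists c, y = c *: x]; first by exists x.
  by exists 1; rewrite scale1r.
Qed.

Lemma functional_neq0 (v : V) : v != 0 -> exists2 f : V -> F, scalar f & f v = 1.
Proof.
move=> v0; have [|p [pl pU pv]] := @linear_projection [set x | exists c, x = c *: v].
  split; first by exists 0; rewrite scale0r.
  by move=> c _ _ [a ->] [b ->]; exists (c * a + b); rewrite scalerDl scalerA.
have [f pf] := choice pU.
have finj a b : a *: v = b *: v -> a = b.
  by move=> /eqP; rewrite -subr_eq0 -scalerBl scaler_eq0 (negPf v0) orbF subr_eq0 => /eqP.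
exists f; last by apply: finj; rewrite -pf scale1r pv //; exists 1; rewrite scale1r.
by move=> c x y; apply: finj; rewrite -pf pl !pf scalerDl scalerA.
Qed.
End LinearProjection.

Section DualSystem.
Variables (F : fieldType) (X Y : lmodType F).

(** Each new [y0] is reduced by the earlier [y k]. If the remainder [y1] is zero, the term is
    absorbed into the [x k]; otherwise a dual functional is added for it. The indices are natural
    numbers so that a family is extended by a conditional. *)
Lemma dual_representation (t : tens X Y) :
  exists n (x : nat -> X) (y : nat -> Y) (l : nat -> Y -> F),
  [/\ t = \sum_(k < n) x k \ot y k, forall k, scalar (l k) &
      forall k m : nat, (k < n)%N -> (m < n)%N -> l k (y m) = (k == m)%:R].
Proof.
rewrite (tensP t); elim: (repr t) => [|[x0 y0] s [n [x [y [l [tE0 ll ly]]]]]].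
  exists 0%N, (fun=> 0), (fun=> 0), (fun=> fun=> 0); split=> //.
    by rewrite big_nil big_ord0.
  by move=> k c u v; rewrite mulr0 addr0.
rewrite big_cons tE0 /=.
have lS k : semilin idfun (l k : Y -> F^o) := ll k.
pose y1 := y0 - \sum_(k < n) l k y0 *: y k.
have ly1 k : (k < n)%N -> l k y1 = 0.
  move=> kn; rewrite /y1 -scaleN1r addrC ll mulN1r.
  rewrite (addmap_sum _ _ _ (semilinD (iota := idfun) (lS k))).
  rewrite (bigD1 (Ordinal kn)) //= big1 ?addr0; last first.
    by move=> i; rewrite -val_eqE /= => ik; rewrite (semilinZ (iota := idfun) (lS k)) ly // eq_sym (negPf ik) scaler0.
  by rewrite (semilinZ (iota := idfun) (lS k)) ly // eqxx /GRing.scale /= mulr1 addNr.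
have tE : x0 \ot y0 + \sum_(k < n) x k \ot y k =
   \sum_(k < n) (x k + l k y0 *: x0) \ot y k + x0 \ot y1.
  under [in RHS]eq_bigr do rewrite tmkDl tmkZl -tmkZr.
  rewrite big_split /= -addrA [LHS]addrC; congr (_ + _).
  by rewrite -(addmap_sum _ _ _ (tmkDr x0)) -tmkDr /y1 addrC subrK.
have [y10|y1n0] := eqVneq y1 0.
  exists n, (fun k => x k + l k y0 *: x0), y, l; split=> //.
  by rewrite tE y10 (addmap0 (tmkDr _)) addr0.
have [f fl fy] := functional_neq0 y1n0.
have fS : semilin idfun (f : Y -> F^o) := fl.
(* The functional [f], with value 1 at [y1], is corrected to vanish at the earlier [y k]; its value
   at [y1] stays, since the earlier [l k] vanish there. *)
pose g v := f v - \sum_(k < n) l k v * f (y k).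
exists n.+1, (fun k => if (k < n)%N then x k + l k y0 *: x0 else x0),
  (fun k => if (k < n)%N then y k else y1), (fun k => if (k < n)%N then l k else g).
split.
- rewrite big_ord_recr /= ltnn tE; congr (_ + _).
  by apply: eq_bigr => k _; rewrite ltn_ord.
- move=> k; case: ifP => _ //.
  move=> c u v; rewrite /g fl mulrBr mulr_sumr addrACA -opprD -big_split /=.
  by congr (_ + _ - _); apply: eq_bigr => i _; rewrite ll mulrDl mulrA.
move=> k m; rewrite !ltnS => kn mn; case: ltnP => k1; case: ltnP => m1.
- exact: ly.
- by rewrite ly1 // ltn_eqF // (leq_trans k1).
- rewrite gtn_eqF ?(leq_trans m1) // /g (bigD1 (Ordinal m1)) //= ly // eqxx mul1r big1 ?addr0 ?subrr //.
  by move=> i; rewrite -val_eqE /= => im; rewrite ly // (negPf im) mul0r.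
- have -> : k == m by rewrite eqn_leq (leq_trans kn) // (leq_trans mn).
  by rewrite /g fy big1 ?subr0 // => i _; rewrite ly1 // mul0r.
Qed.

(** In a dual form of [t - u] the functional [l k] returns exactly the coefficient [x k]. Applied to
    coactions, this shows that the operators determine them. *)
Lemma tens_separated (t u : tens X Y) :
  (forall l : Y -> F, scalar l ->
    tlift (fun x y => l y *: x) t = tlift (fun x y => l y *: x) u) -> t = u.
Proof.
have bal (l : Y -> F) : scalar l -> balanced (fun (x : X) (y : Y) => l y *: x).
  move=> ll; have lS : semilin idfun (l : Y -> F^o) := ll.
  split=> [y x x'|x y y'|c x y] /=; first by rewrite scalerDr.
    by rewrite (semilinD (iota := idfun) lS) scalerDl.
  by rewrite (semilinZ (iota := idfun) lS) scalerA [_ *: _ in RHS]/GRing.scale /= mulrC.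
move=> h; apply/eqP; rewrite -subr_eq0; apply/eqP.
have {h} : forall l, scalar l -> tlift (fun x y => l y *: x) (t - u) = 0.
  move=> l ll; have lD := tliftD (bal l ll).
  apply: (addIr (tlift (fun x y => l y *: x) u)).
  by rewrite -lD subrK add0r h.
have [n [x [y [l [-> ll ly]]]]] := dual_representation (t - u).
move=> h; apply: big1 => k _.
suff -> : x k = 0 by rewrite (addmap0 (tmkDl _)).
have := h _ (ll k); rewrite (addmap_sum _ _ _ (tliftD (bal _ (ll k)))).
rewrite (bigD1 k) //= big1 ?addr0; last first.
  by move=> i; rewrite -val_eqE /= => ik; rewrite (tliftE _ _ (bal _ (ll k))) ly // eq_sym (negPf ik) scale0r.
by rewrite (tliftE _ _ (bal _ (ll k))) ly // eqxx scale1r.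
Qed.
End DualSystem.

(** * Finitely spanned subspaces and polynomials in an operator *)

Section FiniteSpan.
Variables (F : fieldType) (V : lmodType F).

(** The family [s] may be dependent, so [n] only bounds the dimension. *)
Definition spanned (n : nat) (U : set V) : Prop :=
  exists s : 'I_n -> V, forall v, U v <-> exists c : 'rV[F]_n, v = \sum_i c 0 i *: s i.

Lemma spanned_subspace n U : spanned n U -> subspace U.
Proof.
move=> [s sP]; split; first by apply/sP; exists 0; rewrite big1 // => i _; rewrite mxE scale0r.
move=> c u v /sP[a ->] /sP[b ->]; apply/sP; exists (c *: a + b).
by rewrite scaler_sumr -big_split; apply: eq_bigr => i _; rewrite !mxE scalerDl scalerA.
Qed.

(** Vectors of [U] become rows of coefficients. Among the matrices whose rows represent vectors of
    [U'], one of maximal rank has a row space containing every coefficient row of a vector of [U'];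
    full rank forces [U] into [U']. *)
Lemma spanned_sub n (U U' : set V) : spanned n U -> subspace U' -> U' `<=` U ->
  exists r, [/\ (r <= n)%N, spanned r U' & (r < n)%N \/ U `<=` U'].
Proof.
move=> [s sP] U's U'U.
pose lc (c : 'rV[F]_n) := \sum_i c 0 i *: s i.
have lcM m (u : 'rV[F]_m) (A : 'M[F]_(m, n)) : lc (u *m A) = \sum_i u 0 i *: lc (row i A).
  rewrite /lc; under [RHS]eq_bigr do rewrite scaler_sumr.
  rewrite exchange_big /=; apply: eq_bigr => j _; rewrite !mxE scaler_suml.
  by apply: eq_bigr => i _; rewrite mxE scalerA.
pose Q (A : 'M[F]_n) := forall i, U' (lc (row i A)).
have [r [[A QA rA] rmax]] : exists r, (exists2 A, Q A & \rank A = r) /\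
    forall A, Q A -> (\rank A <= r)%N.
  pose P r := `[< exists2 A, Q A & \rank A = r >].
  have exP : exists r, P r.
    exists 0%N; apply/asboolP; exists 0; last exact: mxrank0.
    by move=> i; rewrite /lc big1; [exact: U's.1|move=> j _; rewrite !mxE scale0r].
  have leP r : P r -> (r <= n)%N by move=> /asboolP[A _ <-]; exact: rank_leq_row.
  exists (ex_maxn exP leP); case: ex_maxnP => r /asboolP rP rmax; split=> // A QA.
  by apply: rmax; apply/asboolP; exists A.
have QU m (A' : 'M[F]_(m, n)) u : (forall i, U' (lc (row i A'))) -> U' (lc (u *m A')).
  by move=> QA'; rewrite lcM; apply: subspace_sum => // i _; apply: subspaceZ.
have AP c : U' (lc c) -> (c <= A)%MS.
  move=> Uc; have QAc : Q (A + c)%MS.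
    move=> i; have /sub_addsmxP[[u1 u2] /= ->] := row_sub i (A + c)%MS.
    have -> : lc (u1 *m A + u2 *m c) = lc (u1 *m A) + lc (u2 *m c).
      by rewrite /lc -big_split; apply: eq_bigr => j _; rewrite mxE scalerDl.
    apply: subspaceD => //; first exact: QU.
    by apply: QU => j; rewrite (ord1 j) row_id.
  have := rmax _ QAc; rewrite -rA (geq_leqif (mxrank_leqif_sup (addsmxSl A c))).
  by move=> h; apply: submx_trans h; exact: addsmxSr.
exists (\rank A); split; first exact: rank_leq_row.
  exists (fun i => lc (row i (row_base A))) => v; split.
    move=> U'v; have /U'U/sP[c vc] := U'v; move: U'v; rewrite vc => /AP.
    by rewrite -(eq_row_base A) => /submxP[d ->]; exists d; rewrite -lcM.
  move=> [c ->]; rewrite -lcM; apply: (QU) => i.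
  have : (row i (row_base A) <= A)%MS by rewrite -(eq_row_base A) row_sub.
  by move=> /submxP[d ->]; exact: QU.
rewrite ltn_neqAle rank_leq_row andbT; have [/eqP rn|] := boolP (\rank A == n); last by left.
right=> u /sP[c ->].
have /submxP[d ->] : (c <= A)%MS by apply: submx_full; rewrite /row_full rn.
exact: QU.
Qed.

Lemma spanned_dependent n U (v : 'I_n.+1 -> V) : spanned n U -> (forall i, U (v i)) ->
  exists2 c : 'rV[F]_n.+1, c != 0 & \sum_i c 0 i *: v i = 0.
Proof.
move=> [s sP] Uv; have /choice[M MP] := fun i => (sP (v i)).1 (Uv i).
pose A := \matrix_(i, j) M i 0 j.
have : kermx A != 0.
  rewrite -mxrank_eq0 mxrank_ker subn_eq0 -ltnNge ltnS; exact: rank_leq_col.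
case/rowV0Pn=> c /sub_kermxP cA c0; exists c => //.
under eq_bigr do rewrite MP scaler_sumr.
rewrite exchange_big /= big1 // => j _.
under eq_bigr do rewrite scalerA.
rewrite -scaler_suml; suff -> : \sum_i c 0 i * M i 0 j = 0 by rewrite scale0r.
transitivity ((c *m A) 0 j); last by rewrite cA mxE.
by rewrite mxE; apply: eq_bigr => i _; rewrite mxE.
Qed.

Definition fin_dim : Prop := exists n, spanned n setT.
End FiniteSpan.

Section PolyEval.
Variables (K : fieldType) (V : lmodType K).

Definition peval (P : {poly K}) (f : V -> V) (v : V) : V :=
  \sum_(i < size P) P`_i *: iter i f v.

Lemma peval_widen n (P : {poly K}) f v : (size P <= n)%N -> peval P f v = \sum_(i < n) P`_i *: iter i f v.
Proof.
move=> Pn; rewrite /peval (big_ord_widen n (fun i => P`_i *: iter i f v)) // big_mkcond /=.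
by apply: eq_bigr => i _; case: ltnP => // iP; rewrite nth_default // scale0r.
Qed.

Lemma pevalD P Q f v : peval (P + Q) f v = peval P f v + peval Q f v.
Proof.
rewrite !(@peval_widen (maxn (size P) (size Q))) ?leq_maxl ?leq_maxr ?size_polyD //.
by rewrite -big_split; apply: eq_bigr => i _; rewrite coefD scalerDl.
Qed.
Lemma pevalC c f v : peval c%:P f v = c *: v.
Proof. by rewrite (@peval_widen 1) ?size_polyC_leq1 // big_ord1 coefC. Qed.
Lemma pevalZ c P f v : peval (c *: P) f v = c *: peval P f v.
Proof.
rewrite !(@peval_widen (size P)) ?size_scale_leq // scaler_sumr.
by apply: eq_bigr => i _; rewrite coefZ scalerA.
Qed.
Lemma pevalMX P f v : peval (P * 'X) f v = peval P f (f v).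
Proof.
rewrite (@peval_widen (size P).+1); last first.
  by rewrite (leq_trans (size_polyMleq _ _)) // size_polyX addn2.
rewrite big_ord_recl coefMX eqxx scale0r add0r.
by apply: eq_bigr => i _; rewrite coefMX /= -iterSr.
Qed.
Lemma pevalX f v : peval 'X f v = f v.
Proof. by rewrite -[X in peval X]mul1r pevalMX (pevalC 1) scale1r. Qed.
Lemma pevalXn n f v : peval 'X^n f v = iter n f v.
Proof.
elim: n v => [|n IH] v; first by rewrite expr0 (pevalC 1) scale1r.
by rewrite exprSr pevalMX IH iterSr.
Qed.
Lemma peval_XsubC c f v : peval ('X - c%:P) f v = f v - c *: v.
Proof. by rewrite -scaleN1r pevalD pevalX -scaleN1r scalerA pevalZ pevalC scalerA. Qed.

Section Lin.
Variables (f : V -> V) (fl : linear f).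
Let fS : semilin idfun f := fl.
Lemma pevalC_lin P v : f (peval P f v) = peval P f (f v).
Proof.
rewrite /peval (addmap_sum _ _ _ (@semilinD _ _ idfun _ _ _ fS)).
by apply: eq_bigr => i _; rewrite (@semilinZ _ _ idfun _ _ _ fS) -iterS iterSr.
Qed.
Lemma iter_linear i : linear (iter i f).
Proof. by elim: i => // i IH c u v; rewrite /= IH fl. Qed.
Lemma peval_linear P : linear (peval P f).
Proof.
move=> c u v; rewrite /peval scaler_sumr -big_split; apply: eq_bigr => i _ /=.
by rewrite iter_linear scalerDr !scalerA mulrC.
Qed.
Lemma pevalM P Q v : peval (P * Q) f v = peval P f (peval Q f v).
Proof.
elim/poly_ind: P Q v => [|P c IH] Q v.
  by rewrite mul0r !(pevalC 0) !scale0r.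
rewrite mulrDl !pevalD pevalMX -mulrA ['X * Q]mulrC IH pevalMX -pevalC_lin.
by rewrite mul_polyC pevalZ pevalC.
Qed.
Lemma peval_exp n P v : peval (P ^+ n) f v = iter n (peval P f) v.
Proof.
elim: n v => [|n IH] v; first by rewrite expr0 (pevalC 1) scale1r.
by rewrite exprS pevalM IH.
Qed.
End Lin.

Lemma peval_iter q (P : {poly K}) f v : (0 < q)%N ->
  peval (P \Po 'X^q) f v = peval P (iter q f) v.
Proof.
move=> q0; rewrite (@peval_widen (size P * q)); last by rewrite comp_poly_Xn // size_poly.
rewrite /peval.
transitivity (\sum_(0 <= i < size P * q) (P \Po 'X^q)`_i *: iter i f v); first by rewrite big_mkord.
rewrite big_nat_mul big_mkord; apply: eq_bigr => i _.
rewrite -{1}[(i * q)%N]add0n big_addn mulSn addnK; case: q q0 => // q _; rewrite big_nat_recl //.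
rewrite big1_seq ?addr0 => [|j].
  rewrite add0n coef_comp_poly_Xn // dvdn_mull // mulnK //.
  by rewrite [LHS]addr0; congr (_ *: _); elim: (nat_of_ord i) => [|k IH] //; rewrite mulSn iterD IH.
rewrite mem_index_iota /= => jq; rewrite coef_comp_poly_Xn //.
rewrite dvdn_addl ?dvdn_mull // gtnNdvd // ?scale0r //.
Qed.
End PolyEval.

(** Only the one vector [v] is killed. For an endomorphism of an irreducible module, Schur's lemma
    then makes the whole operator [peval P f] vanish. *)
Lemma fin_dim_annihilator (F : fieldType) (V : lmodType F) (f : V -> V) (v : V) :
  fin_dim V -> exists2 P : {poly F}, P != 0 & peval P f v = 0.
Proof.
move=> [n nV]; have [//|c c0 cv] := spanned_dependent (v := fun i => iter i f v) nV.
exists (\poly_(i < n.+1) (if insub i is Some j then c 0 j else 0)).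
  apply: contraNneq c0 => /polyP P0; apply/eqP/rowP => i; rewrite mxE.
  by have := P0 i; rewrite coef0 coef_poly ltn_ord valK.
rewrite (@peval_widen _ _ n.+1) ?size_poly // -[RHS]cv; apply: eq_bigr => i _.
by rewrite coef_poly ltn_ord valK.
Qed.

(** The degree of [P] must vanish in [K], which forces a positive characteristic [p]; every
    coefficient whose index is prime to [p] is then zero. *)
Lemma deriv_eq0_comp (K : fieldType) (P : {poly K}) : (1 < size P)%N -> P^`() = 0 ->
  exists p (Q : {poly K}), [/\ p \in [pchar K], (size Q < size P)%N & P = Q \Po 'X^p].
Proof.
move=> P1 P'0.
have cP i : P`_i.+1 * i.+1%:R = 0 by rewrite mulr_natr -coef_deriv P'0 coef0.
have n0 : ((size P).-1%:R : K) == 0.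
  have := cP (size P).-2; rewrite (_ : (size P).-2.+1 = (size P).-1); last by case: (size P) P1 => [|[]].
  move=> /eqP; rewrite mulf_eq0 -lead_coefE lead_coef_eq0.
  by case/orP=> // /eqP P0; rewrite P0 size_poly0 in P1.
have [|p pK] := natf0_pchar _ n0; first by case: (size P) P1 => [|[]].
have p_pr := pcharf_prime pK; have p0 := prime_gt0 p_pr.
exists p, (\poly_(i < (size P).-1) P`_(i * p)); split=> //.
  by rewrite (leq_ltn_trans (size_poly _ _)) // ltn_predL ltnW.
apply/polyP=> i; rewrite coef_comp_poly_Xn // coef_poly.
case: ifP => [pi|pi]; last first.
  case: i pi => [|i] pi; first by rewrite dvdn0 in pi.
  have /eqP := cP i; rewrite mulf_eq0 -(dvdn_pcharf pK) pi orbF => /eqP //.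
rewrite divnK //; case: ltnP => // h; rewrite nth_default //.
have {}h : (p * (size P).-1 <= i)%N by rewrite mulnC -leq_divRL.
case: (size P) P1 h => [|[|n]] //= _ h; apply: leq_trans h.
by rewrite (leq_trans (_ : _ <= 2 * n.+1)%N) ?leq_mul2r ?prime_gt1 // mul2n -addnn addnS addSn !ltnS leq_addr.
Qed.

(** * Division algebras over separably closed fields *)

Definition sep_closed (K : fieldType) : Prop :=
  forall p : {poly K}, separable_poly p -> (1 < size p)%N -> exists x, root p x.

Section DivisionAlgebra.
Variables (K : fieldType) (V : lmodType K) (D : set (V -> V)).
Hypothesis sepK : sep_closed K.
Hypothesis Dlin : forall f, D f -> linear f.
Hypothesis DZ : forall c f, D f -> D (fun v => c *: f v).
Hypothesis DD : forall f g, D f -> D g -> D (fun v => f v + g v).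
Hypothesis Did : D id.
Hypothesis Dcomp : forall f g, D f -> D g -> D (f \o g).
Hypothesis Dinv : forall f, D f -> (exists v, f v != 0) ->
  exists2 g, D g & cancel f g /\ cancel g f.
Hypothesis Dalg : forall f, D f -> exists2 P : {poly K}, P != 0 & forall v, peval P f v = 0.
Variable v0 : V.
Hypothesis v00 : v0 != 0.

Let DS f (Df : D f) : semilin idfun f := Dlin Df.
Let Df0 f (Df : D f) : f 0 = 0 := semilin0 (iota := idfun) (DS Df).

Let Diter n f : D f -> D (iter n f).
Proof. by move=> Df; elim: n => // n IH; exact: Dcomp Df IH. Qed.

Let Dpeval P f : D f -> D (peval P f).
Proof.
move=> Df; rewrite /peval; elim: (size P) => [|n IH].
  rewrite (_ : (fun v => _) = (fun v => 0 *: v)); first exact: (DZ 0 Did).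
  by apply/funext => v; rewrite big_ord0 scale0r.
rewrite (_ : (fun v => _) = (fun v => (\sum_(i < n) P`_i *: iter i f v) + P`_n *: iter n f v)).
  by apply: DD => //; apply: DZ; apply: Diter.
by apply/funext => v; rewrite big_ord_recr.
Qed.

Let Dnz f : D f -> ~ (forall v, f v = 0) -> injective f.
Proof.
by move=> Df /existsNP[v /eqP fv]; have [|g _ [fK _]] := Dinv Df; [exists v|exact: can_inj fK].
Qed.

Let Dzero f g : D f -> D g -> (forall v, f (g v) = 0) -> (forall v, f v = 0) \/ (forall v, g v = 0).
Proof.
move=> Df Dg fg; have [|/Dnz fi] := pselect (forall v, f v = 0); first by left.
by right=> v; apply: fi => //; rewrite fg Df0.
Qed.

(** A polynomial of least degree killing [f] has no proper factorization, as [D] has no zero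
    divisors. If its derivative vanishes, it is a polynomial in the p-th power, and induction
    applies to [iter p f]; otherwise it is separable, has a root in [K] and is linear. In
    characteristic zero the condition on [q] means [q = 1]. *)
Lemma division_purely_insep f : D f ->
  exists q c, [pchar K].-nat q /\ forall v, iter q f v = c *: v.
Proof.
move=> Df; have [P P0 Pf] := Dalg Df.
elim: {P}(size P) {-2}P (leqnn (size P)) P0 f Df Pf => [|n IH] P Pn P0 f Df Pf.
  by move: Pn; rewrite leqn0 size_poly_eq0 (negPf P0).
have [[Q [Q0 QP Qf]]|minP] :=
  pselect (exists Q : {poly K}, [/\ Q != 0, (size Q < size P)%N & forall v, peval Q f v = 0]).
  by apply: (IH Q) => //; rewrite -ltnS (leq_trans QP).
have {}minP Q : Q != 0 -> (forall v, peval Q f v = 0) -> (size P <= size Q)%N.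
  by move=> Q0 Qf; rewrite leqNgt; apply/negP => QP; apply: minP; exists Q.
have fl := Dlin Df.
have minM Q R : P = Q * R -> size Q = 1%N \/ size R = 1%N.
  move=> PE; have [Q0 R0] : Q != 0 /\ R != 0 by move: P0; rewrite PE mulf_eq0 negb_or => /andP.
  have sPE : size P = (size Q + size R).-1 by rewrite PE size_mul.
  have [Q1 R1] : (0 < size Q)%N /\ (0 < size R)%N by rewrite !size_poly_gt0.
  have QR v : peval Q f (peval R f v) = 0 by rewrite -pevalM // -PE.
  have [h|h] := Dzero (Dpeval Q Df) (Dpeval R Df) QR.
  - right; have := minP _ Q0 h; rewrite sPE; case: (size R) R1 => // -[|k] // _.
    by rewrite addnS /= addnS leqNgt ltnS leq_addr.
  - left; have := minP _ R0 h; rewrite sPE; case: (size Q) Q1 => // -[|k] // _.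
    by rewrite addSn /= addSn leqNgt ltnS leq_addl.
have P1 : (1 < size P)%N.
  rewrite ltnNge; apply/negP => /size1_polyC PE; move: (Pf v0) P0; rewrite PE pevalC.
  by move=> /eqP; rewrite scaler_eq0 (negPf v00) orbF polyC_eq0 => ->.
have [P'0|P'0] := eqVneq P^`() 0.
  have [p [Q [pK QP PE]]] := deriv_eq0_comp P1 P'0.
  have p0 := prime_gt0 (pcharf_prime pK).
  have Qn : (size Q <= n)%N by rewrite -ltnS (leq_trans QP).
  have Q0 : Q != 0 by apply: contraNneq P0 => Q0; rewrite PE Q0 comp_poly0.
  have Qf v : peval Q (iter p f) v = 0 by rewrite -peval_iter // -PE.
  have [q [c [qK qc]]] := IH Q Qn Q0 (iter p f) (Diter p Df) Qf.
  exists (q * p)%N, c; rewrite pnatM qK pnatE ?(pcharf_prime pK) //; split=> // v.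
  rewrite -qc; elim: (q) v => // k IHk v.
  by rewrite mulSn iterD IHk.
have sepP : separable_poly P.
  rewrite unlock coprimep_def; set g := gcdp _ _.
  have gP : g %| P by exact: dvdp_gcdl.
  have [] := minM (P %/ g) g (esym (divpK gP)); last by move->.
  move=> s1; have gP' := dvdp_leq P'0 (dvdp_gcdr P P^`()).
  have : size P = size g.
    rewrite -[in LHS](divpK gP) size_mul ?s1 // -?size_poly_gt0 ?s1 //.
    by rewrite size_poly_gt0; apply: contraTneq gP => ->; rewrite dvd0p.
  by move=> sPg; have := leq_ltn_trans gP' (lt_size_deriv P0); rewrite -/g sPg ltnn.
have [x /factor_theorem[R PE]] := sepK sepP P1.
exists 1%N, x; split=> // v /=.
have Rx w : peval R f (peval ('X - x%:P) f w) = 0 by rewrite -pevalM // -PE.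
have [h|h] := Dzero (Dpeval R Df) (Dpeval ('X - x%:P) Df) Rx.
- have R0 : R != 0 by apply: contraNneq P0 => R0; rewrite PE R0 mul0r.
  by have := minP _ R0 h; rewrite PE size_Mmonic ?monicXsubC // size_XsubC addn2 ltnn.
- by have /eqP := h v; rewrite peval_XsubC subr_eq0 => /eqP.
Qed.

(* Jacobson-Noether: if a^q is central for a power q of the characteristic, then
   T : x |-> a x a^-1 satisfies (T - 1)^q = 0; a last nonzero iterate of T - 1
   gives w with a w a^-1 = w + 1, which contradicts w^q being central. *)
Lemma division_sep_closed :
  (forall z, D z -> (forall f, D f -> f \o z = z \o f) -> exists c, forall v, z v = c *: v) ->
  forall a, D a -> exists c, forall v, a v = c *: v.
Proof.
move=> center a Da; apply: contrapT => anc.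
have [q [c [qK aq]]] := division_purely_insep Da.
have [|a' Da' [aK a'K]] := Dinv Da.
  apply: contrapT => a0; apply: anc; exists 0 => v; rewrite scale0r.
  by apply: contrapT => /eqP av; apply: a0; exists v.
have al := Dlin Da; have a'l := Dlin Da'.
pose T (x : V -> V) : V -> V := a \o x \o a'.
have Tl : linear T.
  move=> d x y; apply/funext => v /=.
  exact: al.
have TD x : D x -> D (T x) by move=> Dx; apply: Dcomp Da'; apply: Dcomp Da Dx.
have DB x y : D x -> D y -> D (x - y).
  move=> Dx Dy; have := DD Dx (DZ (-1) Dy); congr (D _).
  by apply/funext => v; rewrite scaleN1r.
pose N (x : V -> V) : V -> V := T x - x.
have ND x : D x -> D (N x) by move=> Dx; apply: DB => //; apply: TD.
have NE x : N x = peval ('X - 1%:P) T x by rewrite peval_XsubC scale1r.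
have NS : semilin idfun N by move=> d x y; rewrite !NE (peval_linear Tl).
have Nq x (Dx : D x) : iter q N x = 0.
  have -> : iter q N x = peval (('X - 1%:P) ^+ q) T x.
    by rewrite peval_exp //; apply: eq_iter => y; rewrite NE.
  have -> : ('X - 1%:P : {poly K}) ^+ q = 'X^q - 1.
    apply: (addIr 1); rewrite subrK -[X in _ + X](expr1n _ q) -exprDn_pchar ?subrK //.
    by apply: sub_in_pnat qK => p _; rewrite pchar_poly.
  rewrite pevalD pevalXn -scaleN1r pevalZ (pevalC 1) scale1r scaleN1r.
  apply/eqP; rewrite subr_eq0; apply/eqP/funext => v.
  have -> : iter q T x v = iter q a (x (iter q a' v)).
    by elim: (q) v => // k IHk v; apply: (etrans (congr1 a (IHk (a' v)))); rewrite [iter k.+1 a' v]iterSr.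
  rewrite aq -[X in _ = x X](_ : iter q a (iter q a' v) = v).
    by rewrite aq (semilinZ (iota := idfun) (DS Dx)).
  by elim: (q) => // k; rewrite [iter k.+1 a' v]iterS iterSr a'K.
have [x Dx Nx] : exists2 x, D x & N x <> 0.
  apply: contrapT => h; apply: anc; apply: center => // f Df.
  have Nf : N f = 0 by apply: contrapT => Nf; apply: h; exists f.
  apply/funext => v /=; have : T f (a v) = f (a v).
    by have := congr1 (fun g : V -> V => g (a v)) Nf => /eqP; rewrite [_ == _]subr_eq0 => /eqP.
  by rewrite /T /= aK.
have [y [Dy Ny NNy]] : exists y, [/\ D y, N y <> 0 & N (N y) = 0].
  have ex : exists k, iter k N x == 0 by exists q; rewrite Nq.
  case: (ex_minnP ex) => k /eqP kN kmin.
  have N0 : N 0 = 0 := semilin0 (iota := idfun) NS.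
  case: k kN kmin => [|[|k]] kN kmin.
  - by case: Nx; rewrite [x]kN N0.
  - by case: Nx.
  exists (iter k N x); split=> //; first by elim: k {kN kmin} => // k IHk; apply: ND.
  by move/eqP => /(kmin k.+1); rewrite ltnn.
set u := N y; have Du : D u := ND _ Dy.
have [|u' Du' [uK u'K]] := Dinv Du.
  by apply: contrapT => h; apply: Ny; apply/funext => v; apply: contrapT => /eqP uv; apply: h; exists v.
have Tu v : a (u (a' v)) = u v.
  by have := congr1 (fun g : V -> V => g v) NNy => /eqP; rewrite [_ == _]subr_eq0 => /eqP.
have Ty v : a (y (a' v)) = y v + u v by rewrite /u /N /= addrC [LHS]/(T y v) subrK.
have Tu' v : a (u' (a' v)) = u' v by apply: (can_inj uK); rewrite -[LHS]Tu aK u'K a'K u'K.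
pose w := u' \o y; have Dw : D w := Dcomp Du' Dy.
have Tw v : a (w (a' v)) = w v + v.
  rewrite /w /= -[y (a' v)]aK Tu' Ty (semilinD (iota := idfun) (DS Du')).
  by rewrite uK.
have [n [d [nK wn]]] := division_purely_insep Dw.
have wl := Dlin Dw.
(* The two evaluations of [(w + 1)^n] at [v0]: by Frobenius it is [d + 1], and as the conjugate by
   [a] of the scalar [w^n] it is [d]. *)
have : iter n (fun v => w v + v) v0 = d *: v0 + v0.
  have -> : iter n (fun v => w v + v) v0 = peval (('X + 1) ^+ n) w v0.
    rewrite peval_exp //; apply: eq_iter => v.
    by rewrite pevalD pevalX (pevalC 1) scale1r.
  rewrite exprDn_pchar; last by apply: sub_in_pnat nK => p _; rewrite pchar_poly.
  by rewrite expr1n pevalD pevalXn (pevalC 1) scale1r wn.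
have -> : iter n (fun v => w v + v) v0 = a (iter n w (a' v0)).
  elim: (n) v0 => [|k IHk] v; first by rewrite /= a'K.
  by rewrite iterSr IHk iterSr -Tw aK.
rewrite wn (semilinZ (iota := idfun) (DS Da)) a'K.
by move/eqP; rewrite -subr_eq0 opprD addrA subrr sub0r oppr_eq0 (negPf v00).
Qed.
End DivisionAlgebra.

(** * Extension of isomorphisms to the separable closure *)

Lemma rmorphism_of (R S : nzRingType) (f : R -> S) :
  {morph f : x y / x + y} -> {morph f : x y / x * y} -> f 1 = 1 ->
  exists g : {rmorphism R -> S}, g =1 f.
Proof.
move=> fD fM f1.
have f0 : f 0 = 0 by apply: (addIr (f 0)); rewrite -fD !add0r.
have fB : {morph f : x y / x - y}.
  by move=> x y; apply: (addIr (f y)); rewrite -fD !subrK.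
pose g : {rmorphism R -> S} := HB.pack f (GRing.isZmodMorphism.Build R S f fB)
  (GRing.isMonoidMorphism.Build R S f (conj f1 fM)).
by exists g.
Qed.

Section FixedField.
Variables (F K : fieldType) (iota : {rmorphism F -> K}) (sepK : separable_closure iota).
Implicit Types S : set (K * K).

(* The graph of an F-isomorphism between two subrings of K. *)
Definition partial_iso S : Prop :=
  [/\ forall c, S (iota c, iota c),
      forall a b a' b', S (a, b) -> S (a', b') -> S (a + a', b + b'),
      forall a b a' b', S (a, b) -> S (a', b') -> S (a * a', b * b') &
      forall b, S (0, b) -> b = 0].

(** [p'] is [p] transported along the isomorphism, which is only available as a relation. *)
Definition poly_pair S (p p' : {poly K}) : Prop := forall i, S (p`_i, p'`_i).

(** Dividing an equation of [a] over [F] by powers of X gives one with nonzero constant term, from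
    which the inverse is read off. As it is a polynomial in [a], the subrings related by a
    [partial_iso] are automatically fields. *)
Lemma algebraic_inverse (a : K) : a != 0 ->
  exists q : {poly F}, a * (map_poly iota q).[a] = 1.
Proof.
move=> a0; have [p ps pa] := sepK.1 a.
have := separable_poly_neq0 ps; move: pa; elim/poly_ind: p {ps} => [|p c IH]; first by rewrite eqxx.
rewrite rmorphD rmorphM /= map_polyX map_polyC /= /root hornerMXaddC.
have [-> pa p0|c0 /eqP pa _] := eqVneq c 0.
  apply: IH; last by apply: contraNneq p0 => ->; rewrite mul0r add0r.
  by move: pa; rewrite rmorph0 addr0 mulf_eq0 (negPf a0) orbF.
exists ((- c^-1) *: p); rewrite map_polyZ hornerZ rmorphN fmorphV mulrCA.
have -> : a * (map_poly iota p).[a] = - iota c by apply/eqP; rewrite -addr_eq0 mulrC pa.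
by rewrite mulrNN mulVf // fmorph_eq0.
Qed.

Section Fixed.
Variables (S : set (K * K)) (Sg : partial_iso S).

Lemma partial_iso_uniq a b b' : S (a, b) -> S (a, b') -> b = b'.
Proof.
case: Sg => SF SD SM S0 h h'; apply/eqP; rewrite -subr_eq0; apply/eqP/S0.
have := SD _ _ _ _ h (SM _ _ _ _ (SF (-1)) h').
by rewrite !rmorphN !rmorph1 !mulN1r subrr.
Qed.
Lemma partial_iso00 : S (0, 0).
Proof. by case: Sg => SF _ _ _; have := SF 0; rewrite rmorph0. Qed.
Lemma partial_iso11 : S (1, 1).
Proof. by case: Sg => SF _ _ _; have := SF 1; rewrite rmorph1. Qed.
Lemma poly_pairC a b : S (a, b) -> poly_pair S a%:P b%:P.
Proof. by move=> h i; rewrite !coefC; case: ifP => // _; exact: partial_iso00. Qed.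
Lemma poly_pairX : poly_pair S 'X 'X.
Proof. by move=> i; rewrite !coefX; case: eqP => _; [exact: partial_iso11|exact: partial_iso00]. Qed.
Lemma poly_pairD p p' q q' : poly_pair S p p' -> poly_pair S q q' -> poly_pair S (p + q) (p' + q').
Proof. by case: Sg => _ SD _ _ h k i; rewrite !coefD; exact: SD. Qed.
Lemma poly_pairM p p' q q' : poly_pair S p p' -> poly_pair S q q' -> poly_pair S (p * q) (p' * q').
Proof.
case: Sg => _ SD SM _ h k i; rewrite !coefM.
by apply: (big_rec2 (fun a b => S (a, b))) => [|j a b _ ab]; [exact: partial_iso00|apply: SD => //; apply: SM].
Qed.
Lemma poly_pairN p p' : poly_pair S p p' -> poly_pair S (- p) (- p').
Proof.
case: Sg => SF _ SM _ h i; rewrite !coefN; have := SM _ _ _ _ (SF (-1)) (h i).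
by rewrite rmorphN rmorph1 !mulN1r.
Qed.
Lemma poly_pairXn n : poly_pair S 'X^n 'X^n.
Proof.
elim: n => [|n IH]; first by rewrite expr0; apply: poly_pairC; exact: partial_iso11.
by rewrite exprS; apply: poly_pairM => //; exact: poly_pairX.
Qed.
Lemma poly_pair_horner p p' a b : poly_pair S p p' -> S (a, b) -> S (p.[a], p'.[b]).
Proof.
case: Sg => _ SD SM _; move=> h ab.
rewrite (@horner_coef_wide _ (maxn (size p) (size p')) p) ?leq_maxl //.
rewrite (@horner_coef_wide _ (maxn (size p) (size p')) p') ?leq_maxr //.
apply: (big_rec2 (fun a b => S (a, b))) => [|j c d _ cd]; first exact: partial_iso00.
apply: SD => //; apply: (SM) => //; elim: (nat_of_ord j) => [|k IH]; first exact: partial_iso11.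
by rewrite !exprS; exact: SM.
Qed.
Lemma poly_pair_map (q : {poly F}) : poly_pair S (map_poly iota q) (map_poly iota q).
Proof. by case: Sg => SF _ _ _ i; rewrite !coef_map; exact: SF. Qed.

Lemma partial_iso_inv a b : S (a, b) -> a != 0 -> S (a^-1, b^-1).
Proof.
move=> ab a0; have [q aq] := algebraic_inverse a0.
have h := poly_pair_horner (poly_pair_map q) ab.
have bq : b * (map_poly iota q).[b] = 1.
  apply: (@partial_iso_uniq 1); last exact: partial_iso11.
  by rewrite -aq; case: Sg => _ _ SM _; exact: SM.
have b0 : b != 0 by apply: contra_eqT bq => /negPn/eqP->; rewrite mul0r eq_sym oner_eq0.
by rewrite -[a^-1]mulr1 -[b^-1]mulr1 -{1}aq -bq !mulKf.
Qed.
Lemma partial_iso_inj a : S (a, 0) -> a = 0.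
Proof.
move=> ha; apply/eqP/negPn/negP => a0; have := partial_iso_inv ha a0.
case: Sg => _ _ SM _ h; have := SM _ _ _ _ ha h; rewrite mul0r divff // => h1.
by have /eqP := partial_iso_uniq partial_iso11 h1; rewrite oner_eq0.
Qed.

Variables (x : K) (p p' : {poly K}).
Hypotheses (pp' : poly_pair S p p') (p_mon : p \is monic) (px : root p x).
Hypothesis p_min : forall q q', poly_pair S q q' -> root q x -> q != 0 -> (size p <= size q)%N.

Lemma min_pair_coef n : (size p <= n)%N -> p'`_n = 0.
Proof. by move=> pn; case: Sg => _ _ _; apply; have := pp' n; rewrite nth_default. Qed.
Lemma min_pair_lead : p'`_(size p).-1 = 1.
Proof.
apply: (@partial_iso_uniq 1); last exact: partial_iso11.
by have := pp' (size p).-1; rewrite -lead_coefE (monicP p_mon).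
Qed.
Lemma min_pair_size_gt1 : (1 < size p)%N.
Proof.
rewrite ltnNge; apply/negP => /size1_polyC pE; move: px; rewrite pE rootC -[p`_0]lead_coefC -pE.
by rewrite (monicP p_mon) oner_eq0.
Qed.
Lemma min_pair_size : size p' = size p.
Proof.
apply/eqP; rewrite eqn_leq; apply/andP; split.
  by apply/leq_sizeP => j; exact: min_pair_coef.
rewrite leqNgt; apply/negP => h; have /eqP := min_pair_lead.
rewrite nth_default; first by rewrite eq_sym oner_eq0.
by rewrite -ltnS (leq_trans h) // leqSpred.
Qed.

(** Division by the minimal polynomial [p], carried out on both members of the pair at once, so that
    all coefficients stay related by [S]: the leading terms are cancelled together and the degree of
    [q] drops. *)
Lemma min_pair_dvd q q' : poly_pair S q q' -> root q x -> exists d, q' = d * p'.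
Proof.
elim: {q}(size q) {-2}q (leqnn (size q)) q' => [|n IH] q qn q' qq' qx.
  exists 0; rewrite mul0r; apply/polyP => i; rewrite coef0; case: Sg => _ _ _; apply.
  have := qq' i; suff -> : q = 0 by rewrite coef0.
  by apply/eqP; rewrite -size_poly_eq0 -leqn0.
have [q0|q0] := eqVneq q 0; first by apply: (IH q) => //; rewrite q0 size_poly0.
have pq := p_min qq' qx q0.
pose k := (size q - size p)%N; pose l := lead_coef q; pose l' := q'`_(size q).-1.
have ll : S (l, l') by exact: qq'.
have [|||d dE] := IH (q - l%:P * (p * 'X^k)) _ (q' - l'%:P * (p' * 'X^k)).
- apply/leq_sizeP => j nj; rewrite coefB coefCM coefMXn.
  have qj : (size q <= j.+1)%N by rewrite (leq_trans qn).
  have kj : (k <= j)%N.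
    by rewrite -ltnS (leq_trans _ qj) // /k ltn_subrL (ltn_trans _ min_pair_size_gt1) //= size_poly_gt0.
  rewrite ltnNge kj /=; move: qj; rewrite leq_eqVlt => /orP[/eqP qj|qj].
    have -> : j = (size q).-1 by rewrite qj.
    have -> : ((size q).-1 - k)%N = (size p).-1 by rewrite /k -!subn1 -subnDA addnC subnDA subKn.
    by rewrite -!lead_coefE (monicP p_mon) mulr1 subrr.
  rewrite [q`_j]nth_default // [p`__]nth_default ?mulr0 ?subrr // /k.
  by rewrite leq_subRL // subnK.
- apply: poly_pairD => //; apply: poly_pairN; apply: poly_pairM; first exact: poly_pairC.
  by apply: poly_pairM => //; exact: poly_pairXn.
- by rewrite /root hornerD hornerN !hornerM (rootP qx) (rootP px) mul0r mulr0 subrr.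
exists (d + l'%:P * 'X^k); rewrite mulrDl -dE -[_ * p' in RHS]mulrA ['X^k * p']mulrC.
by rewrite subrK.
Qed.

(** The extension sends [q.[x]] to [q'.[y]]. It is well defined because [q.[x] = 0] makes [q'] a
    multiple of [p'], which vanishes at [y]. *)
Lemma partial_iso_extend y : root p' y ->
  exists S', [/\ partial_iso S', S `<=` S' & S' (x, y)].
Proof.
move=> py.
exists [set u | exists q q', poly_pair S q q' /\ u = (q.[x], q'.[y])]; split.
- split.
  + by move=> c; exists (iota c)%:P, (iota c)%:P; rewrite !hornerC; split=> //; apply: poly_pairC; case: Sg.
  + move=> _ _ _ _ [q [q' [qq [-> ->]]]] [r [r' [rr [-> ->]]]].
    by exists (q + r), (q' + r'); rewrite !hornerD; split=> //; exact: poly_pairD.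
  + move=> _ _ _ _ [q [q' [qq [-> ->]]]] [r [r' [rr [-> ->]]]].
    by exists (q * r), (q' * r'); rewrite !hornerM; split=> //; exact: poly_pairM.
  + move=> b [q [q' [qq [qx ->]]]].
    have [|d ->] := min_pair_dvd qq; first by rewrite /root -qx.
    by rewrite hornerM (rootP py) mulr0.
- by move=> [a b] ab; exists a%:P, b%:P; rewrite !hornerC; split=> //; exact: poly_pairC.
- by exists 'X, 'X; rewrite !hornerX; split=> //; exact: poly_pairX.
Qed.

(** A separable polynomial over [F] that kills [x] is related to itself by [S], so [p'] divides
    it. *)
Lemma min_pair_separable : separable_poly p'.
Proof.
have [q qs qx] := sepK.1 x.
have [//|d qE] := min_pair_dvd (poly_pair_map q) _.
by apply: (@dvdp_separable _ (map_poly iota q)); [rewrite qE dvdp_mulIr|rewrite separable_map].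
Qed.
End Fixed.

Lemma min_pair_exists S x : partial_iso S ->
  exists p p', [/\ poly_pair S p p', p \is monic, root p x &
    forall q q', poly_pair S q q' -> root q x -> q != 0 -> (size p <= size q)%N].
Proof.
move=> Sg.
pose P n := `[< exists p p', [/\ poly_pair S p p', root p x, p != 0 & size p = n] >].
have exP : exists n, P n.
  have [q qs qx] := sepK.1 x.
  exists (size (map_poly iota q)); apply/asboolP; exists (map_poly iota q), (map_poly iota q).
  by split=> //; [exact: poly_pair_map|rewrite map_poly_eq0 separable_poly_neq0].
case: (ex_minnP exP) => n /asboolP[p [p' [pp px p0 pn]]] nmin.
have l0 : lead_coef p != 0 by rewrite lead_coef_eq0.
have ll := partial_iso_inv Sg (pp (size p).-1) l0.
exists ((lead_coef p)^-1%:P * p), ((p'`_(size p).-1)^-1%:P * p'); split.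
- by apply: poly_pairM => //; exact: poly_pairC.
- by rewrite monicE mul_polyC lead_coefZ mulVf.
- by rewrite mul_polyC rootZ ?invr_eq0.
move=> q q' qq qx q0; rewrite mul_polyC size_scale ?invr_eq0 // pn.
by apply: nmin; apply/asboolP; exists q, q'.
Qed.

Lemma partial_iso_swap S : partial_iso S -> partial_iso [set u | S (u.2, u.1)].
Proof.
move=> Sg; case: (Sg) => SF SD SM S0; split=> //=.
- by move=> a b a' b' h h'; exact: SD.
- by move=> a b a' b' h h'; exact: SM.
- by move=> b; exact: partial_iso_inj.
Qed.

Lemma partial_iso_total S : partial_iso S ->
  (forall S', partial_iso S' -> S `<=` S' -> S' `<=` S) -> forall x, exists y, S (x, y).
Proof.
move=> Sg Smax x; have [p [p' [pp pm px pmin]]] := min_pair_exists x Sg.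
have [|y py] := sepK.2 _ (min_pair_separable Sg pp pm px pmin).
  by rewrite (min_pair_size Sg pp pm); exact: min_pair_size_gt1 px.
have [S' [S'g SS' S'xy]] := partial_iso_extend Sg pp pm px pmin py.
by exists y; apply: Smax S'xy.
Qed.

(** A maximal extension of [S] is total, since a new element could be sent to a root of its
    transported minimal polynomial. Its inverse relation is maximal too, hence total, which gives
    surjectivity. *)
Lemma galois_extension S : partial_iso S ->
  exists s : galaut iota, forall a b, S (a, b) -> s a = b.
Proof.
move=> Sg; have [|M [SM Mg Mmax]] := zorn_above Sg.
  move=> C [S0 CS0] CP Ct; split.
  - by move=> c; exists S0 => //; case: (CP _ CS0) => h _ _ _; exact: h.
  - move=> a b a' b' [S1 C1 h1] [S2 C2 h2]; have [h|h] := Ct _ _ C1 C2.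
      by exists S2 => //; case: (CP _ C2) => _ SD _ _; apply: SD => //; exact: h.
    by exists S1 => //; case: (CP _ C1) => _ SD _ _; apply: SD => //; exact: h.
  - move=> a b a' b' [S1 C1 h1] [S2 C2 h2]; have [h|h] := Ct _ _ C1 C2.
      by exists S2 => //; case: (CP _ C2) => _ _ SD _; apply: SD => //; exact: h.
    by exists S1 => //; case: (CP _ C1) => _ _ SD _; apply: SD => //; exact: h.
  - by move=> b [S1 C1 h1]; case: (CP _ C1) => _ _ _; exact.
have [|f fP] := choice (partial_iso_total Mg _); first by move=> S' S'g MS'; exact: Mmax.
have [|g gP] := choice (partial_iso_total (partial_iso_swap Mg) _).
  move=> S' S'g MS' [a b] ab; apply: (Mmax _ _ (partial_iso_swap S'g)) => //.
  by move=> [c d] cd; apply: MS'.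
have fu a b : M (a, b) -> f a = b by move=> h; apply: (partial_iso_uniq Mg (fP a)).
case: (Mg) => MF MD MM M0.
have [|||h hf] := @rmorphism_of K K f.
- by move=> a b; apply: fu; exact: MD.
- by move=> a b; apply: fu; exact: MM.
- by apply: fu; exact: partial_iso11.
have hbij : bijective h.
  exists g => a; last by rewrite hf; apply: fu; exact: gP.
  by apply: (partial_iso_uniq (partial_iso_swap Mg) (gP _)); rewrite /= hf; exact: fP.
have hfix c : h (iota c) = iota c by rewrite hf; exact: fu.
by exists (GalAut hbij hfix) => a b ab; rewrite /= hf; apply: fu; apply: SM.
Qed.

(** Starting from the identity of [F], the minimal polynomial of [x] is its own transport. If it is
    not linear, separability gives a root other than [x], and an automorphism moves [x] there. *)
Lemma fixed_field x : (forall s : galaut iota, s x = x) -> exists c, x = iota c.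
Proof.
move=> xfix; pose S : set (K * K) := [set u | exists c, u = (iota c, iota c)].
have Sg : partial_iso S.
  split.
  - by move=> c; exists c.
  - by move=> _ _ _ _ [c [-> ->]] [d [-> ->]]; exists (c + d); rewrite rmorphD.
  - by move=> _ _ _ _ [c [-> ->]] [d [-> ->]]; exists (c * d); rewrite rmorphM.
  - by move=> b [c [<- ->]].
have [p [p' [pp pm px pmin]]] := min_pair_exists x Sg.
have p'E : p' = p by apply/polyP => i; have [c [-> ->]] := pp i.
have sp := min_pair_separable Sg pp pm px pmin; rewrite p'E in sp.
have [R pE] := factor_theorem _ _ px.
have R0 : R != 0 by apply: contraTneq sp => R0; rewrite pE R0 mul0r; apply/negP => /separable_poly_neq0; rewrite eqxx.
have R_mon : R \is monic by move: pm; rewrite pE monicMr // monicXsubC.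
have [R1|R1] := leqP (size R) 1.
  have RE : R = 1 by rewrite (size1_polyC R1) -[R`_0]lead_coefC -size1_polyC // (monicP R_mon).
  have [c [cE _]] := pp 0%N; exists (- c); rewrite rmorphN -cE pE RE mul1r coefB coefX coefC sub0r opprK //.
move: sp; rewrite pE separable_root => /andP[Rs Rx].
have [y Ry] := sepK.2 _ Rs R1.
have py : root p' y by rewrite p'E pE rootM Ry.
have [S' [S'g _ S'xy]] := partial_iso_extend Sg pp pm px pmin py.
have [s sP] := galois_extension S'g.
by move: Rx; rewrite -(xfix s) (sP _ _ S'xy) Ry.
Qed.
End FixedField.

(** * Modules over a set of operators *)

Section Galois.
Variables (F K : fieldType) (iota : {rmorphism F -> K}).

Lemma galaut_inv (s : galaut iota) : exists s' : galaut iota, cancel s s' /\ cancel s' s.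
Proof.
have [g sK gK] := ga_bij s; have si := can_inj sK.
have [|||h hg] := @rmorphism_of K K g.
- by move=> x y; apply: si; rewrite rmorphD !gK.
- by move=> x y; apply: si; rewrite rmorphM !gK.
- by apply: si; rewrite gK rmorph1.
have hb : bijective h by exists s => x; rewrite hg.
have hf c : h (iota c) = iota c by rewrite hg -[in LHS](ga_fix s) sK.
by exists (GalAut hb hf); split=> x /=; rewrite hg.
Qed.

Lemma galaut_comp (s t : galaut iota) : exists u : galaut iota, u =1 s \o t.
Proof.
have ub : bijective (s \o t) by apply: bij_comp; exact: ga_bij.
have uf c : (s \o t) (iota c) = iota c by rewrite /= !ga_fix.
by exists (@GalAut _ _ iota (s \o t) ub uf).
Qed.

Definition galaut_id : galaut iota :=
  @GalAut _ _ iota idfun (@Bijective _ _ idfun idfun (fun _ => erefl) (fun _ => erefl)) (fun _ => erefl).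
End Galois.
Arguments galaut_id {F K iota}.

Section Twisted.
Variables (J : Type) (tw : bool -> J -> J).
Hypothesis tw0 : forall j, tw false j = j.
Hypothesis twA : forall b c j, tw b (tw c j) = tw (b (+) c) j.

Lemma twK b j : tw b (tw b j) = j.
Proof. by rewrite twA addbb tw0. Qed.

(* For b = true these are the odd homomorphisms. *)
Definition shom (E E' : fieldType) (s : E -> E') (b : bool) (V : jmod J E) (V' : jmod J E')
    (f : V -> V') : Prop :=
  semilin s f /\ forall j v, f (jact j v) = jact (tw b j) (f v).
Arguments shom {E E'} s b V V' f.

Lemma shom_comp (E1 E2 E3 : fieldType) (s : E1 -> E2) (t : E2 -> E3) (u : E1 -> E3) b c d
    (V1 : jmod J E1) (V2 : jmod J E2) (V3 : jmod J E3) f g :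
  shom s b V1 V2 f -> shom t c V2 V3 g -> (forall x, u x = t (s x)) -> d = c (+) b ->
  shom u d V1 V3 (fun v => g (f v)).
Proof.
move=> [fS fa] [gS ga] us ->; split; first exact: semilin_comp us fS gS.
by move=> j v; rewrite fa ga twA.
Qed.

Lemma shom_id (E : fieldType) (V : jmod J E) : shom idfun false V V id.
Proof. by split=> // j v; rewrite tw0. Qed.

Lemma shom_scale (E : fieldType) (V : jmod J E) c : shom idfun false V V (fun v => c *: v).
Proof. by split=> [|j v]; [exact: semilin_scale|rewrite tw0 jactZ]. Qed.

Lemma shom_add (E E' : fieldType) (s : {rmorphism E -> E'}) b (V : jmod J E) (V' : jmod J E') f g :
  shom s b V V' f -> shom s b V V' g -> shom s b V V' (fun v => f v + g v).
Proof.
by move=> [fS fa] [gS ga]; split; [exact: semilin_add|move=> j v; rewrite fa ga jactD].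
Qed.

Section Maps.
Variables (E E' : fieldType) (s : {rmorphism E -> E'}) (b : bool).
Variables (V : jmod J E) (V' : jmod J E') (f : V -> V').
Hypothesis fh : shom s b V V' f.

Lemma shomD : addmap f. Proof. exact: semilinD fh.1. Qed.
Lemma shom0 : f 0 = 0. Proof. exact: addmap0 shomD. Qed.
Lemma shomZ c v : f (c *: v) = s c *: f v. Proof. exact: semilinZ fh.1 _ _. Qed.
Lemma shomB u v : f (u - v) = f u - f v.
Proof. by rewrite shomD -scaleN1r shomZ rmorphN rmorph1 scaleN1r. Qed.
Lemma shom_inj0 : (forall v, f v = 0 -> v = 0) -> injective f.
Proof.
by move=> h u v uv; apply/eqP; rewrite -subr_eq0; apply/eqP/h; rewrite shomB uv subrr.
Qed.

Lemma shom_preimage U : stable U -> stable (f @^-1` U).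
Proof.
move=> [[U0 UZ] Ua]; split; first split.
- by rewrite /preimage /= shom0.
- by move=> c u v Uu Uv; rewrite /preimage /= fh.1; exact: UZ.
- by move=> j u Uu; rewrite /preimage /= fh.2; exact: Ua.
Qed.

Lemma stable0 (E0 : fieldType) (V0 : jmod J E0) : stable [set (0 : V0)].
Proof.
split=> [|j _ ->]; last exact: jact0.
by split=> // c _ _ -> ->; rewrite scaler0 addr0.
Qed.

Lemma schur_injective : jirr V -> (exists v, f v != 0) -> injective f.
Proof.
move=> [_ Virr] [v0 fv0]; apply: shom_inj0 => v fv; apply: contrapT => /eqP v_n0.
move: fv0; have := Virr _ (shom_preimage (stable0 _)).
by move=> /(_ (ex_intro2 _ _ v fv v_n0) v0) ->; rewrite eqxx.
Qed.

Variable s' : E' -> E.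
Hypothesis s'K : cancel s' s.

(** The range of a semilinear map is closed under scalars because the field morphism is onto, here
    through its section [s']. *)
Lemma shom_range : stable (range f).
Proof.
split; first split.
- by exists 0 => //; exact: shom0.
- move=> c _ _ [u _ <-] [v _ <-]; exists (s' c *: u + v) => //.
  by rewrite fh.1 s'K.
- by move=> j _ [u _ <-]; exists (jact (tw b j) u) => //; rewrite fh.2 twK.
Qed.

Lemma schur_surjective : jirr V' -> (exists v, f v != 0) -> forall w, exists v, f v = w.
Proof.
move=> [_ Virr] [v fv] w.
have [|u _ uw] := Virr _ shom_range _ w; last by exists u.
by exists (f v) => //; exists v.
Qed.

Lemma shom_inv g : cancel f g -> cancel g f -> shom s' b V' V g.
Proof.
move=> fK gK; have fi := can_inj fK; split=> [c u v|j v]; apply: fi; rewrite gK.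
  by rewrite fh.1 !gK s'K.
by rewrite fh.2 twK gK.
Qed.

Lemma schur_inverse : jirr V -> jirr V' -> (exists v, f v != 0) ->
  exists g, [/\ cancel f g, cancel g f & shom s' b V' V g].
Proof.
move=> Vi V'i fn0; have fi := schur_injective Vi fn0.
have [g gK] := choice (schur_surjective V'i fn0).
have fK : cancel f g by move=> v; apply: fi; rewrite gK.
by exists g; split=> //; exact: shom_inv.
Qed.
End Maps.

(** * Base change of modules with operators *)

Section BaseChange.
Variables (F K : fieldType) (iota : {rmorphism F -> K}).

Section Action.
Variable W : jmod J F.
Lemma bcactS j : semilin iota (fun w : W => bj iota (jact j w)).
Proof. exact: (semilin_compr (jactS (V := W) j) (semilin_bj iota W)). Qed.
Lemma bcact_linear j : linear (bclift iota (fun w : W => bj iota (jact j w))).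
Proof. exact: semilin_bclift (bcactS j). Qed.
Definition jbc : jmod J K := JMod bcact_linear.

Lemma jact_bj j (w : W) : jact j (bj iota w : jbc) = bj iota (jact j w).
Proof. exact: (bcliftE (bcactS j) w). Qed.

Lemma shom_bj : shom iota false W jbc (bj iota).
Proof. by split=> [|j w]; [exact: semilin_bj|rewrite tw0 jact_bj]. Qed.

Lemma shom_bc_ext (E : fieldType) (s : {rmorphism K -> E}) b c (V : jmod J E) (f g : jbc -> V) :
  shom s b jbc V f -> shom s c jbc V g -> (forall w, f (bj iota w) = g (bj iota w)) -> f =1 g.
Proof. by move=> [fS _] [gS _]; exact: bc_ext fS gS. Qed.

Lemma shom_bclift b (V : jmod J K) (f : W -> V) :
  shom iota b W V f -> shom idfun b jbc V (bclift iota f).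
Proof.
move=> [fS fa]; split; first exact: semilin_bclift.
move=> j; apply: bc_ext0 => [x y|x y|e w].
- by rewrite jactD (bcliftD fS).
- by rewrite (bcliftD fS) jactD.
rewrite jactZ jact_bj !(semilinZ (iota := idfun) (semilin_bclift fS)) jactZ.
by rewrite !(bcliftE fS) fa.
Qed.

(** The Galois action [s] (x) id on K (x) W; operators defined over [F] commute with it. *)
Definition gact (s : K -> K) : jbc -> jbc :=
  tlift (fun (e : rscal iota K^o) (w : W) => s (e : K) *: (bj iota w : jbc)).

Lemma balanced_gact (s : galaut iota) :
  balanced (fun (e : rscal iota K^o) (w : W) => s (e : K) *: (bj iota w : jbc)).
Proof.
split=> [v d e|d v w|c e v] /=.
- by rewrite rmorphD scalerDl.
- by rewrite (semilinD (semilin_bj _ _)) scalerDr.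
- rewrite (semilinZ (semilin_bj _ _)) scalerA -[iota c in RHS](ga_fix s) -rmorphM mulrC; congr (s _ *: _).
Qed.
Lemma gactE (s : galaut iota) c w : gact s (c *: bj iota w) = s c *: bj iota w.
Proof. exact: (etrans (congr1 (gact s) (esym (bjE iota c w))) (tliftE _ _ (balanced_gact s))). Qed.
Lemma shom_gact (s : galaut iota) : shom s false jbc jbc (gact s).
Proof.
have gD : addmap (gact s) := tliftD (balanced_gact s).
split=> [|j].
  apply: semilinP => // c; apply: bc_ext0 => [x y|x y|e w].
  - by rewrite scalerDr gD.
  - by rewrite gD scalerDr.
  - by rewrite scalerA !gactE rmorphM scalerA.
apply: bc_ext0 => [x y|x y|e w].
- by rewrite jactD gD.
- by rewrite gD jactD.
- by rewrite jactZ jact_bj !gactE jactZ tw0 jact_bj.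
Qed.

Section Proj.
Variable l : rscal iota K^o -> F.
Hypothesis ll : scalar l.
Definition bproj : jbc -> W := tlift (fun (e : rscal iota K^o) (w : W) => l e *: w).
Let lS : semilin idfun (l : rscal iota K^o -> F^o) := ll.
Lemma balanced_bproj : balanced (fun (e : rscal iota K^o) (w : W) => l e *: w).
Proof.
split=> [w d e|d v w|c e v] /=.
- by rewrite (semilinD (iota := idfun) lS) scalerDl.
- by rewrite scalerDr.
- by rewrite (semilinZ (iota := idfun) lS) scalerA [_ *: _ in LHS]/GRing.scale /= mulrC.
Qed.
Lemma bprojE c w : bproj (c *: bj iota w) = l c *: w.
Proof. exact: (etrans (congr1 bproj (esym (bjE iota c w))) (tliftE _ _ balanced_bproj)). Qed.
Lemma bproj_bj w : bproj (bj iota w) = l 1 *: w.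
Proof. by rewrite -[bj iota w]scale1r bprojE. Qed.
Lemma bprojD : addmap bproj. Proof. exact: tliftD balanced_bproj. Qed.
Lemma bprojZ c x : bproj (iota c *: x) = c *: bproj x.
Proof.
move: x; apply: bc_ext0 => [x y|x y|e w].
- by rewrite scalerDr bprojD.
- by rewrite bprojD scalerDr.
rewrite scalerA !bprojE scalerA; congr (_ *: _).
exact: (semilinZ (iota := idfun) lS).
Qed.
Lemma bproj_act j x : bproj (jact j x) = jact j (bproj x).
Proof.
move: x; apply: bc_ext0 => [x y|x y|e w].
- by rewrite jactD bprojD.
- by rewrite bprojD jactD.
by rewrite jactZ jact_bj !bprojE jactZ.
Qed.
End Proj.

Section Coef.
Variable m : W -> F.
Hypothesis ml : scalar m.
Let mS : semilin idfun (m : W -> F^o) := ml.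
Definition bcoef : jbc -> rscal iota K^o := tlift (fun (e : rscal iota K^o) (w : W) => m w *: e).
Lemma balanced_bcoef : balanced (fun (e : rscal iota K^o) (w : W) => m w *: e).
Proof.
split=> [w d e|d v w|c e v] /=.
- by rewrite scalerDr.
- by rewrite (semilinD (iota := idfun) mS) scalerDl.
- by rewrite (semilinZ (iota := idfun) mS) scalerA [_ *: _ in RHS]/GRing.scale /= mulrC.
Qed.
Lemma bcoefD : addmap bcoef. Proof. exact: tliftD balanced_bcoef. Qed.
Lemma bcoefE (c : K) w : bcoef (c *: bj iota w) = m w *: (c : rscal iota K^o).
Proof. exact: (etrans (congr1 bcoef (esym (bjE iota c w))) (tliftE _ _ balanced_bcoef)). Qed.
Lemma bcoef_bproj l : scalar l -> forall z, l (bcoef z) = m (bproj l z).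
Proof.
move=> ll; have lS : semilin idfun (l : rscal iota K^o -> F^o) := ll.
apply: bc_ext0.
- exact: addmap_comp (semilinD (iota := idfun) lS) bcoefD.
- exact: addmap_comp (semilinD (iota := idfun) mS) (bprojD ll).
move=> e w; rewrite bcoefE (bprojE ll).
by rewrite (semilinZ (iota := idfun) lS) (semilinZ (iota := idfun) mS) [LHS]mulrC.
Qed.
End Coef.

Lemma bproj_separated (x y : jbc) :
  (forall l : rscal iota K^o -> F, scalar l -> bproj l x = bproj l y) -> x = y.
Proof.
move=> h; apply: tens_separated => m ml.
change (bcoef m x = bcoef m y).
apply/eqP; rewrite -subr_eq0; apply: contrapT => /negP /functional_neq0[l ll].
have lS : semilin idfun (l : rscal iota K^o -> F^o) := ll.
rewrite (semilinD (iota := idfun) lS) -scaleN1r (semilinZ (iota := idfun) lS) scaleN1r.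
by rewrite !(bcoef_bproj ml ll) h // subrr => /eqP; rewrite eq_sym oner_eq0.
Qed.
End Action.
Arguments jbc W : clear implicits.
Arguments gact {W} s.
Arguments bproj {W} l.
Arguments bcoef {W} m.

Hypothesis sepK : separable_closure iota.

(** With independent vectors [w k] the coefficients of [x] are unique, so each of them is fixed by
    every automorphism and lies in [F]. *)
Lemma galois_invariant (W : jmod J F) (x : jbc W) :
  (forall s : galaut iota, gact s x = x) -> exists w, x = bj iota w.
Proof.
move=> xinv; have [n [c [w [l [xE ll lw]]]]] := dual_representation x.
have coef m : (m < n)%N -> forall d : nat -> K,
    bcoef (l m) (\sum_(k < n) (d k *: bj iota (w k) : jbc W)) = d m.
  move=> mn d; rewrite (addmap_sum _ _ _ (bcoefD (ll m))) (bigD1 (Ordinal mn)) //= big1 ?addr0.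
    by rewrite (bcoefE (ll m)) lw // eqxx scale1r.
  by move=> i; rewrite -val_eqE /= => im; rewrite (bcoefE (ll m)) lw // eq_sym (negPf im) scale0r.
have {}xE : x = \sum_(k < n) ((c k : K) *: bj iota (w k) : jbc W).
  by rewrite xE; apply: eq_bigr => k _; rewrite -bjE.
have cF (k : 'I_n) : exists d, (c k : K) = iota d.
  apply: (fixed_field sepK) => s; have := xinv s; rewrite xE.
  rewrite (addmap_sum _ _ _ (shomD (shom_gact W s))).
  under eq_bigr do rewrite gactE.
  by move/(congr1 (bcoef (l k))); rewrite (coef k (ltn_ord k) (fun i => s (c i))) coef.
have [d dE] := choice cF; exists (\sum_(k < n) d k *: w k).
rewrite xE (addmap_sum _ _ _ (semilinD (semilin_bj _ _))); apply: eq_bigr => k _.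
by rewrite (semilinZ (semilin_bj _ _)) dE.
Qed.

(* A vector of U with the fewest terms c_k (x) w_k, scaled so that c_0 = 1, is
   invariant: s x - x lies in U and has fewer terms. *)
Lemma galois_descent (W : jmod J F) (U : set (jbc W)) :
  subspace U -> (forall (s : galaut iota) x, U x -> U (gact s x)) ->
  (exists2 x, U x & x != 0) -> exists2 w, w != 0 & U (bj iota w).
Proof.
move=> Us UG [x0 Ux0 x00].
pose rep (r : seq (K * W)) : jbc W := \sum_(p <- r) p.1 *: bj iota p.2.
pose P n := `[< exists r, [/\ size r = n, U (rep r) & rep r != 0] >].
have exP : exists n, P n.
  exists (size (repr x0)); apply/asboolP; exists (repr x0).
  have -> : rep (repr x0) = x0; last by [].
  by rewrite [RHS](tensP x0); apply: eq_bigr => p _; rewrite -bjE.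
case: (ex_minnP exP) => n /asboolP[[|[c w] r] [rn Ur r0]] nmin; first by rewrite /rep big_nil eqxx in r0.
have small r' : (size r' < n)%N -> U (rep r') -> rep r' = 0.
  move=> r'n Ur'; apply: contrapT => /eqP r'0; move: r'n; rewrite ltnNge => /negP[].
  by apply: nmin; apply/asboolP; exists r'.
have c0 : c != 0.
  apply: contraNneq r0 => c0; rewrite /rep big_cons c0 scale0r add0r; apply/eqP/small; first by rewrite -rn.
  by move: Ur; rewrite /rep big_cons c0 scale0r add0r.
pose x := c^-1 *: rep ((c, w) :: r).
have Ux : U x by exact: subspaceZ.
have [|w1 xE] := @galois_invariant W x.
  move=> s; have gD := shomD (shom_gact W s).
  have xE : x = bj iota w + rep [seq (c^-1 * p.1, p.2) | p <- r].
    rewrite /x /rep big_cons scalerDr scalerA mulVf // scale1r; congr (_ + _).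
    by rewrite scaler_sumr big_map; apply: eq_bigr => p _; rewrite scalerA.
  apply/eqP; rewrite -subr_eq0.
  have sE : gact s x - x = rep [seq (s (c^-1 * p.1) - c^-1 * p.1, p.2) | p <- r].
    rewrite {1 2}xE gD opprD addrACA -[bj iota w in X in X - _ + _]scale1r gactE rmorph1 scale1r subrr add0r.
    rewrite /rep !big_map (addmap_sum _ _ _ gD) -sumrB; apply: eq_bigr => p _ /=.
    by rewrite gactE scalerBl.
  rewrite sE; apply/eqP/small; first by rewrite size_map -rn.
  by rewrite -sE; apply: subspaceB => //; exact: UG.
exists w1; last by rewrite -xE.
apply: contraNneq r0 => w10; have : x = 0 by rewrite xE w10 (semilin0 (semilin_bj _ _)).
by rewrite /x => /eqP; rewrite scaler_eq0 invr_eq0 (negPf c0).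
Qed.

Lemma bc_ind (W : jmod J F) (U : set (jbc W)) :
  U 0 -> (forall x y, U x -> U y -> U (x + y)) -> (forall c w, U (c *: bj iota w)) -> forall x, U x.
Proof.
move=> U0 UD UZ x; rewrite (tensP x); apply: (big_ind U) => // p _.
by rewrite bjE; exact: UZ.
Qed.

(** * Modules generated by the Galois conjugates of an irreducible module *)

Section Conjugates.
Variable V : jmod J K.

(** A map semilinear along [s] is a homomorphism from a Galois twist of [V]. The additive span of
    this set is therefore the part of [X] generated by the conjugates of [V], with no twisted module
    formed. *)
Definition conj_image (X : jmod J K) : set X :=
  [set x | exists (s : galaut iota) f v, shom s false V X f /\ x = f v].

Lemma shom_zero (E E' : fieldType) (s : {rmorphism E -> E'}) b (V1 : jmod J E) (V2 : jmod J E') :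
  shom s b V1 V2 (fun=> 0).
Proof. by split=> [c u v|j v]; rewrite ?scaler0 ?addr0 ?jact0. Qed.

Lemma sums_stable (X : jmod J K) (P : set X) :
  (forall c x, P x -> P (c *: x)) -> (forall j x, P x -> P (jact j x)) -> stable (sums P).
Proof.
move=> PZ Pa; split; first split.
- exact: sums0.
- move=> c x y Px Py; apply: sumsD => //; move: x Px.
  apply: (sums_ind (U := [set x : X | sums P (c *: x)])) => /= [|x z Ux Uz|x Px].
  + by rewrite scaler0; exact: sums0.
  + by rewrite scalerDr; exact: sumsD.
  + by apply: sums1; exact: PZ.
move=> j; apply: (sums_ind (U := [set x : X | sums P (jact j x)])) => /= [|x z Ux Uz|x Px].
- by rewrite jact0; exact: sums0.
- by rewrite jactD; exact: sumsD.
- by apply: sums1; exact: Pa.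
Qed.

Lemma conj_image_stable (X : jmod J K) : stable (sums (@conj_image X)).
Proof.
apply: sums_stable => [c|j] _ [s [f [v [fh ->]]]]; last first.
  by exists s, f, (jact j v); rewrite fh.2 tw0.
have [s' [sK s'K]] := galaut_inv s.
by exists s, f, (s' c *: v); rewrite (shomZ fh) s'K.
Qed.

Lemma conj_generates (W : jmod J F) : jirr W ->
  (exists (s : galaut iota) f, shom s false V (jbc W) f /\ exists v, f v != 0) ->
  forall x : jbc W, sums (@conj_image (jbc W)) x.
Proof.
move=> Wi [s0 [f0 [f0h [v0 fv0]]]].
have Us := conj_image_stable (jbc W).
have Uf0 : sums (@conj_image (jbc W)) (f0 v0) by apply: sums1; exists s0, f0, v0.
have [|w0 w00 Uw0] := galois_descent Us.1 _ (ex_intro2 _ _ (f0 v0) Uf0 fv0).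
  move=> s; have gh := shom_gact W s.
  apply: (sums_ind (U := [set x | sums (@conj_image (jbc W)) (gact s x)])) => /= [|x y Ux Uy|_ [t [f [v [fh ->]]]]].
  + by rewrite (shom0 gh); exact: sums0.
  + by rewrite (shomD gh); exact: sumsD.
  have [u uE] := galaut_comp s t.
  by apply: sums1; exists u, (fun v => gact s (f v)), v; split=> //; exact: shom_comp fh gh uE _.
have UW w : sums (@conj_image (jbc W)) (bj iota w).
  exact: (Wi.2 _ (shom_preimage (shom_bj W) Us) (ex_intro2 _ _ w0 Uw0 w00) w).
apply: bc_ind; [exact: Us.1.1|exact: sumsD|move=> c w].
exact: (subspaceZ Us.1).
Qed.

Hypothesis Vi : jirr V.
Variable X : jmod J K.
Hypothesis X_conj : forall x : X, sums (@conj_image X) x.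

Lemma conj_projection (U : set X) : stable U ->
  exists p : X -> X, [/\ shom idfun false X X p, forall x, U (p x) & forall u, U u -> p u = u].
Proof.
move=> Us.
have [||||p [pl pa pU pu]] :=
  @stable_projection J K X [set L | exists (s : galaut iota) f, shom s false V X f /\ L = range f] U.
- move=> _ [s [f [fh ->]]]; have [s' [_ s'K]] := galaut_inv s.
  exact (shom_range fh s'K).
- move=> _ N [s [f [fh ->]]] Ns [_ [[v _ <-] Nv fv0]] _ [w _ <-].
  apply: (Vi.2 _ (shom_preimage fh Ns)); exists v => //.
  by apply: contraNneq fv0 => ->; rewrite (shom0 fh).
- move=> x; apply: (sums_ind (P := @conj_image X)) (X_conj x); [exact: sums0|exact: sumsD|].
  move=> _ [s [f [v [fh ->]]]]; apply: sums1; exists (range f); last by exists v.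
  by exists s, f.
- exact: Us.
by exists p; split=> //; split=> // j v; rewrite tw0.
Qed.

(** The range of [f] is a direct summand; projecting onto it and undoing [f] is semilinear along the
    inverse automorphism. *)
Lemma conj_retraction (V' : jmod J K) (s s' : galaut iota) b f :
  cancel s' s -> shom s b V' X f -> injective f ->
  exists2 h, shom s' b X V' h & cancel f h.
Proof.
move=> s'K fh fi.
have [p [ph pU pu]] := conj_projection (shom_range fh s'K).
have /choice[h hP] : forall x, exists v, f v = p x by move=> x; have [v _ fv] := pU x; exists v.
exists h; last by move=> v; apply: fi; rewrite hP pu //; exists v.
split=> [c x y|j x]; apply: fi; rewrite hP.
  by rewrite (shomD ph) (shomZ ph) fh.1 !hP s'K.
by rewrite fh.2 hP ph.2 tw0 twK.
Qed.

Lemma conj_nonzero (E : fieldType) (s : {rmorphism K -> E}) b (Y : jmod J E) h :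
  shom s b X Y h -> (exists x, h x != 0) ->
  exists (t : galaut iota) f, shom t false V X f /\ exists v, h (f v) != 0.
Proof.
move=> hh [x hx]; apply: contrapT => nex; move: hx; apply/negP; rewrite negbK; apply/eqP.
move: (X_conj x); move: x; apply: (sums_ind (U := [set x | h x = 0])) => /=.
- exact: shom0 hh.
- by move=> x y hx hy; rewrite (shomD hh) hx hy addr0.
move=> _ [t [f [v [fh ->]]]]; apply: contrapT => /eqP hfv; apply: nex.
by exists t, f; split=> //; exists v.
Qed.
End Conjugates.

Lemma injective_nz (E E' : fieldType) (s : {rmorphism E -> E'}) b (V : jmod J E) (V' : jmod J E') f :
  shom s b V V' f -> jirr V -> injective f -> exists v, f v != 0.
Proof.
move=> fh [[v v0] _] fi; exists v; apply: contraNneq v0 => fv; apply/eqP/fi.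
by rewrite fv (shom0 fh).
Qed.

(** A retraction of the base change onto [V'] cannot vanish on all conjugates of [V], as these
    generate; Schur's lemma turns a nonzero composite into an isomorphism. *)
Lemma conjugate_of_embeddings (W : jmod J F) (V V' : jmod J K) f f' :
  jirr W -> jirr V -> jirr V' ->
  shom idfun false V (jbc W) f -> (exists v, f v != 0) ->
  shom idfun false V' (jbc W) f' -> (exists v, f' v != 0) ->
  exists (s : galaut iota) g, shom s false V V' g /\ bijective g.
Proof.
move=> Wi Vi V'i fh fn f'h f'n.
have WV := conj_generates Wi (ex_intro _ galaut_id (ex_intro _ f (conj fh fn))).
have f'i := schur_injective f'h V'i f'n.
have [h hh f'K] := conj_retraction (s := galaut_id) (s' := galaut_id) Vi WV (fun=> erefl) f'h f'i.
have [t [f1 [f1h hf1]]] := conj_nonzero WV hh (let: ex_intro v v0 := V'i.1 in ex_intro _ (f' v) (eq_ind_r (fun x => x != 0) v0 (f'K v))).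
have gh : shom t false V V' (fun v => h (f1 v)) by exact: shom_comp f1h hh _ _.
have [t' [tK t'K]] := galaut_inv t.
have [g [gK Kg _]] := schur_inverse gh t'K Vi V'i hf1.
by exists t, (fun v => h (f1 v)); split=> //; exists g.
Qed.

(** Retracting the first base change to [V] and embedding [V] in the second is nonzero on some
    [bj iota w]; a functional [l] that detects this value yields a nonzero homomorphism from [W] to
    [W']. *)
Lemma iso_of_common_constituent (W W' : jmod J F) (V : jmod J K) f f' :
  jirr W -> jirr W' -> jirr V ->
  shom idfun false V (jbc W) f -> (exists v, f v != 0) ->
  shom idfun false V (jbc W') f' -> (exists v, f' v != 0) ->
  exists2 g, shom idfun false W W' g & bijective g.
Proof.
move=> Wi W'i Vi fh fn f'h [v0 f'v0].
have WV := conj_generates Wi (ex_intro _ galaut_id (ex_intro _ f (conj fh fn))).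
have fi := schur_injective fh Vi fn.
have [h hh fK] := conj_retraction (s := galaut_id) (s' := galaut_id) Vi WV (fun=> erefl) fh fi.
have gh : shom idfun false (jbc W) (jbc W') (fun x => f' (h x)) by exact: shom_comp hh f'h _ _.
have [w gw] : exists w, f' (h (bj iota w)) != 0.
  apply: contrapT => nw; move: f'v0; rewrite -[v0]fK => /negP; apply; apply/eqP.
  apply: (shom_bc_ext gh (shom_zero idfun false _ _)) => w.
  by apply: contrapT => /eqP gw; apply: nw; exists w.
have [l ll lw] : exists2 l : rscal iota K^o -> F, scalar l & bproj l (f' (h (bj iota w))) != 0.
  apply: contrapT => nl; move: gw; rewrite (_ : f' _ = 0) ?eqxx //.
  apply: bproj_separated => l ll; rewrite (addmap0 (bprojD ll)).
  by apply: contrapT => /eqP lw; apply: nl; exists l.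
pose g w := bproj l (f' (h (bj iota w))).
have g_h : shom idfun false W W' g.
  split=> [c u v|j v]; rewrite /g.
    by rewrite (semilin_bj iota W) gh.1 (bprojD ll) (bprojZ ll).
  by rewrite -jact_bj gh.2 (bproj_act ll) !tw0.
have [g' [gK Kg _]] := schur_inverse g_h (fun=> erefl) Wi W'i (ex_intro _ w lw).
by exists g => //; exists g'.
Qed.

(** The linear extension of [k] is nonzero on some conjugate of [V'], hence maps it isomorphically
    to [V]. The inverse followed by the inclusion [f1] is linear over [K], since [t] and its inverse
    cancel. *)
Lemma constituent_of_quotient (W : jmod J F) (V V' : jmod J K) k f' :
  jirr W -> jirr V -> jirr V' ->
  shom iota false W V k -> (exists w, k w != 0) ->
  shom idfun false V' (jbc W) f' -> (exists v, f' v != 0) ->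
  exists f, shom idfun false V (jbc W) f /\ exists v, f v != 0.
Proof.
move=> Wi Vi V'i kh [w kw] f'h f'n.
have WV := conj_generates Wi (ex_intro _ galaut_id (ex_intro _ f' (conj f'h f'n))).
have kkh := shom_bclift kh.
have [|t [f1 [f1h kf1]]] := conj_nonzero WV kkh; first by exists (bj iota w); rewrite (bcliftE kh.1).
have gh : shom t false V' V (fun v => bclift iota k (f1 v)) by exact: shom_comp f1h kkh _ _.
have [t' [tK t'K]] := galaut_inv t.
have [g [gK Kg g_h]] := schur_inverse gh t'K V'i Vi kf1.
exists (fun v => f1 (g v)).
have fh : shom idfun false V (jbc W) (fun v => f1 (g v)).
  by apply: shom_comp g_h f1h _ _ => // x; rewrite t'K.
split=> //; apply: injective_nz fh Vi _ => u v uv; apply: (can_inj Kg).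
apply: (schur_injective f1h V'i) uv; case: kf1 => v1 kf1; exists v1.
by apply: contraNneq kf1 => ->; rewrite (shom0 kkh).
Qed.

Lemma gactK (W : jmod J F) (s s' : galaut iota) : cancel s s' -> cancel (@gact W s) (gact s').
Proof.
move=> sK; have h := shom_comp (u := idfun) (d := false) (shom_gact W s) (shom_gact W s') (fun x => esym (sK x)) erefl.
by apply: (shom_bc_ext h (shom_id _)) => w; rewrite -[bj iota w]scale1r !gactE !rmorph1.
Qed.

(* For bb = false only even homomorphisms are considered, for bb = true also
   the odd ones: the endomorphism algebra and the endomorphism superalgebra. *)
Section Central.
Variable bb : bool.

Definition graded_center (E : fieldType) (V : jmod J E) (z : V -> V) : Prop :=
  shom idfun false V V z /\
  forall b g, (b ==> bb) -> shom idfun b V V g -> forall v, z (g v) = g (z v).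
Arguments graded_center {E} V z.

Definition scalar_map (E : fieldType) (V : lmodType E) (z : V -> V) : Prop :=
  exists c, forall v, z v = c *: v.

Lemma bproj_shom (W W' : jmod J F) b (g : jbc W -> jbc W') l :
  scalar l -> shom idfun b (jbc W) (jbc W') g ->
  shom idfun b W W' (fun w => bproj l (g (bj iota w))).
Proof.
move=> ll gh; split=> [c u v|j v].
  by rewrite (semilin_bj iota W) gh.1 (bprojD ll) (bprojZ ll).
by rewrite -jact_bj gh.2 (bproj_act ll).
Qed.

Lemma shom_bc (W W' : jmod J F) b g : shom idfun b W W' g ->
  shom idfun b (jbc W) (jbc W') (bclift iota (fun w => bj iota (g w) : jbc W')).
Proof. by move=> gh; apply: shom_bclift; apply: shom_comp gh (shom_bj W') _ _. Qed.

Lemma bcE (W W' : jmod J F) b g : shom idfun b W W' g ->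
  forall w, bclift iota (fun w => bj iota (g w) : jbc W') (bj iota w) = bj iota (g w).
Proof.
move=> gh w; apply: (bcliftE (M := jbc W')).
have h : shom iota b W (jbc W') (fun w => bj iota (g w)) by apply: shom_comp gh (shom_bj W') _ _.
exact: h.1.
Qed.

Lemma bproj_bc (W W' : jmod J F) b g l : scalar l -> shom idfun b W W' g ->
  forall x, bproj l (bclift iota (fun w => bj iota (g w) : jbc W') x) = g (bproj l x).
Proof.
move=> ll gh; have kh := shom_bc gh; apply: (@bc_ind W (fun x => _ = _)) => /=.
- by rewrite (shom0 kh) !(addmap0 (bprojD ll)) (shom0 gh).
- by move=> x y hx hy; rewrite (shomD kh) !(bprojD ll) hx hy (shomD gh).
by move=> c w; rewrite (shomZ kh) (bcE gh) !(bprojE ll) (shomZ gh).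
Qed.

(** Commutation with [g] is tested after each [bproj l], where [g] is replaced by a homomorphism
    over [F], with which [z] commutes. *)
Lemma graded_center_bc (W : jmod J F) z : graded_center W z ->
  forall b g, (b ==> bb) -> shom idfun b (jbc W) (jbc W) g ->
  forall x, bclift iota (fun w => bj iota (z w) : jbc W) (g x) =
            g (bclift iota (fun w => bj iota (z w) : jbc W) x).
Proof.
move=> [zh zc] b g bbb gh; have zKh := shom_bc zh.
have h1 : shom idfun b (jbc W) (jbc W) (fun x => bclift iota (fun w => bj iota (z w) : jbc W) (g x)).
  by apply: shom_comp gh zKh _ _.
have h2 : shom idfun b (jbc W) (jbc W) (fun x => g (bclift iota (fun w => bj iota (z w) : jbc W) x)).
  by apply: shom_comp zKh gh _ _; rewrite ?addbF.
apply: (shom_bc_ext h1 h2) => w; apply: bproj_separated => l ll.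
by rewrite (bproj_bc ll zh) (bcE zh) (zc _ _ bbb (bproj_shom ll gh)).
Qed.

(** Each coordinate of [p] along a functional [l] lies in the graded center of [W], hence is a
    scalar of [F]; these scalars are the values at [l] of a single element of [K]. *)
Lemma scalar_of_graded_center (W : jmod J F) (p : jbc W -> jbc W) :
  (forall z, graded_center W z -> scalar_map z) -> shom idfun false (jbc W) (jbc W) p ->
  (forall b g, (b ==> bb) -> shom idfun b (jbc W) (jbc W) g -> forall x, p (g x) = g (p x)) ->
  (exists w : W, w != 0) -> scalar_map p.
Proof.
move=> zs ph pc [w0 w00]; have [m ml mw0] := functional_neq0 w00.
have mS : semilin idfun (m : W -> F^o) := ml.
have pl l : scalar l -> exists c, forall w, bproj l (p (bj iota w)) = c *: w.
  move=> ll; apply: zs; split=> [|b g bbb gh w]; first exact: bproj_shom.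
  by rewrite -(bcE gh) (pc b _ bbb (shom_bc gh)) (bproj_bc ll gh).
(* As [m w0 = 1], this is the coefficient of the image of [w0] along [w0]. *)
exists (bcoef m (p (bj iota w0)) : K).
have ch := shom_scale (jbc W) (bcoef m (p (bj iota w0)) : K).
apply: (shom_bc_ext ph ch) => w; apply: bproj_separated => l ll.
have [c cE] := pl l ll; rewrite cE (bprojE ll) (bcoef_bproj ml ll) cE.
by rewrite (semilinZ (iota := idfun) mS) mw0; congr (_ *: _); exact: (esym (mulr1 c)).
Qed.

Section Constituent.
Variables (W : jmod J F) (V : jmod J K) (f0 : V -> jbc W).
Hypotheses (Wi : jirr W) (Vi : jirr V).
Hypotheses (f0h : shom idfun false V (jbc W) f0) (f0n : exists v, f0 v != 0).
Let X := jbc W.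
Let XV : forall x : X, sums (@conj_image V X) x.
Proof. exact: conj_generates Wi (ex_intro _ galaut_id (ex_intro _ f0 (conj f0h f0n))). Qed.
Let f0i : injective f0.
Proof. exact: schur_injective f0h Vi f0n. Qed.
Let retract (V' : jmod J K) b f : shom idfun b V' X f -> injective f ->
  exists2 h, shom idfun b X V' h & cancel f h.
Proof. exact: (conj_retraction (s := galaut_id) (s' := galaut_id) Vi XV (fun=> erefl)). Qed.

(** On one copy of [V] the extension of [z] is a scalar [c], because End(V) is [K]. Commutation with
    homomorphisms spreads [c] to all copies, and the hypothesis on twists reaches all conjugates,
    which generate. *)
Lemma graded_center_scalar :
  (forall f, shom idfun false V V f -> scalar_map f) ->
  (forall s : galaut iota, exists b g, [/\ b ==> bb, shom s b V V g & exists v, g v != 0]) ->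
  forall z, graded_center W z -> scalar_map z.
Proof.
move=> Vs Vt z zc; have zKc := graded_center_bc zc; have zh := zc.1.
set zK := bclift iota _ in zKc; have zKh : shom idfun false X X zK := shom_bc zh.
have [h0 h0h f0K] := retract f0h f0i.
have [|c cE] := Vs (fun v => h0 (zK (f0 v))).
  have h1 : shom idfun false V X (fun v => zK (f0 v)) by apply: shom_comp f0h zKh _ _.
  by apply: shom_comp h1 h0h _ _.
have lin_c b f2 : b ==> bb -> shom idfun b V X f2 -> forall v, zK (f2 v) = c *: f2 v.
  move=> bbb f2h v; have gh : shom idfun b X X (fun x => f2 (h0 x)).
    by apply: shom_comp h0h f2h _ _; rewrite ?addbF.
  by have := zKc _ _ bbb gh (f0 v); rewrite f0K cE (shomZ f2h).
have zKE : forall x, zK x = c *: x.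
  move=> x; move: x (XV x); apply: (sums_ind (U := [set x : X | zK x = c *: x])) => /=.
  - by rewrite (shom0 zKh) scaler0.
  - by move=> x y hx hy; rewrite (shomD zKh) hx hy scalerDr.
  (* Precomposing [f1] with a self-map [g] of [V] along the inverse of [t] makes it linear, possibly
     odd, with the same image. *)
  move=> _ [t [f1 [v [f1h ->]]]]; have [t' [tK t'K]] := galaut_inv t.
  have [b [g [bbb gh gn]]] := Vt t'.
  have [g' [gK Kg _]] := schur_inverse gh tK Vi Vi gn.
  rewrite -(Kg v); apply: (lin_c _ (fun u => f1 (g u)) bbb).
  by apply: shom_comp gh f1h _ _ => // y; rewrite t'K.
(* A functional with [l 1 = 1] carries [bj iota (z w) = c *: bj iota w] to [z w = l c *: w]. *)
have [l ll l1] : exists2 l : rscal iota K^o -> F, scalar l & l 1 = 1.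
  by apply: functional_neq0; exact: oner_neq0.
exists (l c) => w; have := zKE (bj iota w); rewrite /zK (bcE zh).
by move/(congr1 (bproj l)); rewrite (bproj_bj ll) l1 scale1r (bprojE ll).
Qed.

Hypothesis Zs : forall z, graded_center W z -> scalar_map z.

Let lin_image : set X := [set x | exists b f v, [/\ b ==> bb, shom idfun b V X f & x = f v]].

Let lin_nonzero b' (s : galaut iota) (Y : jmod J K) h x : shom s b' X Y h -> sums lin_image x -> h x != 0 ->
  exists b f, [/\ b ==> bb, shom idfun b V X f & exists v, h (f v) != 0].
Proof.
move=> hh xU hx; apply: contrapT => nex; move: hx; apply/negP; rewrite negbK; apply/eqP.
move: x xU; apply: (sums_ind (U := [set x | h x = 0])) => /=.
- exact: shom0 hh.
- by move=> x y hx hy; rewrite (shomD hh) hx hy addr0.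
move=> _ [b [f [v [bbb fh ->]]]]; apply: contrapT => /eqP hfv; apply: nex.
by exists b, f; split=> //; exists v.
Qed.

(* The projection onto the isotypic part is in the graded center, so it is 1. *)
Lemma isotypic x : sums lin_image x.
Proof.
have Us : stable (sums lin_image).
  apply: sums_stable => [c|j] _ [b [f [v [bbb fh ->]]]].
    by exists b, f, (c *: v); rewrite (shomZ fh).
  by exists b, f, (jact (tw b j) v); rewrite fh.2 twK.
have [p [ph pU pu]] := conj_projection Vi XV Us.
have gU b g : b ==> bb -> shom idfun b X X g -> forall y, sums lin_image y -> sums lin_image (g y).
  move=> bbb gh; apply: (sums_ind (U := [set y | sums lin_image (g y)])) => /=.
  - by rewrite (shom0 gh); exact: sums0.
  - by move=> y z Uy Uz; rewrite (shomD gh); exact: sumsD.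
  move=> _ [c [f [v [cbb fh ->]]]]; apply: sums1.
  exists (b (+) c), (fun v => g (f v)), v; split=> //; first by case: b c bbb cbb {gh fh} => [] [].
  exact: shom_comp fh gh _ _.
have pc b g : b ==> bb -> shom idfun b X X g -> forall y, p (g y) = g (p y).
  move=> bbb gh y; rewrite -[RHS]pu; last by apply: gU bbb gh _ _; exact: pU.
  apply/eqP; rewrite -subr_eq0 -(shomB ph) -(shomB gh); apply: contrapT => /negP qy.
  (* This is [p g (1 - p)]. If it is nonzero, it embeds a conjugate of [V] into the isotypic part,
     so that conjugate is [V] itself up to the allowed parity and already lies in the isotypic part,
     which [1 - p] kills. *)
  pose q x := p (g (x - p x)).
  have qh : shom idfun b X X q.
    have h1 : shom idfun false X X (fun x => x - p x).
      split=> [c u v|j v]; first by rewrite ph.1 opprD addrACA scalerBr.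
      by rewrite ph.2 tw0 jactB.
    have h2 : shom idfun b X X (fun x => g (x - p x)) by apply: shom_comp h1 gh _ _; rewrite ?addbF.
    by apply: shom_comp h2 ph _ _; rewrite ?addbF.
  have [t [f1 [f1h qf1]]] := conj_nonzero XV qh (ex_intro _ y qy).
  have qf1h : shom t b V X (fun v => q (f1 v)) by apply: shom_comp f1h qh _ _; rewrite ?addbF.
  have qf1i := schur_injective qf1h Vi qf1.
  have [t' [tK t'K]] := galaut_inv t.
  have [h hh hK] := conj_retraction Vi XV t'K qf1h qf1i.
  have [v0 v00] := Vi.1.
  have hqn : h (q (f1 v0)) != 0 by rewrite hK.
  have [b' [f' [b'bb f'h hf']]] := lin_nonzero hh (pU _) hqn.
  have kh : shom t' (b (+) b') V V (fun v => h (f' v)) by apply: shom_comp f'h hh _ _.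
  have [k' [kK Kk _]] := schur_inverse kh tK Vi Vi hf'.
  case: qf1 => v; have f1U : sums lin_image (f1 v).
    rewrite -(Kk v); apply: sums1; exists (b (+) b'), (fun v => f1 (h (f' v))), (k' v); split=> //.
      by case: b b' bbb b'bb {gh qh qf1h hh kh f'h} => [] [].
    by apply: shom_comp kh f1h _ _ => // z; rewrite t'K.
  by rewrite /q (pu _ f1U) subrr (shom0 gh) (shom0 ph) eqxx.
have [c cE] := scalar_of_graded_center Zs ph pc Wi.1.
case: f0n => v0 fv0.
have f0U : sums lin_image (f0 v0) by apply: sums1; exists false, f0, v0.
have := pu _ f0U; rewrite cE => /eqP.
rewrite -subr_eq0 -[X in _ - X]scale1r -scalerBl scaler_eq0 (negPf fv0) orbF subr_eq0 => /eqP c1.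
by have := pU x; rewrite cE c1 scale1r.
Qed.

(** The conjugate copy [gact s' (f0 v)] has a retraction to [V] semilinear along [s]; as the base
    change is isotypic, this retraction is nonzero on a linear image of [V]. *)
Lemma conjugate_scalar (s : galaut iota) :
  exists b g, [/\ b ==> bb, shom s b V V g & exists v, g v != 0].
Proof.
have [s' [sK s'K]] := galaut_inv s.
have f1h : shom s' false V X (fun v => gact s' (f0 v)) by apply: shom_comp f0h (shom_gact W s') _ _.
have f1n : exists v, gact s' (f0 v) != 0.
  case: f0n => v fv; exists v; apply: contraNneq fv => gv.
  by rewrite -[f0 v](gactK s'K) gv (shom0 (shom_gact W s)).
have [h hh hK] := conj_retraction Vi XV sK f1h (schur_injective f1h Vi f1n).
have [v0 v00] := Vi.1.
have [|b [f [bbb fh hf]]] := lin_nonzero (x := gact s' (f0 v0)) hh (isotypic _); first by rewrite hK.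
by exists b, (fun v => h (f v)); split=> //; apply: shom_comp fh hh _ _.
Qed.

(** If the common kernel of the homomorphisms to [V] were nonzero, it would contain a copy of [V],
    whose retraction to [V] vanishes on the kernel. *)
Lemma lin_separated (y : X) :
  (forall b h, b ==> bb -> shom idfun b X V h -> h y = 0) -> y = 0.
Proof.
pose N : set X := [set y | forall b h, b ==> bb -> shom idfun b X V h -> h y = 0].
have Ns : stable N.
  split; first split.
  - by move=> b h _ hh; exact: shom0 hh.
  - by move=> c u v Nu Nv b h bbb hh; rewrite hh.1 (Nu b) // (Nv b) // scaler0 addr0.
  - by move=> j u Nu b h bbb hh; rewrite hh.2 (Nu b) // jact0.
move=> Ny; apply: contrapT => /eqP y0.
have [p [ph pN pu]] := conj_projection Vi XV Ns.
have [|b [f [bbb fh [v pf]]]] := lin_nonzero (s := galaut_id) ph (isotypic y); first by rewrite pu.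
have pfh : shom idfun b V X (fun v => p (f v)) by apply: shom_comp fh ph _ _.
have [h hh hK] := retract pfh (schur_injective pfh Vi (ex_intro _ v pf)).
by move: pf; rewrite -[v]hK (pN _ _ _ bbb hh) (shom0 fh) (shom0 ph) eqxx.
Qed.

(* z extends to an endomorphism Z of X with h Z = z h for all homomorphisms
   h : X -> V; Z is in the graded center. *)
Lemma graded_center_constituent z : graded_center V z -> scalar_map z.
Proof.
move=> [zh zc].
pose R (x y : X) := forall b h, b ==> bb -> shom idfun b X V h -> h y = z (h x).
have Runiq x y y' : R x y -> R x y' -> y = y'.
  move=> Ry Ry'; apply/eqP; rewrite -subr_eq0; apply/eqP/lin_separated => b h bbb hh.
  by rewrite (shomB hh) (Ry b h) // (Ry' b h) // subrr.
have Rf b f v : b ==> bb -> shom idfun b V X f -> R (f v) (f (z v)).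
  move=> bbb fh c h cbb hh.
  have hfh : shom idfun (c (+) b) V V (fun v => h (f v)) by apply: shom_comp fh hh _ _.
  by rewrite (zc _ _ _ hfh) //; case: b c bbb cbb {fh hh hfh} => [] [].
have RZ c x y x' y' : R x y -> R x' y' -> R (c *: x + x') (c *: y + y').
  by move=> Rx Rx' b h bbb hh; rewrite !hh.1 (Rx b h) // (Rx' b h) // zh.1.
have Rex x : exists y, R x y.
  move: x (isotypic x); apply: (sums_ind (U := [set x | exists y, R x y])) => /=.
  - by exists 0 => b h bbb hh; rewrite (shom0 hh) (shom0 zh).
  - by move=> x x' [y Ry] [y' Ry']; exists (1 *: y + y'); rewrite -[x in R (x + _)]scale1r; exact: RZ.
  - by move=> _ [b [f [v [bbb fh ->]]]]; exists (f (z v)); exact: Rf fh.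
have [Z ZR] := choice Rex.
have ZE x y : R x y -> Z x = y by exact: Runiq.
have Zh : shom idfun false X X Z.
  split=> [c x x'|j x]; apply: ZE; first by apply: RZ; exact: ZR.
  by move=> b h bbb hh; rewrite !hh.2 (ZR x b h) // zh.2 !tw0.
have [|c cE] := scalar_of_graded_center Zs Zh _ Wi.1.
  move=> b g bbb gh x; apply: ZE => c h cbb hh.
  have hgh : shom idfun (c (+) b) X V (fun v => h (g v)) by apply: shom_comp gh hh _ _.
  by apply: ZR hgh; case: b c bbb cbb {gh hh} => [] [].
exists c => v; apply: f0i; rewrite (shomZ f0h) -cE; apply/esym/ZE.
exact: (Rf false).
Qed.

Hypothesis two_neq0 : 2%:R != 0 :> K.

(* For an odd automorphism u and z central in the even part, y = z - u z u^-1 is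
   negated by conjugation by u and has a scalar square; its square root in K
   shows that y is a scalar, so y = - y. *)
Lemma center_constituent z : shom idfun false V V z ->
  (forall g, shom idfun false V V g -> forall v, z (g v) = g (z v)) -> scalar_map z.
Proof.
move=> zh zc.
have [[bbT [u [uh un]]]|nou] := pselect (bb /\ exists u, shom idfun true V V u /\ exists v, u v != 0); last first.
  apply: graded_center_constituent; split=> // b g bbb gh v.
  case: b bbb gh => bbb gh; last exact: zc.
  suff g0 w : g w = 0 by rewrite !g0 (shom0 zh).
  apply: contrapT => /eqP gw; apply: nou; split; first exact: bbb.
  by exists g; split=> //; exists w.
have [u' [uK u'K u'h]] := schur_inverse uh (fun=> erefl) Vi Vi un.
have odd_c (y : V -> V) : shom idfun false V V y ->
    (forall g, shom idfun false V V g -> forall v, y (g v) = g (y v)) ->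
    (forall v, y (u v) = u (y v)) -> scalar_map y.
  move=> yh yc yu; apply: graded_center_constituent; split=> // b g bbb gh v.
  case: b bbb gh => bbb gh; last exact: yc.
  have gu'h : shom idfun false V V (fun v => g (u' v)) by apply: shom_comp u'h gh _ _.
  by rewrite -(uK v) (yc _ gu'h) yu !uK.
pose th v := u (z (u' v)).
have thh : shom idfun false V V th.
  have h1 : shom idfun true V V (fun v => z (u' v)) by apply: shom_comp u'h zh _ _.
  by apply: shom_comp h1 uh _ _.
have thc g : shom idfun false V V g -> forall v, th (g v) = g (th v).
  move=> gh v; have h1 : shom idfun true V V (fun v => g (u v)) by apply: shom_comp uh gh _ _.
  have h2 : shom idfun false V V (fun v => u' (g (u v))) by apply: shom_comp h1 u'h _ _.
  by rewrite /th -{1}(u'K v) (zc _ h2) u'K.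
have uu v : z (u (u v)) = u (u (z v)).
  by apply: (zc (fun v => u (u v))); exact: (shom_comp uh uh (fun=> erefl) erefl).
pose y v := z v - th v.
have shomB2 f g : shom idfun false V V f -> shom idfun false V V g -> shom idfun false V V (fun v => f v - g v).
  move=> fh gh; have h1 : shom idfun false V V (fun v => -1 *: g v) by apply: shom_comp gh (shom_scale V (-1)) _ _.
  have := shom_add (s := idfun) fh h1; congr (shom _ _ _ _ _).
  by apply/funext => v; rewrite scaleN1r.
have yh : shom idfun false V V y by exact: shomB2.
have yc g : shom idfun false V V g -> forall v, y (g v) = g (y v).
  by move=> gh v; rewrite /y zc // thc // (shomB gh).
have yu v : y (u v) = - u (y v).
  by rewrite /y (shomB uh) /th uK -uu u'K opprB.
have [c cE] : scalar_map (fun v => y (y v)).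
  apply: odd_c => [|g gh v|v]; first by exact: (shom_comp yh yh (fun=> erefl) erefl).
    by rewrite (yc _ gh) (yc _ gh).
  by rewrite yu -[in LHS]scaleN1r (shomZ yh) yu scaleN1r opprK.
have [r rc] : exists r, r ^+ 2 = c.
  have [->|c0] := eqVneq c 0; first by exists 0; rewrite expr0n.
  have [||r] := sepK.2 ('X^2 - c%:P).
  (* The identity [- c^-1 (X^2 - c) + (2 c)^-1 X (2 X) = 1] needs 2 to be invertible. *)
  - rewrite unlock; apply/Bezout_coprimepP; exists ((- c^-1)%:P, (2%:R * c)^-1%:P * 'X) => /=.
    rewrite derivB derivXn derivC subr0 expr1 -mulrA mulrnAr -expr2 -scaler_nat mulrBr -polyCM mulNr mulVf //.
    rewrite !mul_polyC scalerA invfM mulrAC mulVf // mul1r scaleNr polyCN opprK.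
    by rewrite addrAC addNr add0r eqpxx.
  - by rewrite size_XnsubC.
  by rewrite /root !hornerE subr_eq0 => /eqP rc; exists r.
have [t tE] : scalar_map y.
  have rh := shom_scale V (- r).
  have m1h := shom_add (s := idfun) yh (shom_scale V (- r)).
  have m2h := shom_add (s := idfun) yh (shom_scale V r).
  (* Since [(y - r) (y + r) = 0], either [y = r], or [y - r] is injective and [y = - r]. *)
  have m12 v : y (y v + r *: v) + (- r) *: (y v + r *: v) = 0.
    rewrite (shomD yh) (shomZ yh) [y (y v)]cE scaleNr [r *: (y v + _)]scalerDr scalerA -expr2 rc.
    by rewrite [c *: v + _]addrC subrr.
  have [m10|/existsNP[v /eqP m1v]] := pselect (forall v, y v + (- r) *: v = 0).
    by exists r => v; apply/eqP; rewrite -subr_eq0 -scaleNr m10.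
  exists (- r) => w; apply/eqP; rewrite -subr_eq0 scaleNr opprK; apply/eqP.
  by apply: (schur_injective m1h Vi (ex_intro _ v m1v)); rewrite m12 (shom0 m1h).
have t0 : t = 0.
  case: un => v uv; have := yu v; rewrite !tE (shomZ uh) => /eqP.
  rewrite -subr_eq0 opprK -scalerDl scaler_eq0 (negPf uv) orbF -mulr2n -mulr_natl mulf_eq0 (negPf two_neq0).
  by move=> /eqP.
apply: odd_c => // v; apply/eqP; rewrite -subr_eq0; apply/eqP.
by have := tE (u v); rewrite t0 scale0r /y /th uK.
Qed.

(** Schur's lemma makes the even endomorphisms a division algebra, finite dimension makes it
    algebraic over [K], and [center_constituent] identifies its center. *)
Lemma endomorphism_scalar : fin_dim V -> forall f, shom idfun false V V f -> scalar_map f.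
Proof.
move=> Vfd; have [v0 v00] := Vi.1.
apply: (@division_sep_closed K V [set f | shom idfun false V V f] sepK.2 _ _ _ _ _ _ _ v0 v00) => /=.
- by move=> f [].
- by move=> c f fh; apply: shom_comp fh (shom_scale V c) _ _.
- by move=> f g; exact: (shom_add (s := idfun)).
- exact: shom_id.
- by move=> f g fh gh; apply: shom_comp gh fh _ _.
- move=> f fh fn; have [g [fK gK gh]] := schur_inverse fh (fun=> erefl) Vi Vi fn.
  by exists g.
- move=> f fh; have [P P0 Pf] := fin_dim_annihilator f v0 Vfd; exists P => // v.
  have Ph : shom idfun false V V (peval P f).
    split=> [|j w]; first exact: peval_linear fh.1 P.
    rewrite tw0 /peval (addmap_sum _ _ _ (jactD j)); apply: eq_bigr => i _.
    rewrite jactZ; congr (_ *: _); elim: (nat_of_ord i) => //= k ->.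
    by rewrite fh.2 tw0.
  apply: contrapT => /eqP Pv; move: v00.
  rewrite (schur_injective Ph Vi (ex_intro _ v Pv) (_ : peval P f v0 = peval P f 0)) ?eqxx //.
  by rewrite Pf (shom0 Ph).
by move=> z zh zc; apply: center_constituent => // g gh v; have := congr1 (fun k => k v) (zc g gh) => /=.
Qed.
End Constituent.
End Central.

(** * The field F' acting on the base change *)

Section EvenCenter.
Variables (F' : fieldType) (iF : {rmorphism F -> F'}) (sepF : separable_over iF).
Variables (W : jmod J F) (theta : F' -> W -> W).
Hypotheses (Wi : jirr W) (Wfd : fin_dim W).
Hypothesis thh : forall c, shom idfun false W W (theta c).
Hypothesis thD : forall c d w, theta (c + d) w = theta c w + theta d w.
Hypothesis thM : forall c d w, theta (c * d) w = theta c (theta d w).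
Hypothesis thF : forall c w, theta (iF c) w = c *: w.

Lemma theta0 w : theta 0 w = 0.
Proof. by rewrite -(rmorph0 iF) thF scale0r. Qed.
Lemma theta1 w : theta 1 w = w.
Proof. by rewrite -(rmorph1 iF) thF scale1r. Qed.
Lemma theta_inj c d w : w != 0 -> theta c w = theta d w -> c = d.
Proof.
move=> w0 cd; apply/eqP; rewrite -subr_eq0; apply: contrapT => /negP cd0.
have : theta (c - d) w = 0.
  by apply: (addIr (theta d w)); rewrite -thD subrK add0r.
move/(congr1 (theta (c - d)^-1)); rewrite -thM mulVf // theta1 (shom0 (thh _)) => w00.
by rewrite w00 eqxx in w0.
Qed.
Lemma theta_sum (I : Type) (r : seq I) (c : I -> F') w :
  theta (\sum_(i <- r) c i) w = \sum_(i <- r) theta (c i) w.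
Proof. exact: (big_morph (theta^~ w) (fun c d => thD c d w) (theta0 w)). Qed.

(** Evaluation at a nonzero [w0] embeds F' in the finite-dimensional [W]; the [c i] span F' over
    [F]. *)
Lemma even_center_finite : exists n (c : 'I_n -> F'), forall d, exists a : 'I_n -> F, d = \sum_i iF (a i) * c i.
Proof.
have [w0 w00] := Wi.1; have [n nW] := Wfd.
have [|//|r [_ [s sP] _]] := @spanned_sub _ _ n setT [set w | exists d, w = theta d w0] nW.
  split; first by exists 0; rewrite theta0.
  by move=> c _ _ [a ->] [b ->]; exists (iF c * a + b); rewrite thD thM thF.
have /choice[c cP] i : exists d, s i = theta d w0.
  apply: (sP (s i)).2; exists (\row_j (j == i)%:R); rewrite (bigD1 i) //= big1 ?addr0.
    by rewrite mxE eqxx scale1r.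
  by move=> j ji; rewrite mxE (negPf ji) scale0r.
exists r, c => d; have [|a aE] := (sP (theta d w0)).1; first by exists d.
exists (a 0); apply: (theta_inj w00); rewrite aE theta_sum; apply: eq_bigr => i _.
by rewrite thM thF cP.
Qed.

Let X := jbc W.
Definition thetaK c : X -> X := bclift iota (fun w => bj iota (theta c w) : jbc W).

Lemma thetaK_shom c : shom idfun false X X (thetaK c).
Proof. exact: shom_bc. Qed.
Lemma thetaK_bj c w : thetaK c (bj iota w) = bj iota (theta c w).
Proof. exact: bcE. Qed.
Lemma thetaKD c d x : thetaK (c + d) x = thetaK c x + thetaK d x.
Proof.
have h := shom_add (s := idfun) (thetaK_shom c) (thetaK_shom d).
apply: (shom_bc_ext (thetaK_shom _) h) => w.
by rewrite !thetaK_bj thD (semilinD (semilin_bj _ _)).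
Qed.
Lemma thetaKM c d x : thetaK (c * d) x = thetaK c (thetaK d x).
Proof.
have h : shom idfun false X X (fun x => thetaK c (thetaK d x)).
  by apply: shom_comp (thetaK_shom d) (thetaK_shom c) _ _.
by apply: (shom_bc_ext (thetaK_shom _) h) => w; rewrite !thetaK_bj thM.
Qed.
Lemma thetaKF a x : thetaK (iF a) x = iota a *: x.
Proof.
apply: (shom_bc_ext (thetaK_shom _) (shom_scale X (iota a))) => w.
by rewrite thetaK_bj thF (semilinZ (semilin_bj _ _)).
Qed.
Lemma thetaKC c d x : thetaK c (thetaK d x) = thetaK d (thetaK c x).
Proof. by rewrite -!thetaKM mulrC. Qed.
Lemma thetaK1 x : thetaK 1 x = x.
Proof. by rewrite -(rmorph1 iF) thetaKF rmorph1 scale1r. Qed.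

Lemma peval_thetaK (p : {poly F}) c x :
  peval (map_poly iota p) (thetaK c) x = thetaK (map_poly iF p).[c] x.
Proof.
rewrite /peval (size_map_poly iota) horner_coef (size_map_poly iF).
have thK0 y : thetaK 0 y = 0 by rewrite -(rmorph0 iF) thetaKF rmorph0 scale0r.
rewrite [RHS](big_morph (thetaK^~ x) (fun c d => thetaKD c d x) (thK0 x)).
apply: eq_bigr => i _; rewrite !coef_map thetaKM thetaKF; congr (_ *: _).
elim: (nat_of_ord i) => [|k IH]; first by rewrite expr0 thetaK1.
by rewrite iterS IH exprS thetaKM.
Qed.

Lemma thetaK_annihilator c : exists P : {poly K}, separable_poly P /\ forall x, peval P (thetaK c) x = 0.
Proof.
have [p ps pc] := sepF c; exists (map_poly iota p); split; first by rewrite separable_map.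
by move=> x; rewrite peval_thetaK (rootP pc) -(rmorph0 iF) thetaKF rmorph0 scale0r.
Qed.

Section Eigen.
Variable V : jmod J K.

(** If [P = R (X - l)], either [f] is already an eigenvector for [l], or [thetaK c - l] applied to
    [f] is nonzero and killed by [R]. The predicate [Q] preserves the eigenvector property for the
    elements treated before. *)
Lemma eigen_step (P : {poly K}) c (f : V -> X) (Q : (V -> X) -> Prop) :
  separable_poly P -> (forall v, peval P (thetaK c) (f v) = 0) ->
  Q f -> (exists v, f v != 0) ->
  (forall g l, Q g -> Q (fun v => thetaK c (g v) - l *: g v)) ->
  exists g, [/\ Q g, exists v, g v != 0 & exists l, forall v, thetaK c (g v) = l *: g v].
Proof.
elim: {P}(size P) {-2}P (leqnn (size P)) f => [|n IH] P Pn f Ps Pf Qf [v fv] Qstep.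
  by move: (separable_poly_neq0 Ps); rewrite -size_poly_eq0 -leqn0 Pn.
have P1 : (1 < size P)%N.
  rewrite ltnNge; apply/negP => /size1_polyC PE; have := separable_poly_neq0 Ps.
  move: (Pf v); rewrite PE pevalC => /eqP; rewrite scaler_eq0 (negPf fv) orbF polyC_eq0 => /eqP ->.
  by rewrite eqxx.
have [l /factor_theorem[R PE]] := sepK.2 P Ps P1.
pose g v := thetaK c (f v) - l *: f v.
have [g0|/existsNP[w /eqP gw]] := pselect (forall v, g v = 0).
  exists f; split=> //; first by exists v.
  by exists l => w; apply/eqP; rewrite -subr_eq0; apply/eqP; exact: g0.
have Rs : separable_poly R by apply: dvdp_separable Ps; rewrite PE dvdp_mulIl.
apply: (IH R _ g) => //; [|move=> u|exact: Qstep|by exists w].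
  by move: Pn; rewrite PE size_Mmonic ?monicXsubC ?separable_poly_neq0 // size_XsubC addn2.
by have := Pf u; rewrite PE (pevalM (thetaK_shom c).1) peval_XsubC.
Qed.

(** An eigenvector for a finite spanning family of F' is one for all of F', and the eigenvalue
    depends on the element of F' through a field morphism over [F]: this is where [e] comes from. *)
Lemma common_eigenvector (f0 : V -> X) :
  shom idfun false V X f0 -> (exists v, f0 v != 0) ->
  exists (e : {rmorphism F' -> K}) f,
  [/\ forall c, e (iF c) = iota c, shom idfun false V X f, exists v, f v != 0 &
      forall c v, thetaK c (f v) = e c *: f v].
Proof.
move=> f0h f0n; have [n [gen genP]] := even_center_finite.
have step (s : seq F') : exists f, [/\ shom idfun false V X f, exists v, f v != 0 &
    forall c, c \in s -> exists l, forall v, thetaK c (f v) = l *: f v].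
  elim: s => [|c s [f [fh fn fs]]]; first by exists f0.
  pose Q (f : V -> X) := shom idfun false V X f /\
    forall c, c \in s -> exists l, forall v, thetaK c (f v) = l *: f v.
  have [P [Ps Pc]] := thetaK_annihilator c.
  have [|g [[gh gs] gn gc]] := @eigen_step P c f Q Ps (fun v => Pc _) (conj fh fs) fn.
    move=> g l [gh gs]; split.
      have h1 : shom idfun false V X (fun v => thetaK c (g v)) by apply: shom_comp gh (thetaK_shom c) _ _.
      have h2 : shom idfun false V X (fun v => (- l) *: g v) by apply: shom_comp gh (shom_scale X (- l)) _ _.
      have := shom_add (s := idfun) h1 h2; congr (shom _ _ _ _ _).
      by apply/funext => v; rewrite scaleNr.
    move=> d /gs[m gd]; exists m => v.
    by rewrite (shomB (thetaK_shom d)) thetaKC gd !(shomZ (thetaK_shom _)) gd scalerBr !scalerA mulrC.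
  exists g; split=> // d; rewrite inE => /orP[/eqP->|]; [exact: gc|exact: gs].
have [f [fh [v0 fv0] fs]] := step [seq gen i | i <- enum 'I_n].
have /choice[e eP] : forall c, exists l, forall v, thetaK c (f v) = l *: f v.
  move=> c; have [a ->] := genP c.
  have /choice[l lP] i : exists l, forall v, thetaK (gen i) (f v) = l *: f v.
    by apply: fs; apply: map_f; rewrite mem_enum.
  exists (\sum_i iota (a i) * l i) => v.
  have thK0 y : thetaK 0 y = 0 by rewrite -(rmorph0 iF) thetaKF rmorph0 scale0r.
  rewrite (big_morph (thetaK^~ (f v)) (fun c d => thetaKD c d (f v)) (thK0 (f v))) scaler_suml.
  by apply: eq_bigr => i _; rewrite thetaKM thetaKF lP scalerA.
have euniq c l : thetaK c (f v0) = l *: f v0 -> e c = l.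
  by rewrite eP => /eqP; rewrite -subr_eq0 -scalerBl scaler_eq0 (negPf fv0) orbF subr_eq0 => /eqP.
have [|||e' e'E] := @rmorphism_of F' K e.
- by move=> c d; apply: euniq; rewrite thetaKD !eP scalerDl.
- by move=> c d; apply: euniq; rewrite thetaKM eP (shomZ (thetaK_shom _)) eP scalerA mulrC.
- by apply: euniq; rewrite thetaK1 scale1r.
exists e', f; split=> //; last by move=> c v; rewrite e'E.
- by move=> c; rewrite e'E; apply: euniq; rewrite thetaKF.
- by exists v0.
Qed.
End Eigen.

Variable e : {rmorphism F' -> K}.
Hypothesis he : forall c, e (iF c) = iota c.

(* Q is the product over generators c of q(thetaK c), where (X - e c) q is a
   separable polynomial that kills c. *)
Lemma eigenspace_projection : exists (Q : X -> X) (k : K),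
  [/\ linear Q, k != 0, forall c x, Q (thetaK c x) = e c *: Q x &
      forall y, (forall c, thetaK c y = e c *: y) -> Q y = k *: y].
Proof.
have [n [gen genP]] := even_center_finite.
have [Q [k [Ql k0 QC Qs Qk]]] : exists (Q : X -> X) (k : K),
  [/\ linear Q, k != 0, forall c x, thetaK c (Q x) = Q (thetaK c x),
      forall c, c \in [seq gen i | i <- enum 'I_n] -> forall x, thetaK c (Q x) = e c *: Q x &
      forall y, (forall c, thetaK c y = e c *: y) -> Q y = k *: y].
  elim: [seq gen i | i <- enum 'I_n] => [|c s [Q [k [Ql k0 QC Qs Qk]]]].
    by exists id, 1; split=> //; [exact: oner_neq0|move=> y _; rewrite scale1r].
  have [p ps pc] := sepF c.
  have Ps : separable_poly (map_poly iota p) by rewrite separable_map.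
  have Pe : root (map_poly iota p) (e c).
    have -> : map_poly iota p = map_poly e (map_poly iF p).
      by rewrite -map_poly_comp; apply: eq_map_poly => a; rewrite /= he.
    by rewrite /root horner_map (rootP pc) rmorph0.
  have [R PE] := factor_theorem _ _ Pe.
  have [Rs Re] : separable_poly R /\ ~~ root R (e c) by apply/andP; rewrite -separable_root -PE.
  have cl := (thetaK_shom c).1.
  have RC d x : thetaK d (peval R (thetaK c) x) = peval R (thetaK c) (thetaK d x).
    rewrite /peval (addmap_sum _ _ _ (shomD (thetaK_shom d))); apply: eq_bigr => i _.
    rewrite (shomZ (thetaK_shom d)); congr (_ *: _).
    by elim: (nat_of_ord i) => //= m <-; rewrite thetaKC.
  exists (fun x => peval R (thetaK c) (Q x)), (R.[e c] * k); split.
  - by move=> a x y; rewrite Ql; exact: (peval_linear cl).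
  - by rewrite mulf_neq0.
  - by move=> d x; rewrite RC QC.
  - move=> d; rewrite inE => /orP[/eqP->|ds] x; last first.
      by rewrite RC (Qs d ds); exact: (semilinZ (iota := idfun) (peval_linear cl R)).
    apply/eqP; rewrite -subr_eq0; apply/eqP.
    have := peval_thetaK p c (Q x); rewrite (rootP pc) -(rmorph0 iF) thetaKF rmorph0 scale0r.
    by rewrite PE mulrC (pevalM cl) peval_XsubC.
  move=> y yE; rewrite (Qk y yE) (semilinZ (iota := idfun) (peval_linear cl R)) mulrC -scalerA; congr (_ *: _).
  rewrite /peval horner_coef scaler_suml; apply: eq_bigr => i _; rewrite -scalerA; congr (_ *: _).
  elim: (nat_of_ord i) => [|m IHm]; first by rewrite expr0 scale1r.
  by rewrite iterS IHm (shomZ (thetaK_shom c)) yE scalerA exprSr.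
exists Q, k; split=> // c x; rewrite -QC; have [a ->] := genP c.
have thK0 y : thetaK 0 y = 0 by rewrite -(rmorph0 iF) thetaKF rmorph0 scale0r.
rewrite (big_morph (thetaK^~ (Q x)) (fun c d => thetaKD c d (Q x)) (thK0 (Q x))).
rewrite rmorph_sum scaler_suml; apply: eq_bigr => i _; rewrite thetaKM thetaKF Qs; last first.
  by apply: map_f; rewrite mem_enum.
by rewrite scalerA rmorphM he.
Qed.

(* Q factors through the quotient map K (x)_F W -> K (x)_F' W. *)
Lemma eigenspace_quotient (W' : lmodType F') (r : W -> W') (r' : W' -> W) (y : X) :
  semilin iF r -> cancel r r' -> cancel r' r -> (forall c w, r (theta c w) = c *: r w) ->
  (forall c, thetaK c y = e c *: y) ->
  bclift iota (fun w => bj e (r w)) y = 0 -> y = 0.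
Proof.
move=> rS rK r'K rth yE piy.
have [Q [k [Ql k0 Qth Qk]]] := eigenspace_projection.
have QS : semilin idfun Q := Ql.
have r'D a b : r' (a + b) = r' a + r' b by apply: (can_inj rK); rewrite (semilinD rS) !r'K.
have r'Z c a : r' (c *: a) = theta c (r' a) by apply: (can_inj rK); rewrite rth !r'K.
(* Since [Q] turns [thetaK c] into the scalar [e c], the map is semilinear along [e], which lets [Q]
   factor over F'. *)
have qS : semilin e (fun w' : W' => Q (bj iota (r' w'))).
  move=> c u v; rewrite r'D r'Z (semilinD (semilin_bj iota W)) (semilinD (iota := idfun) QS).
  by rewrite -thetaK_bj Qth.
have piS : semilin iota (fun w => bj e (r w)) by exact: semilin_comp (fun c => esym (he c)) rS (semilin_bj e W').
have QE x : bclift e (fun w' : W' => Q (bj iota (r' w'))) (bclift iota (fun w => bj e (r w)) x) = Q x.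
  move: x; apply: (@bc_ind W (fun x => _ = _)) => /=.
  - by rewrite (semilin0 (semilin_bclift piS)) (semilin0 (semilin_bclift qS)) (semilin0 QS).
  - move=> a b ha hb; rewrite (semilinD (semilin_bclift piS)) (semilinD (semilin_bclift qS)) ha hb.
    by rewrite (semilinD (iota := idfun) QS).
  move=> c w; rewrite (semilinZ (semilin_bclift piS)) (bcliftE piS) (semilinZ (semilin_bclift qS)) (bcliftE qS) rK.
  by rewrite (semilinZ (iota := idfun) QS).
have := QE y; rewrite piy (semilin0 (semilin_bclift qS)) (Qk y yE) => /eqP.
by rewrite eq_sym scaler_eq0 (negPf k0) => /eqP.
Qed.
End EvenCenter.
End BaseChange.
End Twisted.
Arguments shom {J} tw {E E'} s b V V' f.
Arguments jbc {J F K} iota W.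

(** * Representations as modules over operators *)

Section Operators.
Variables (F : fieldType) (A : hopf_superalg F).

Record functional := Functional { fn_fun :> A -> F; fn_scalar : scalar fn_fun }.

(* Supercomodules over A are vector spaces with operators indexed by oper: a
   functional l acts by (id (x) l) o coact, and i : bool by projection onto the
   part of parity i. *)
Definition oper : Type := (functional + bool)%type.

Definition twist (b : bool) (j : oper) : oper :=
  match j with inl l => inl l | inr i => inr (i (+) b) end.

Lemma twist0 j : twist false j = j.
Proof. by case: j => //= i; rewrite addbF. Qed.
Lemma twistA b c j : twist b (twist c j) = twist (b (+) c) j.
Proof. by case: j => //= i; rewrite -addbA [c (+) b]addbC. Qed.

Lemma fnS (l : functional) : semilin idfun (l : A -> F^o).
Proof. exact: fn_scalar. Qed.
Lemma fnD (l : functional) a b : l (a + b) = l a + l b.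
Proof. exact: (semilinD (iota := idfun) (fnS l)). Qed.
Lemma fnZ (l : functional) c a : l (c *: a) = c * l a.
Proof. exact: (semilinZ (iota := idfun) (fnS l)). Qed.

Section Contract.
Variable V : lmodType F.
Definition contract (l : A -> F) (t : tens V A) : V := tlift (fun w a => l a *: w) t.
Variable l : functional.
Lemma balanced_contract : balanced (fun (w : V) (a : A) => l a *: w).
Proof.
split=> [a v w|v a b|c v a] /=; first by rewrite scalerDr.
- by rewrite fnD scalerDl.
- by rewrite fnZ scalerA mulrC.
Qed.
Lemma contractD : addmap (contract l). Proof. exact: tliftD balanced_contract. Qed.
Lemma contractE v a : contract l (v \ot a) = l a *: v.
Proof. exact: tliftE _ _ balanced_contract. Qed.
Lemma contractZ c t : contract l (c *: t) = c *: contract l t.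
Proof.
move: t; apply: tens_ext => [x y|x y|v a].
- by rewrite scalerDr contractD.
- by rewrite contractD scalerDr.
- by rewrite -tmkZl !contractE !scalerA mulrC.
Qed.
End Contract.

Lemma contract_separated (V : lmodType F) (t u : tens V A) :
  (forall l : functional, contract l t = contract l u) -> t = u.
Proof. by move=> h; apply: tens_separated => l ll; exact: (h (Functional ll)). Qed.

Lemma contract_tmap (V V' : lmodType F) (f : V -> V') (l : functional) t :
  semilin idfun f -> contract l (tmap f id t) = f (contract l t).
Proof.
move=> fS; have idA := @semilin_id F A.
move: t; apply: tens_ext => [||v a].
- exact: addmap_comp (contractD l) (tmapD fS idA).
- exact: addmap_comp (semilinD (iota := idfun) fS) (contractD l).
- by rewrite (tmapE fS idA) !contractE (semilinZ (iota := idfun) fS).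
Qed.

Section RepJ.
Variable V : rep A.
Definition opact (j : oper) (v : V) : V :=
  match j with inl l => contract l (coact v) | inr i => gcomp (rep_gr V) i v end.
Lemma opact_linear j : linear (opact j).
Proof.
case: j => [l|i] c u v; last exact: gcomp_linear.
by rewrite /= coact_linear contractD contractZ.
Qed.
Definition repJ : jmod oper F := JMod opact_linear.
End RepJ.

(** The coefficients [x k] of a dual form are images of [v] under operators, so a set stable under
    the operators contains them together with [v]. *)
Lemma coact_dual (V : rep A) (v : V) :
  exists n (x : nat -> V) (a : nat -> A) (l : nat -> functional),
  [/\ coact v = \sum_(k < n) x k \ot a k, forall k, (k < n)%N -> x k = contract (l k) (coact v) &
      forall k m, (k < n)%N -> (m < n)%N -> l k (a m) = (k == m)%:R].
Proof.
have [n [x [a [l [vE ll la]]]]] := dual_representation (coact v).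
exists n, x, a, (fun k => Functional (ll k)); split=> // k kn.
rewrite vE (addmap_sum _ _ _ (contractD _)) (bigD1 (Ordinal kn)) //= big1 ?addr0.
  by rewrite (contractE (Functional (ll k))) /= la // eqxx scale1r.
by move=> i; rewrite -val_eqE /= => ik; rewrite (contractE (Functional (ll k))) /= la // eq_sym (negPf ik) scale0r.
Qed.

Lemma coact_homE (V V' : rep A) (f : V -> V') : linear f ->
  (forall v, coact (f v) = tmap f id (coact v)) <->
  (forall l : functional, forall v, f (contract l (coact v)) = contract l (coact (f v))).
Proof.
move=> fl; split=> [h l v|h v]; first by rewrite h contract_tmap.
by apply: contract_separated => l; rewrite contract_tmap.
Qed.

Lemma HomG_shom (V V' : rep A) f : HomG V V' f <-> shom twist idfun false (repJ V) (repJ V') f.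
Proof.
split=> [[fl fg fc]|[fl fa]]; split=> //.
- by move=> [l|i] v /=; [exact: (coact_homE fl).1|rewrite addbF].
- by move=> i v; have := fa (inr i) v; rewrite twist0.
- by apply/(coact_homE fl) => l v; exact: (fa (inl l)).
Qed.

Lemma HomG_parity_shom (V V' : rep A) f :
  HomG V (parity_change V') f <-> shom twist idfun true (repJ V) (repJ V') f.
Proof.
split=> [[fl fg fc]|[fl fa]]; split=> //.
- move=> [l|i] v /=; first exact: ((coact_homE (V' := parity_change V') fl).1 fc l v).
  by rewrite addbT; exact: fg.
- by move=> i v; have := fa (inr i) v; rewrite /= addbT.
- by apply/(coact_homE (V' := parity_change V') fl) => l v; exact: (fa (inl l)).
Qed.

Lemma subrep_stable (V : rep A) (U : set V) : subrep U <-> stable (V := repJ V) U.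
Proof.
split=> [[U0 UZ Ug Uc]|[[U0 UZ] Ua]].
  split=> // -[l|i] u Uu; last exact: Ug.
  rewrite /=; have [s sU ->] := Uc u Uu.
  rewrite (addmap_sum _ _ _ (contractD l)) big_seq; apply: (big_ind U) => //.
    by move=> x y Ux Uy; rewrite -[x]scale1r; exact: UZ.
  by move=> p /sU Up; rewrite contractE -[_ *: _]addr0; exact: UZ.
split=> //; first by move=> i v; exact: (Ua (inr i)).
move=> v Uv; have [n [x [a [l [vE xE _]]]]] := coact_dual v.
exists [seq (x k, a k) | k <- iota 0 n]; last by rewrite vE big_map -(big_mkord xpredT (fun k => x k \ot a k)) /index_iota subn0.
move=> _ /mapP[k kn ->] /=; rewrite mem_iota in kn; rewrite xE //.
exact: (Ua (inl (l k))).
Qed.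

Lemma irreducible_jirr (V : rep A) : irreducible V <-> jirr (repJ V).
Proof.
split=> [[v0 Virr]|[v0 Virr]]; split=> // U.
  move=> /subrep_stable/Virr[->|-> //] [u -> /eqP //].
move=> /subrep_stable Us; have [[u Uu u0]|nU] := pselect (exists2 u, U u & u != 0).
  right; apply/seteqP; split=> // v _; apply: (Virr U) => //; by exists u.
left; apply/seteqP; split=> [u Uu|_ ->]; last exact: Us.1.1.
by apply: contrapT => /eqP u0; apply: nU; exists u.
Qed.

(** By coassociativity [n] is the convolution of [m] and [l], the functional ([m] (x) [l]) o
    [comul]. *)
Lemma op_comp (V : rep A) (l m : functional) : exists n : functional, forall v : V,
  contract m (coact (contract l (coact v))) = contract n (coact v).
Proof.
have bal : balanced (fun b c : A => m b * l c : F^o).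
  split=> [c a b|a b c|k a b] /=; first by rewrite fnD mulrDl.
  - by rewrite fnD mulrDr.
  - by rewrite !fnZ -mulrA mulrCA.
pose ml (p : tens A A) : F^o := tlift (fun b c : A => m b * l c : F^o) p.
have mlD : addmap ml := tliftD bal.
have mlE b c : ml (b \ot c) = m b * l c := tliftE _ _ bal.
have mlS : semilin idfun ml.
  apply: semilinP => // k; apply: tens_ext => [x y|x y|b c]; rewrite ?scalerDr ?mlD ?scalerDr //.
  by rewrite -tmkZl !mlE fnZ [RHS]mulrA.
have nl : scalar (fun a : A => ml (comul a) : F).
  move=> k a b; have := mlS k (comul a) (comul b); rewrite comul_linear.
  by [].
exists (Functional nl) => v.
have bal2 : balanced (fun (w : V) (p : tens A A) => (ml p : F) *: w).
  split=> [p u w|w p q|k w p] /=; first by rewrite scalerDr.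
  - by rewrite mlD scalerDl.
  - by rewrite (semilinZ (iota := idfun) mlS) scalerA [_ *: _ in RHS]/GRing.scale /= mulrC.
pose Phi : tens V (tens A A) -> V := tlift (fun w p => (ml p : F) *: w).
have PhiD : addmap Phi := tliftD bal2.
have PhiE w p : Phi (w \ot p) = (ml p : F) *: w := tliftE _ _ bal2.
have idA := @semilin_id F A; have idV := @semilin_id F V.
have cS := coactS V; have hS := @comulS F A.
have lmD : addmap (fun v : V => contract m (coact v)).
  by move=> x y; rewrite (semilinD (iota := idfun) cS) contractD.
transitivity (Phi (tassoc (tmap (@coact _ _ V) id (coact v)))).
  move: (coact v); apply: tens_ext.
  - exact: addmap_comp lmD (contractD l).
  - exact: addmap_comp PhiD (addmap_comp (semilinD (iota := idfun) (@semilin_tassoc _ _ _ _)) (tmapD cS idA)).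
  move=> w a; rewrite contractE (tmapE cS idA) (semilinZ (iota := idfun) cS) contractZ.
  move: (coact w); apply: tens_ext.
  - by move=> x y; rewrite contractD scalerDr.
  - apply: addmap_comp PhiD (addmap_comp (semilinD (iota := idfun) (@semilin_tassoc _ _ _ _)) _).
    by move=> x y; rewrite tmkDl.
  by move=> u b; rewrite tassocE PhiE mlE contractE scalerA mulrC.
rewrite coact_assoc; move: (coact v); apply: tens_ext.
- exact: addmap_comp PhiD (tmapD idV hS).
- exact: contractD (Functional nl).
by move=> w a; rewrite (tmapE idV hS) PhiE (contractE (Functional nl)).
Qed.

(** On a vector of parity [d], taking the part of parity [i] amounts to restricting [l] to the part
    of [A] of parity [d (+) i]. *)
Lemma op_gcomp (V : rep A) (l : functional) d i : exists n : functional, forall v : V,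
  gcomp (rep_gr V) d v = v -> gcomp (rep_gr V) i (contract l (coact v)) = contract n (coact v).
Proof.
have gS k := gcompS (hs_gr A) k.
have nl : scalar (fun a : A => l (gcomp (hs_gr A) (d (+) i) a)).
  by move=> k a b; rewrite gcomp_linear fn_scalar.
exists (Functional nl) => v vd; rewrite -vd coact_even; move: (coact v); apply: tens_ext.
- apply: addmap_comp (semilinD (iota := idfun) (gcompS _ _)) (addmap_comp (contractD l) (semilinD (iota := idfun) (tcompS _ _ _))).
- exact: addmap_comp (contractD (Functional nl)) (semilinD (iota := idfun) (tcompS _ _ _)).
move=> w a; rewrite tcompE !contractD !contractE /= (semilinD (iota := idfun) (gcompS _ _)).
rewrite !(semilinZ (iota := idfun) (gcompS _ _)) !gcompK.
have l0 : l 0 = 0 by apply: (addIr (l 0)); rewrite -fnD !add0r.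
by case: d i {nl vd} => [] [] /=; rewrite ?l0 ?scale0r ?scaler0 ?addr0 ?add0r.
Qed.

(** Local finiteness of comodules: for a homogeneous [v], the images of [v] under the functionals
    are stable under all operators and spanned by the finitely many coefficients of [coact v]. The
    counit shows that [v] is among them. *)
Lemma locally_finite (V : rep A) (v : V) : v != 0 ->
  exists n (U : set V), [/\ stable (V := repJ V) U, spanned n U & exists2 u, U u & u != 0].
Proof.
move=> v0; wlog [d vd] : v v0 / exists d, gcomp (rep_gr V) d v = v.
  move=> W; have [e0|e0] := eqVneq (gcomp (rep_gr V) false v) 0.
    apply: (W v) => //; exists true.
    by rewrite -[RHS](gcompD (rep_gr V)) e0 add0r.
  by apply: (W _ e0); exists false; rewrite gcompK eqxx.
have [n [x [a [l [vE xE la]]]]] := coact_dual v.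
pose U : set V := [set w | exists m : functional, w = contract m (coact v)].
have sp : spanned n U.
  exists (fun i : 'I_n => x i) => w; split.
    move=> [m ->]; exists (\row_i m (a i)); rewrite vE (addmap_sum _ _ _ (contractD m)).
    by apply: eq_bigr => i _; rewrite contractE mxE.
  move=> [c ->].
  (* By duality this functional extracts the prescribed combination of the [x i]. *)
  have ml : scalar (fun b => \sum_(i < n) c 0 i * l i b).
    move=> k b b'; rewrite mulr_sumr -big_split; apply: eq_bigr => i _ /=.
    by rewrite fn_scalar mulrDr mulrCA.
  exists (Functional ml); rewrite vE (addmap_sum _ _ _ (contractD _)); apply: eq_bigr => i _.
  rewrite contractE /=; congr (_ *: _); rewrite (bigD1 i) //= big1 ?addr0.
    by rewrite la // eqxx mulr1.
  by move=> j ji; rewrite la // -[_ == _]/(j == i) (negPf ji) mulr0.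
exists n, U; split=> //; last first.
  have el : scalar (@counit F A) by exact: counit_linear.
  by exists v => //; exists (Functional el); rewrite -[LHS]coact_counit.
split; first exact: spanned_subspace sp.
move=> [m|i] _ [l1 ->] /=; last first.
  by have [m mE] := op_gcomp V l1 d i; exists m; exact: mE.
by have [m' mE] := op_comp V l1 m; exists m'; exact: mE.
Qed.
End Operators.
Arguments contract {F A V} l t.

(** * Subspaces as representations, and irreducible subrepresentations *)

Section Subspace.
Variables (F : fieldType) (V : lmodType F) (U : set V) (Us : subspace U).

Definition subsp : Type := {v : V | `[< U v >]}.
HB.instance Definition _ := SubType.on subsp.
HB.instance Definition _ := [Choice of subsp by <:].

Lemma subspP (u : subsp) : U (val u). Proof. exact/asboolP/(valP u). Qed.
Definition mksub v (Uv : U v) : subsp := exist _ v (introT (asboolP _) Uv).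
Definition sub0 : subsp := mksub Us.1.
Definition subD (u v : subsp) : subsp := mksub (subspaceD Us (subspP u) (subspP v)).
Definition subN (u : subsp) : subsp := mksub (subspaceZ Us (-1) (subspP u)).
Definition subZ (c : F) (u : subsp) : subsp := mksub (subspaceZ Us c (subspP u)).
Lemma subDA : associative subD. Proof. by move=> u v w; apply: val_inj; exact: addrA. Qed.
Lemma subDC : commutative subD. Proof. by move=> u v; apply: val_inj; exact: addrC. Qed.
Lemma sub0D : left_id sub0 subD. Proof. by move=> u; apply: val_inj; exact: add0r. Qed.
Lemma subND : left_inverse sub0 subN subD.
Proof. by move=> u; apply: val_inj; rewrite /= scaleN1r addNr. Qed.
Lemma subZA a b u : subZ a (subZ b u) = subZ (a * b) u.
Proof. by apply: val_inj; exact: scalerA. Qed.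
Lemma sub1Z : left_id 1 subZ. Proof. by move=> u; apply: val_inj; exact: scale1r. Qed.
Lemma subZDr : right_distributive subZ subD.
Proof. by move=> c u v; apply: val_inj; exact: scalerDr. Qed.
Lemma subZDl u : {morph subZ^~ u : a b / a + b >-> subD a b}.
Proof. by move=> a b; apply: val_inj; exact: scalerDl. Qed.

(** The inverse [g] of the inclusion is extended to all of [V] through a linear projection, so that
    coactions can be transported along [g] (x) id. *)
Lemma submodule_of_subspace : exists (S : lmodType F) (f : S -> V) (g : V -> S),
  [/\ linear f, linear g, cancel f g, forall s, U (f s) & forall u, U u -> f (g u) = u].
Proof.
pose Z := GRing.isZmodule.Build subsp subDA subDC sub0D subND.
pose S0 : zmodType := HB.pack subsp Z.
pose S : lmodType F := HB.pack S0 (@GRing.Zmodule_isLmodule.Build F S0 subZ subZA sub1Z subZDr subZDl).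
have [p [pl pU pu]] := linear_projection Us.
exists S, (val : subsp -> V), (fun v => mksub (pU v) : S); split.
- by [].
- by move=> c u v; apply: val_inj; exact: pl.
- by move=> s; apply: val_inj; rewrite /= pu //; exact: subspP.
- exact: subspP.
- by move=> u Uu /=; exact: pu.
Qed.
End Subspace.

Section Subrepresentations.
Variables (F : fieldType) (A : hopf_superalg F).

Section Build.
Variables (V : rep A) (U : set V) (Us : stable (V := repJ V) U).
Variables (S : lmodType F) (f : S -> V) (g : V -> S).
Hypotheses (fl : linear f) (gl : linear g) (fK : cancel f g).
Hypotheses (fU : forall s, U (f s)) (gK : forall u, U u -> f (g u) = u).

Let fS : semilin idfun f := fl.
Let gS : semilin idfun g := gl.
Let idA := @semilin_id F A.
Let idV := @semilin_id F V.
Let idS := @semilin_id F S.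

Definition sub_coact (s : S) : tens S A := tmap g id (coact (f s)).
Lemma sub_coactS : semilin idfun sub_coact.
Proof. exact: semilin_compl (semilin_compr fS (coactS V)) (semilin_tmap gS idA). Qed.
Definition sub_comp i (s : S) : S := g (gcomp (rep_gr V) i (f s)).
Lemma sub_compS i : linear (sub_comp i).
Proof. by move=> c u v; rewrite /sub_comp fl gcomp_linear gl. Qed.
Lemma sub_compE i s : f (sub_comp i s) = gcomp (rep_gr V) i (f s).
Proof. by rewrite /sub_comp gK //; exact: (Us.2 (inr i) _ (fU s)). Qed.
Lemma sub_compK i j s : sub_comp i (sub_comp j s) = if i == j then sub_comp i s else 0.
Proof.
apply: (can_inj fK); rewrite !sub_compE gcompK; case: ifP => _; first by rewrite sub_compE.
by rewrite (semilin0 (iota := idfun) fS).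
Qed.
Lemma sub_compD s : sub_comp false s + sub_comp true s = s.
Proof. by apply: (can_inj fK); rewrite (semilinD (iota := idfun) fS) !sub_compE gcompD. Qed.
Definition sub_gr : grading S := Grading sub_compS sub_compK sub_compD.

Lemma tmap_f_inj (X : lmodType F) : injective (tmap f (@id X)).
Proof.
apply: (can_inj (g := tmap g (@id X))) => t.
rewrite (tmap_comp _ fS (@semilin_id F X) gS (@semilin_id F X)) -[RHS]tmap_id.
by apply: eq_tmap.
Qed.

(** The coefficients of [coact (f s)] lie in [U], where the retraction [g] really inverts [f]. *)
Lemma sub_coactE s : tmap f id (sub_coact s) = coact (f s).
Proof.
rewrite (tmap_comp _ gS idA fS idA).
have [n [x [a [l [vE xE _]]]]] := coact_dual (f s).
have fgS : semilin idfun (fun v => f (g v)) by exact: semilin_compl gS fS.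
rewrite vE (addmap_sum _ _ _ (tmapD fgS idA)); apply: eq_bigr => k _.
rewrite (tmapE fgS idA) gK // xE //.
exact: (Us.2 (inl (l k)) _ (fU s)).
Qed.

Lemma sub_coact_even i s : sub_coact (gcomp sub_gr i s) = tcomp sub_gr (hs_gr A) i (sub_coact s).
Proof.
apply: tmap_f_inj; rewrite sub_coactE (tcomp_nat (gV' := rep_gr V) (gW' := hs_gr A) _ _ fS idA) //.
  by rewrite sub_coactE [f _]sub_compE coact_even.
by move=> b v; exact: sub_compE.
Qed.
Lemma sub_coact_assoc s :
  tassoc (tmap sub_coact id (sub_coact s)) = tmap id (@comul F A) (sub_coact s).
Proof.
have hS := @comulS F A; have cS := coactS V; have scS := sub_coactS.
have idAA := @semilin_id F (tens A A).
have fiS := semilin_tmap fS idA.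
apply: tmap_f_inj.
have -> : tmap f (@id (tens A A)) (tassoc (tmap sub_coact id (sub_coact s))) =
    tassoc (tmap (tmap f id) id (tmap sub_coact id (sub_coact s))).
  rewrite (tassoc_nat _ fS idA idA); apply: eq_tmap => // p; exact: (esym (tmap_id p)).
rewrite (tmap_comp _ scS idA fiS idA).
have -> : tmap (fun v => tmap f id (sub_coact v)) (fun a : A => id (id a)) (sub_coact s) =
    tmap (@coact _ _ V) id (tmap f id (sub_coact s)).
  by rewrite (tmap_comp _ fS idA cS idA); apply: eq_tmap => // v; exact: sub_coactE.
rewrite sub_coactE coact_assoc -sub_coactE (tmap_comp _ fS idA idV hS) (tmap_comp _ idS hS fS idAA).
exact: eq_tmap.
Qed.
Lemma sub_coact_counit s : tlift (fun w (a : A) => counit a *: w) (sub_coact s) = s.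
Proof.
have el : scalar (@counit F A) by exact: counit_linear.
apply: (can_inj fK); rewrite -[RHS]coact_counit -sub_coactE.
exact: (esym (contract_tmap (Functional el) (sub_coact s) fS)).
Qed.
Definition sub_rep : rep A := Rep sub_coactS sub_coact_even sub_coact_assoc sub_coact_counit.
Lemma sub_rep_hom : HomG sub_rep V f.
Proof.
by split=> // [i v|v]; [exact: sub_compE|rewrite [coact v]/(sub_coact v) sub_coactE].
Qed.
End Build.

Lemma subrep_exists (V : rep A) (U : set V) : stable (V := repJ V) U ->
  exists (S : rep A) (f : S -> V), [/\ HomG S V f, injective f, forall s, U (f s) &
    forall u, U u -> exists s, f s = u].
Proof.
move=> Us; have [S [f [g [fl gl fK fU gK]]]] := submodule_of_subspace Us.1.
exists (sub_rep Us fl gl fK fU gK), f; split=> //; first exact: sub_rep_hom.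
  exact: can_inj fK.
by move=> u Uu; exists (g u); exact: gK.
Qed.

(** A nonzero stable subspace spanned by the least possible number of vectors is irreducible: a
    proper nonzero stable subspace would be spanned by fewer. *)
Lemma irreducible_exists (V : rep A) (v : V) : v != 0 ->
  exists (S : rep A) (f : S -> V), [/\ irreducible S, HomG S V f & injective f].
Proof.
move=> v0.
pose P n := `[< exists U : set V, [/\ stable (V := repJ V) U, spanned n U & exists2 u, U u & u != 0] >].
have exP : exists n, P n.
  by have [n [U h]] := locally_finite v0; exists n; apply/asboolP; exists U.
case: (ex_minnP exP) => n /asboolP[U [Us Usp [u0 Uu0 u00]]] nmin.
have [S [f [fh fi fU Uf]]] := subrep_exists Us.
exists S, f; split=> //; apply/irreducible_jirr; split.
  by have [s fs] := Uf _ Uu0; exists s; apply: contraNneq u00 => s0; rewrite -fs s0 (semilin0 (iota := idfun) (let: And3 h _ _ := fh in h)).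
have fsh := (HomG_shom f).1 fh.
move=> T Ts [t Tt t0] s.
pose U' := [set x | exists2 t, T t & x = f t].
have U's : stable (V := repJ V) U'.
  split; first split.
  - by exists 0; [exact: Ts.1.1|rewrite (shom0 fsh)].
  - by move=> c _ _ [x Tx ->] [y Ty ->]; exists (c *: x + y); [exact: Ts.1.2|rewrite fsh.1].
  - move=> j _ [x Tx ->]; exists (jact (j : oper A) (x : repJ S)); first exact: Ts.2.
    by rewrite fsh.2 twist0.
have U'U : U' `<=` U by move=> _ [x _ ->]; exact: fU.
have ft0 : f t != 0 by apply: contraNneq t0 => ft; apply/eqP/fi; rewrite ft (shom0 fsh).
have [r [rn rU' [rltn|UU']]] := spanned_sub Usp U's.1 U'U.
  have : (n <= r)%N by apply: nmin; apply/asboolP; exists U'; split=> //; exists (f t) => //; exists t.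
  by rewrite leqNgt rltn.
by have [x Tx /fi->] := UU' _ (fU s).
Qed.

Lemma irreducible_fin_dim (V : rep A) : irreducible V -> fin_dim V.
Proof.
move=> Vi; have [[v v0] Virr] := (irreducible_jirr V).1 Vi.
have [n [U [Us Usp un]]] := locally_finite v0.
exists n; have -> // : setT = U.
by apply/seteqP; split=> // w _; exact: Virr Us un w.
Qed.
End Subrepresentations.

Lemma HomG_scale (F : fieldType) (A : hopf_superalg F) (V : rep A) c : HomG V V (fun v => c *: v).
Proof.
have cS : semilin idfun (fun v : V => c *: v) := @semilin_scale F V c.
have idA := @semilin_id F A.
split=> // [i v|v]; first by rewrite (semilinZ (iota := idfun) (gcompS _ _)).
rewrite (semilinZ (iota := idfun) (coactS V)).
move: (coact v); apply: tens_ext => [x y||x a].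
- by rewrite scalerDr.
- exact: (tmapD cS idA).
- by rewrite (tmapE cS idA) tmkZl.
Qed.

(** * Representations over an extension as modules over operators defined over the base *)

Section Restriction.
Variables (F E : fieldType) (iota : {rmorphism F -> E}) (A : hopf_superalg F).
Notation B := (base_changeH iota A).

Lemma res2_tmap (X : lmodType F) (M : lmodType E) (f : X -> M) (t : tens X A) :
  semilin iota f ->
  res2 (tmap f (bj iota : A -> B) t) = tmap (f : X -> rscal iota M) id t :> tens (rscal iota M) A.
Proof.
move=> fS; have fS' : semilin idfun (f : X -> rscal iota M) := fS.
have jS : semilin iota (bj iota : A -> B) := semilin_bj iota A.
move: t; apply: tens_ext.
- exact: addmap_comp (@res2D _ _ _ _ M) (tmapD fS jS).
- exact: tmapD fS' (@semilin_id F A).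
by move=> x a; rewrite (tmapE fS jS) (tmapE fS' (@semilin_id F A)) res2E res1bj.
Qed.

Lemma res_coact_homE (V V' : rep B) (f : V -> V') : linear f ->
  (forall v, coact (f v) = tmap f id (coact v)) <->
  (forall v : rscal iota V, res_coact (f v : rscal iota V') =
     tmap (f : rscal iota V -> rscal iota V') id (res_coact v)).
Proof.
move=> fl; have fS : semilin idfun f := fl.
have idS : semilin iota (id : rscal iota V -> V) by [].
have idS' : semilin iota (id : rscal iota V' -> V') by [].
have jS : semilin iota (bj iota : A -> B) := semilin_bj iota A.
have fS1 : semilin iota (f : rscal iota V -> V') by move=> c u v; exact: (fl (iota c) u v).
have fS2 : semilin idfun (f : rscal iota V -> rscal iota V') := fS1.
have idB := @semilin_id E B; have idA := @semilin_id F A.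
split=> h v.
  rewrite /res_coact h -{1}(kap_res v) (tmap_comp _ idS jS fS idB).
  exact: (res2_tmap (res_coact v) fS1).
rewrite -(kap_res (f v : rscal iota V')) h (tmap_comp _ fS2 idA idS' jS).
by rewrite -(kap_res (v : rscal iota V)) (tmap_comp _ idS jS fS idB).
Qed.

Section RepK.
Variable V : rep B.
Definition opactK (j : oper A) (v : V) : V := opact (V := restriction V) j v.
(** The operators of the restriction are a priori linear over [F] only; they are linear over [E]
    because scaling by an element of [E] is an endomorphism of [V] and commutes with them. *)
Lemma opactK_linear j : linear (opactK j).
Proof.
case: j => [l|i] c u v; last exact: (gcomp_linear (rep_gr V) i c u v).
have [cl _ cc] := HomG_scale V c.
have cZ (w : V) : opactK (inl l) (c *: w) = c *: opactK (inl l) w.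
  have := (res_coact_homE cl).1 cc w.
  have cl' : semilin idfun ((fun v : V => c *: v) : rscal iota V -> rscal iota V).
    exact: (semilin_rs cl).
  move/(congr1 (contract l)); rewrite (contract_tmap l _ cl'); exact.
have D (x y : V) : opactK (inl l) (x + y) = opactK (inl l) x + opactK (inl l) y.
  exact: (@jactD _ _ (repJ (restriction V)) (inl l) x y).
by rewrite D cZ.
Qed.
Definition repK : jmod (oper A) E := JMod opactK_linear.
End RepK.

Lemma repK_shom (V V' : rep B) b f :
  (linear f /\ (forall i v, f (gcomp (rep_gr V) i v) = gcomp (rep_gr V') (i (+) b) (f v)) /\
   forall v, coact (f v) = tmap f id (coact v)) <->
  shom (@twist F A) idfun b (repK V) (repK V') f.
Proof.
split=> [[fl [fg fc]]|[fl fa]].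
  split=> // -[l|i] v; last exact: fg.
  have fl' : linear (f : restriction V -> restriction V') by exact: (semilin_rs fl).
  exact: ((coact_homE (V := restriction V) (V' := restriction V') fl').1 ((res_coact_homE fl).1 fc) l v).
split=> //; split; first by move=> i v; exact: (fa (inr i) v).
apply/(res_coact_homE fl).
have fl' : linear (f : restriction V -> restriction V') by exact: (semilin_rs fl).
by apply/(coact_homE (V := restriction V) (V' := restriction V') fl') => l v; exact: (fa (inl l) v).
Qed.

Lemma HomG_shomK (V V' : rep B) f : HomG V V' f <-> shom (@twist F A) idfun false (repK V) (repK V') f.
Proof.
rewrite -repK_shom; split=> [[h1 h2 h3]|[h1 [h2 h3]]]; split=> //.
  by split=> // i v; rewrite addbF.
by move=> i v; rewrite h2 addbF.
Qed.

Lemma HomG_parity_shomK (V V' : rep B) f :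
  HomG V (parity_change V') f <-> shom (@twist F A) idfun true (repK V) (repK V') f.
Proof.
rewrite -repK_shom; split=> [[h1 h2 h3]|[h1 [h2 h3]]]; split=> //.
  by split=> // i v; rewrite addbT; exact: h2.
by move=> i v; rewrite h2 addbT.
Qed.

Lemma HomG_restriction (V V' : rep B) f : HomG V V' f -> HomG (restriction V) (restriction V') f.
Proof.
move=> [fl fg fc]; split; [exact: (semilin_rs fl)|exact: fg|].
exact: ((res_coact_homE fl).1 fc).
Qed.

Lemma HomG_of_restriction (V V' : rep B) (f : V -> V') :
  linear f -> HomG (restriction V) (restriction V') f -> HomG V V' f.
Proof. by move=> fl [_ fg fc]; split=> //; apply/(res_coact_homE fl). Qed.

Lemma contractK (V : rep B) (l : functional A) :
  exists m : functional B, forall v : V, opactK (inl l) v = contract m (coact v).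
Proof.
have lS : semilin iota (fun a : A => iota (l a) : E^o).
  by move=> c u v; rewrite fn_scalar rmorphD rmorphM.
have ml : scalar (bclift iota (fun a : A => iota (l a) : E^o) : B -> E).
  exact: (semilin_bclift lS).
exists (Functional ml) => v; rewrite /opactK /= /res_coact; move: (coact v).
apply: tensB_ext.
- exact: addmap_comp (contractD l) (@res2D _ _ _ _ V).
- exact: contractD (Functional ml).
move=> u a; rewrite res2E res1bj (contractE l) (contractE (Functional ml)) /=.
by rewrite (bcliftE lS).
Qed.

Lemma subrep_stableK (V : rep B) (U : set V) : subrep U <-> stable (V := repK V) U.
Proof.
split=> [/subrep_stable[[U0 UZ] Ua]|[[U0 UZ] Ua]].
  split=> // -[l|i] u Uu; last exact: (Ua (inr i)).
  have [m mE] := contractK V l; rewrite [jact _ _]mE; exact: (Ua (inl m)).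
have /subrep_stable[_ _ _ Uc] : stable (V := repJ (restriction V)) U.
  by split=> //; split=> // c u v; exact: UZ.
split=> //; first by move=> i v; exact: (Ua (inr i)).
move=> v Uv; have [s sU sE] := Uc v Uv.
exists [seq (p.1, bj iota p.2 : B) | p <- s]; first by move=> _ /mapP[p ps ->]; exact: sU.
have idS : semilin iota (id : rscal iota V -> V) by [].
have jS : semilin iota (bj iota : A -> B) := semilin_bj iota A.
rewrite -(kap_res (v : rscal iota V)) [res_coact _]sE (addmap_sum _ _ _ (tmapD idS jS)) big_map.
by apply: eq_bigr => p _; rewrite (tmapE idS jS).
Qed.

Lemma irreducible_jirrK (V : rep B) : irreducible V <-> jirr (repK V).
Proof.
split=> [[v0 Virr]|[v0 Virr]]; split=> // U.
  move=> /subrep_stableK/Virr[->|-> //] [u -> /eqP //].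
move=> /subrep_stableK Us; have [[u Uu u0]|nU] := pselect (exists2 u, U u & u != 0).
  right; apply/seteqP; split=> // v _; apply: (Virr U) => //; by exists u.
left; apply/seteqP; split=> [u Uu|_ ->]; last exact: Us.1.1.
by apply: contrapT => /eqP u0; apply: nU; exists u.
Qed.

Lemma HomG_bj (W : rep A) : HomG W (restriction (base_changeR iota W)) (bj iota : W -> bc iota W).
Proof.
split.
- exact: (semilin_bj iota W).
- by move=> i v; rewrite [RHS]bccompE.
move=> v; rewrite [LHS]/(res2 (coact _)) [coact _]bccoactE.
exact: (res2_tmap (M := bc iota W) (coact v) (semilin_bj iota W)).
Qed.

Lemma repK_base_change (W : rep A) j (x : bc iota W) :
  @jact _ _ (repK (base_changeR iota W)) j x = @jact _ _ (jbc iota (repJ W)) j x.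
Proof.
move: x; apply: (@bc_ext _ _ iota W _ idfun (bc iota W)).
- exact: (@jactS _ _ (repK (base_changeR iota W)) j).
- exact: (@jactS _ _ (jbc iota (repJ W)) j).
move=> w; rewrite [RHS](jact_bj iota j (w : repJ W)).
by have := ((HomG_shom (bj iota : W -> restriction (base_changeR iota W))).1 (HomG_bj W)).2 j w; rewrite twist0.
Qed.

Lemma HomG_base_change (V : rep B) (W : rep A) f :
  HomG V (base_changeR iota W) f <-> shom (@twist F A) idfun false (repK V) (jbc iota (repJ W)) f.
Proof.
rewrite HomG_shomK; split=> -[fS fa]; split=> // j v.
  by rewrite -repK_base_change; exact: fa.
by rewrite repK_base_change; exact: fa.
Qed.
End Restriction.
Arguments repK {F E} iota {A} V.

(** * Galois twists through semilinear maps *)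

Section GaloisTwist.
Variables (F K : fieldType) (iota : {rmorphism F -> K}) (G : hopf_superalg F).
Notation B := (base_changeH iota G).
Notation tw := (@twist F G).

(** The canonical map from [V] to its twist respects the operators, since these are defined over
    [F], which [s] fixes. Homomorphisms out of the twist thus become semilinear maps out of [V]. *)
Lemma shom_gal_twist (s : galaut iota) (V : rep B) :
  shom tw s false (repK iota V) (repK iota (gal_twist s V)) (bj s : V -> bc s V).
Proof.
have bS := semilin_bj s V.
have bSF : semilin iota ((bj s : V -> bc s V) : rscal iota V -> bc s V).
  by move=> c u v; rewrite rscalE (semilin_bj s V (iota c) u v) ga_fix.
have bS' : semilin idfun ((bj s : V -> bc s V) : restriction V -> restriction (gal_twist s V)) := bSF.
have co (v : V) : res_coact (U := gal_twist s V) (bj s v) =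
    tmap ((bj s : V -> bc s V) : restriction V -> restriction (gal_twist s V)) id (res_coact (v : rscal iota V)).
  rewrite -(res2_tmap (res_coact (v : rscal iota V)) bSF) /res_coact; congr res2.
  have -> : coact (bj s v : gal_twist s V) = tmap id (bc_fold (ga_fix s) G) (tmap (bj s : V -> bc s V) (bj s : B -> base_changeH s B) (coact v)).
    by rewrite -bccoactE.
  have idS : semilin iota (id : rscal iota V -> V) by [].
  have jS : semilin iota (bj iota : G -> B) := semilin_bj iota G.
  have jsS : semilin s (bj s : B -> base_changeH s B) := semilin_bj s B.
  have jsjS : semilin iota (fun a : G => bj s (bj iota a : B) : base_changeH s B).
    exact: semilin_comp (fun c => esym (ga_fix s c)) jS jsS.
  rewrite -{1}(kap_res (v : rscal iota V)) (tmap_comp _ idS jS bS jsS).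
  have idB := @semilin_id K (bc s V).
  have fS := @foldS F K K iota s iota (ga_fix s) G.
  rewrite (tmap_comp _ bSF jsjS idB fS) /res_coact; apply: eq_tmap => // a.
  exact: (foldE (ga_fix s) a).
split=> // -[l|i] v; last by rewrite /= addbF; exact: (esym (bccompE s (rep_gr V) i v)).
exact: (esym (etrans (congr1 (contract l) (co v)) (contract_tmap l _ bS'))).
Qed.

Lemma bj_bijective (s : galaut iota) (V : lmodType K) : bijective (bj s : V -> bc s V).
Proof.
have [s' [sK s'K]] := galaut_inv s.
have bal : balanced (fun (c : rscal s K^o) (v : V) => s' (c : K) *: v).
  split=> [v c d|c v w|c d v] /=; first by rewrite rmorphD scalerDl.
    by rewrite scalerDr.
  rewrite scalerA; congr (_ *: _); rewrite rscalE [_ *: _]/(s c * (d : K)) rmorphM sK mulrC //.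
have hE c v : tlift (fun (c : rscal s K^o) (v : V) => s' (c : K) *: v) (c *: bj s v) = s' c *: v.
  exact: (etrans (congr1 _ (esym (bjE s c v))) (tliftE _ _ bal)).
exists (tlift (fun (c : rscal s K^o) (v : V) => s' (c : K) *: v)).
  by move=> v; rewrite -[bj s v]scale1r hE rmorph1 scale1r.
apply: bc_ext0 => [x y|//|c v].
  by rewrite (tliftD bal) (semilinD (semilin_bj s V)).
by rewrite hE (semilinZ (semilin_bj s V)) s'K.
Qed.

Lemma gal_twist_iso (s : galaut iota) (V V' : rep B) :
  iso (gal_twist s V) V' <-> exists g, shom tw s false (repK iota V) (repK iota V') g /\ bijective g.
Proof.
have bh := shom_gal_twist s V; have bb := bj_bijective s V.
split=> [[f /(HomG_shomK (iota := iota)) fh fb]|[g [gh gb]]].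
  exists (fun v => f (bj s v)); split; last exact: bij_comp fb bb.
  by apply: (shom_comp (@twistA _ _) bh fh).
have [s' [sK s'K]] := galaut_inv s.
case: bb => b' bK Kb; have b'h := shom_inv (@twist0 _ _) (@twistA _ _) bh s'K bK Kb.
exists (fun x => g (b' x)); last by apply: bij_comp gb _; exists (bj s).
by apply/(HomG_shomK (iota := iota)); apply: (shom_comp (@twistA _ _) b'h gh) => // x; rewrite s'K.
Qed.
End GaloisTwist.

(** * Enlarging the field of scalars by central endomorphisms *)

Section EnlargeScalars.
Variables (F F' : fieldType) (iF : {rmorphism F -> F'}) (G : hopf_superalg F).
Variables (W : rep G) (theta : F' -> W -> W).
Hypothesis thh : forall c, HomG W W (theta c).
Hypothesis thD : forall c d w, theta (c + d) w = theta c w + theta d w.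
Hypothesis thM : forall c d w, theta (c * d) w = theta c (theta d w).
Hypothesis thF : forall c w, theta (iF c) w = c *: w.
Notation B := (base_changeH iF G).

Lemma module_of_action : exists (M : lmodType F') (r : W -> M) (r' : M -> W),
  [/\ cancel r r', cancel r' r, semilin iF r & forall c w, r (theta c w) = c *: r w].
Proof.
have thS c : semilin idfun (theta c) by case: (thh c).
have th1 : left_id 1 theta by move=> w; rewrite -(rmorph1 iF) thF scale1r.
have thDr : right_distributive theta +%R by move=> c u v; exact: (semilinD (iota := idfun) (thS c)).
have thDl w : {morph theta^~ w : a b / a + b} by move=> a b; exact: thD.
have thA a b w : theta a (theta b w) = theta (a * b) w by rewrite thM.
pose Z : zmodType := W.
pose M : lmodType F' := HB.pack (GRing.Zmodule.sort Z)
  (@GRing.Zmodule_isLmodule.Build F' Z theta thA th1 thDr thDl).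
exists M, (id : W -> M), (id : M -> W); split=> // c u v.
by congr (_ + _); exact: (esym (thF c u)).
Qed.

Section Coaction.
Variables (M : lmodType F') (r : W -> M) (r' : M -> W).
Hypotheses (rK : cancel r r') (r'K : cancel r' r) (rS : semilin iF r).
Hypothesis rth : forall c w, r (theta c w) = c *: r w.

Let thS c : semilin idfun (theta c). Proof. by case: (thh c). Qed.
Let r'D : addmap r'.
Proof. by move=> a b; apply: (can_inj rK); rewrite (semilinD rS) !r'K. Qed.
Let r'Z c a : r' (c *: a) = theta c (r' a).
Proof. by apply: (can_inj rK); rewrite rth !r'K. Qed.
Let jS : semilin iF (bj iF : G -> B) := semilin_bj iF G.
Let rjS : semilin iF (tmap r (bj iF : G -> B)) := semilin_tmap rS jS.
Let idG := @semilin_id F G.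
Let idM := @semilin_id F' M.
Let idB := @semilin_id F' B.
Let idW := @semilin_id F W.

Definition ext_coact (m : M) : tens M B := tmap r (bj iF : G -> B) (coact (r' m)).

Lemma ext_coact_linear : linear ext_coact.
Proof.
move=> c u v; rewrite /ext_coact r'D r'Z (semilinD (iota := idfun) (coactS W)) (semilinD rjS).
congr (_ + _); have [_ _ ->] := thh c; rewrite (tmap_comp _ (thS c) idG rS jS).
move: (coact _); apply: tens_ext => [|x y|w a].
- apply: tmapD jS; exact: (semilin_comp (fun _ => erefl) (thS c) rS).
- by rewrite (semilinD rjS) scalerDr.
rewrite (tmapE (semilin_comp (i3 := iF) (fun _ => erefl) (thS c) rS) jS) (tmapE rS jS).
by rewrite rth tmkZl.
Qed.
Let ext_coactS : semilin idfun ext_coact := ext_coact_linear.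

Definition ext_comp i (m : M) : M := r (gcomp (rep_gr W) i (r' m)).
Lemma ext_comp_linear i : linear (ext_comp i).
Proof.
move=> c u v; rewrite /ext_comp r'D r'Z (semilinD (iota := idfun) (gcompS _ _)) (semilinD rS).
by congr (_ + _); have [_ <- _] := thh c; rewrite rth.
Qed.
Lemma ext_compK i j m : ext_comp i (ext_comp j m) = if i == j then ext_comp i m else 0.
Proof. by rewrite /ext_comp rK gcompK; case: ifP => // _; rewrite (semilin0 rS). Qed.
Lemma ext_compD m : ext_comp false m + ext_comp true m = m.
Proof. by rewrite /ext_comp -(semilinD rS) gcompD r'K. Qed.
Definition ext_gr : grading M := Grading ext_comp_linear ext_compK ext_compD.

Lemma ext_coact_even i m : ext_coact (gcomp ext_gr i m) = tcomp ext_gr (hs_gr B) i (ext_coact m).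
Proof.
rewrite /ext_coact [gcomp ext_gr i m]/(ext_comp i m) /ext_comp rK coact_even; apply: (tcomp_nat _ _ rS jS) => b w.
  by rewrite [RHS]/(ext_comp b (r w)) /ext_comp rK.
by rewrite gcomp_bj.
Qed.
Lemma ext_coactE w : ext_coact (r w) = tmap r (bj iF : G -> B) (coact w).
Proof. by rewrite /ext_coact rK. Qed.

Lemma ext_coact_assoc m :
  tassoc (tmap ext_coact id (ext_coact m)) = tmap id (@comul F' B) (ext_coact m).
Proof.
have cW := coactS W; have cG := @comulS F G; have cB := @comulS F' B.
rewrite {2 3}/ext_coact (tmap_comp _ rS jS ext_coactS idB) (tmap_comp _ rS jS idM cB).
rewrite (@eq_tmap _ _ _ _ _ _ _ (fun w => tmap r (bj iF : G -> B) (coact w)) _ (bj iF : G -> B)) //; last exact: ext_coactE.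
rewrite (@eq_tmap _ _ _ _ _ _ (fun w => id (r w)) r _
  (fun a : G => tmap (bj iF : G -> B) (bj iF : G -> B) (comul a))) //; last exact: comul_bj.
rewrite -(tmap_comp _ cW idG rjS jS) -(tmap_comp _ idW cG rS (semilin_tmap jS jS)).
by rewrite (tassoc_nat _ rS jS jS) coact_assoc.
Qed.
Lemma ext_coact_counit m : tlift (fun w (b : B) => counit b *: w) (ext_coact m) = m.
Proof.
have bal := @balanced_counitr F' B M; have balG := @balanced_counitr F G W.
rewrite -[RHS]r'K -[r' m in RHS]coact_counit /ext_coact; move: (coact _); apply: tens_ext.
- exact: addmap_comp (tliftD bal) (semilinD rjS).
- exact: addmap_comp (semilinD rS) (tliftD balG).
by move=> w a; rewrite (tmapE rS jS) (tliftE _ _ bal) (tliftE _ _ balG) counit_bj (semilinZ rS).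
Qed.
Definition ext_rep : rep B :=
  Rep ext_coact_linear ext_coact_even ext_coact_assoc ext_coact_counit.

Lemma ext_rep_hom : HomG W (restriction ext_rep) (r : W -> restriction ext_rep).
Proof.
split=> [|i w|w]; first exact: rS.
  by rewrite [RHS]/(ext_comp i (r w)) /ext_comp rK.
rewrite [LHS]/(res2 (ext_coact (r w))) ext_coactE; exact: res2_tmap.
Qed.
End Coaction.

(** With [theta] as scalar multiplication [W] becomes a vector space over F'. Its grading and
    coaction are linear over F' because each [theta c] is an even endomorphism. *)
Lemma rep_of_action : exists (W' : rep B) (r : W -> W') (r' : W' -> W),
  [/\ cancel r r', cancel r' r, semilin iF r, forall c w, r (theta c w) = c *: r w &
      HomG W (restriction W') r].
Proof.
have [M [r [r' [rK r'K rS rth]]]] := module_of_action.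
exists (ext_rep rK r'K rS rth), r, r'; split=> //; exact: ext_rep_hom.
Qed.
End EnlargeScalars.

(** * Comparing base changes in a tower of fields *)

Section Tower.
Variables (F F' K : fieldType) (iota : {rmorphism F -> K}) (iF : {rmorphism F -> F'}).
Variables (e : {rmorphism F' -> K}) (he : forall c, e (iF c) = iota c) (G : hopf_superalg F).
Notation B := (base_changeH iota G).
Notation B' := (base_changeH iF G).
Notation tw := (@twist F G).

Section Push.
Variable V : rep B.
Notation P := (pushforward (bc_unfold he G) V).

(** Restricting [V] directly to [F], or through F' after identifying the two base changes of [G],
    gives the same operators. Homomorphisms over [K] can thus be checked after restriction to
    [F]. *)
Lemma HomG_unfold : HomG (restriction V) (restriction (restriction P)) (id : V -> V).
Proof.
have idS : semilin iota (id : rscal iota V -> V) by [].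
have jS : semilin iota (bj iota : G -> B) := semilin_bj iota G.
have jF : semilin iF (bj iF : G -> B') := semilin_bj iF G.
have je : semilin e (bj e : B' -> base_changeH e B') := semilin_bj e B'.
have jje : semilin iota (fun a : G => bj e (bj iF a : B') : base_changeH e B').
  exact: semilin_comp (fun c => esym (he c)) jF je.
have uS := @unfoldS F F' K iF e iota he G.
have idV := @semilin_id K V.
have idR : semilin iF (id : restriction V -> rscal e V).
  by move=> c u v; congr (_ + _); exact: (congr1 (fun d : K => d *: (u : V)) (esym (he c))).
have idR' : semilin e (id : rscal e V -> V) by [].
have idF : semilin idfun (id : restriction V -> restriction (restriction P)).
  by move=> c u v; congr (_ + _); exact: (congr1 (fun d : K => d *: (u : V)) (esym (he c))).
split=> // v.
have pE : @coact _ _ P v = tmap (id : rscal e V -> V) (bj e : B' -> base_changeH e B')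
    (tmap (id : restriction V -> rscal e V) (bj iF : G -> B') (res_coact (v : rscal iota V))).
  rewrite (tmap_comp _ idR jF idR' je).
  transitivity (tmap (@id V) (bc_unfold he G)
    (tmap (id : rscal iota V -> V) (bj iota : G -> B) (res_coact (v : rscal iota V)))).
    by rewrite kap_res.
  apply: (etrans (tmap_comp _ idS jS idV uS)).
  by apply: eq_tmap => // a; exact: unfoldE.
have r1 : res_coact (v : rscal e P) =
    tmap (id : restriction V -> rscal e V) (bj iF : G -> B') (res_coact (v : rscal iota V)).
  rewrite [LHS]/(res2 (@coact _ _ P v)) pE.
  exact: (etrans (res2_tmap _ idR') (tmap_id _)).
rewrite [LHS]/(res2 (res_coact (v : rscal e P))) r1.
exact: (res2_tmap _ idR).
Qed.

Lemma irreducible_unfold : irreducible V -> irreducible P.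
Proof.
move=> [v0 Vi]; split=> // U [U0 UZ Ug Uc]; apply: Vi; split=> // v Uv.
have [s sU sE] := Uc v Uv.
exists [seq (p.1, bc_fold he G p.2) | p <- s]; first by move=> _ /mapP[p ps ->]; exact: sU.
have idV := @semilin_id K V; have fS := @foldS F F' K iF e iota he G.
have uS := @unfoldS F F' K iF e iota he G.
have -> : coact v = tmap id (bc_fold he G) (tmap id (bc_unfold he G) (coact v)).
  rewrite (tmap_comp _ idV uS idV fS) -[LHS]tmap_id; apply: eq_tmap => // b.
  have fuS : semilin idfun (fun b => fold0 iota (unfold0 iF e b) : B) := semilin_compl uS fS.
  move: b; apply: (@bc_ext _ _ _ _ _ idfun B) => //.
  by move=> a; apply: esym; exact: (etrans (congr1 (fun x => fold0 iota x) (unfoldE he a)) (foldE he a)).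
rewrite [tmap id (bc_unfold he G) _]sE (addmap_sum _ _ _ (tmapD idV fS)) big_map.
by apply: eq_bigr => p _; rewrite (tmapE idV fS).
Qed.
End Push.

Section Quotient.
Variables (W : rep G) (W' : rep B') (r : W -> W').
Hypotheses (rS : semilin iF r) (rh : HomG W (restriction W') r).
Notation Y := (base_changeR e W').

(** The canonical map from the base change of [W] over [F] to that of [W'] over F'. *)
Definition quot : bc iota W -> bc e W' := bclift iota (fun w => bj e (r w)).

Lemma quot0S : semilin iota (fun w => bj e (r w)).
Proof. exact: semilin_comp (fun c => esym (he c)) rS (semilin_bj e W'). Qed.
Lemma quotS : semilin idfun quot. Proof. exact: semilin_bclift quot0S. Qed.

Lemma jact_restr2_linear (X : rep (base_changeH e B')) j : 
  linear (@jact _ _ (repJ (restriction (restriction X))) j : X -> X).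
Proof.
move=> c u v.
have hc := HomG_restriction (HomG_restriction (HomG_scale X c)).
have /HomG_shom[_ /(_ j u)] := hc; rewrite twist0 => h.
have jD := @jactD _ _ (repJ (restriction (restriction X))) j (c *: u : X) v.
by rewrite [LHS]jD -h.
Qed.

Lemma quot_act j (x : bc iota W) :
  quot (@jact _ _ (jbc iota (repJ W)) j x) =
  @jact _ _ (repJ (restriction (restriction Y))) j (quot x).
Proof.
have jS : semilin idfun (@jact _ _ (repJ (restriction (restriction Y))) j : Y -> Y) :=
  jact_restr2_linear (X := Y) j.
move: x; apply: (@bc_ext _ _ iota W _ idfun (bc e W')).
- exact: semilin_compl (@jactS _ _ (jbc iota (repJ W)) j) quotS.
- exact: semilin_compl quotS jS.
move=> w; rewrite (jact_bj iota j (w : repJ W)) /quot !(bcliftE quot0S).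
have h1 := (HomG_shom _).1 rh.
have h2 := (HomG_shom _).1 (HomG_restriction (HomG_bj e W')).
by rewrite h1.2 twist0 [LHS]h2.2 twist0.
Qed.

Lemma HomG_quot (V : rep B) f : shom tw idfun false (repK iota V) (jbc iota (repJ W)) f ->
  HomG (pushforward (bc_unfold he G) V) Y (fun v => quot (f v)).
Proof.
move=> [fS fa]; have qfl : linear (fun v => quot (f v)) by exact: semilin_compl fS quotS.
apply: HomG_of_restriction => //; apply: HomG_of_restriction; first exact: (semilin_rs qfl).
apply/HomG_shom; split; first exact: (semilin_rs (semilin_rs qfl)).
move=> j v; rewrite twist0 -quot_act; congr quot.
have [_ /(_ j v)] := (HomG_shom _).1 (HomG_unfold V); rewrite twist0 => hv.
by have := fa j v; rewrite twist0 => <-; congr f.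
Qed.
End Quotient.
End Tower.

(** * Proof of the theorem *)

Section Isomorphism.
Variables (F : fieldType) (A : hopf_superalg F).

Lemma HomG_id (V : rep A) : HomG V V id.
Proof. by split=> // v; rewrite tmap_id. Qed.
Lemma HomG_comp (V1 V2 V3 : rep A) f g : HomG V1 V2 f -> HomG V2 V3 g -> HomG V1 V3 (fun v => g (f v)).
Proof. move=> /HomG_shom fh /HomG_shom gh; apply/HomG_shom; exact: (shom_comp (@twistA _ _) fh gh). Qed.
Lemma HomG_inv (V V' : rep A) f g : HomG V V' f -> cancel f g -> cancel g f -> HomG V' V g.
Proof.
move=> /HomG_shom fh fK gK; apply/HomG_shom.
exact: (shom_inv (s := idfun) (@twist0 _ _) (@twistA _ _) fh (fun=> erefl) fK gK).
Qed.
Lemma iso_refl (V : rep A) : iso V V.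
Proof. by exists id; [exact: HomG_id|exists id]. Qed.
Lemma iso_sym (V V' : rep A) : iso V V' -> iso V' V.
Proof. by move=> [f fh [g fK gK]]; exists g; [exact: HomG_inv fh fK gK|exists f]. Qed.
Lemma iso_trans (V1 V2 V3 : rep A) : iso V1 V2 -> iso V2 V3 -> iso V1 V3.
Proof.
move=> [f fh fb] [g gh gb]; exists (fun v => g (f v)); first exact: HomG_comp fh gh.
exact: bij_comp.
Qed.
Lemma iso_classP (V V' : rep A) : iso_class V = iso_class V' <-> iso V V'.
Proof.
split=> [h|h].
  by have := iso_refl V'; rewrite -[iso V' V']/(iso_class V' V') -h.
apply/funext => X; apply/propext; split; last exact: iso_trans h.
exact: iso_trans (iso_sym h).
Qed.

Lemma irreducible_parity (V : rep A) : irreducible V -> irreducible (parity_change V).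
Proof.
move=> [v0 Vi]; split=> // U [U0 UZ Ug Uc]; apply: Vi; split=> // i v Uv.
by have := Ug (~~ i) v Uv; rewrite /= /par_comp negbK.
Qed.

Lemma scalars_mem (V : rep A) z : scalars V z <-> scalar_map z.
Proof.
split=> [[c _ <-]|[c zc]]; first by exists c.
exists c => //; by apply/funext => v; rewrite zc.
Qed.

Lemma End_scalar (V : rep A) : HomG V V = scalars V <-> (forall f, HomG V V f -> scalar_map f).
Proof.
split=> [-> f /scalars_mem //|h]; apply/seteqP; split=> f; first by move=> /h/scalars_mem.
by move=> [c _ <-]; exact: HomG_scale.
Qed.

Lemma central_iff (V : rep A) D (bb : bool) :
  (forall z, even_center D z <-> graded_center (@twist F A) bb (V := repJ V) z) ->
  central D <-> (forall z, graded_center (@twist F A) bb (V := repJ V) z -> scalar_map z).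
Proof.
move=> Dz; split=> [h z /Dz|h]; first by rewrite h => /scalars_mem.
apply/seteqP; split=> z; first by move=> /Dz/h/scalars_mem.
move=> [c _ <-]; apply/Dz; split; first exact: (shom_scale (@twist0 _ _)).
by move=> b g _ gh v; rewrite (shomZ (s := idfun) gh).
Qed.

Lemma End_alg_center (V : rep A) z :
  even_center (End_alg V) z <-> graded_center (@twist F A) false (V := repJ V) z.
Proof.
split=> [[zh zc]|[zh zc]].
  split; first exact/HomG_shom.
  by move=> [//|] g _ /HomG_shom gh v; have := congr1 (fun k => k v) (zc false g gh).
split; first exact/HomG_shom.
move=> [|] g.
  by move=> ->; apply/funext => v; rewrite /= (shom0 (s := idfun) zh).
by move=> /HomG_shom gh; apply/funext => v; exact: (zc false).
Qed.

Lemma End_superalg_shom (V : rep A) b g :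
  End_superalg V b g <-> shom (@twist F A) idfun b (repJ V) (repJ V) g.
Proof. by case: b; [exact: HomG_parity_shom|exact: HomG_shom]. Qed.

Lemma End_superalg_center (V : rep A) z :
  even_center (End_superalg V) z <-> graded_center (@twist F A) true (V := repJ V) z.
Proof.
split=> [[/(End_superalg_shom false) zh zc]|[zh zc]].
  split=> // b g _ /End_superalg_shom gh v.
  by have := congr1 (fun k => k v) (zc b g gh).
split; first exact/(End_superalg_shom false).
by move=> b g /End_superalg_shom gh; apply/funext => v; apply: (zc b) => //; rewrite implybT.
Qed.
End Isomorphism.

(** * Embeddings into base changes and Galois orbits *)

Section Correspondence.
Variables (F K : fieldType) (iota : {rmorphism F -> K}) (G : hopf_superalg F).
Hypothesis sepK : separable_closure iota.
Notation B := (base_changeH iota G).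
Notation tw := (@twist F G).
Notation rK := (repK iota).
Notation tw0 := (@twist0 F G).
Notation twA := (@twistA F G).

Lemma gal_orbitP (V V' : rep B) :
  gal_orbit V = gal_orbit V' <->
  exists (s : galaut iota) g, shom tw s false (rK V) (rK V') g /\ bijective g.
Proof.
have sub (V1 V2 : rep B) (s : galaut iota) g : shom tw s false (rK V1) (rK V2) g -> bijective g ->
    forall C, gal_orbit V2 C -> gal_orbit V1 C.
  move=> gh gb _ [t ->]; have [u uE] := galaut_comp t s; exists u.
  apply/iso_classP; have bh := shom_gal_twist t V2.
  apply/iso_sym/gal_twist_iso; exists (fun v => bj t (g v)); split; last exact: bij_comp (bj_bijective _ _) gb.
  exact: (shom_comp twA gh bh).
split=> [h|[s [g [gh gb]]]].
  have : gal_orbit V' (iso_class (gal_twist galaut_id V')) by exists galaut_id.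
  rewrite -h => -[s /iso_classP /iso_sym sh]; exists s; apply/gal_twist_iso.
  apply: iso_trans sh _; apply/gal_twist_iso; exists id; split; last by exists id.
  exact: (shom_id tw0).
apply/funext => C; apply/propext; split; last exact: sub gh gb C.
have [s' [sK s'K]] := galaut_inv s; case: gb => g' gK Kg.
have g'h := shom_inv tw0 twA gh s'K gK Kg.
by apply: sub g'h _ C; exists g.
Qed.

Lemma embedsP (W : rep G) (V : rep B) : irreducible V ->
  embeds V (base_changeR iota W) <->
  exists f, shom tw idfun false (rK V) (jbc iota (repJ W)) f /\ exists v, f v != 0.
Proof.
move=> /(irreducible_jirrK (iota := iota)) Vi; split=> [[f /HomG_base_change fh fi]|[f [fh fn]]].
  by exists f; split=> //; exact: injective_nz fh Vi fi.
exists f; first exact/HomG_base_change.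
exact: (schur_injective fh Vi fn).
Qed.

(** The base change of [W] is isomorphic to its own Galois twists through [gact], so it contains
    every conjugate of each of its subrepresentations. *)
Lemma embeds_orbit (W : rep G) (V V' : rep B) : irreducible V -> irreducible V' ->
  gal_orbit V = gal_orbit V' -> embeds V (base_changeR iota W) -> embeds V' (base_changeR iota W).
Proof.
move=> Vi V'i /gal_orbitP[s [g [gh [g' gK Kg]]]] /(embedsP _ Vi)[f [fh [v0 fv0]]].
have [s' [sK s'K]] := galaut_inv s; have g'h := shom_inv tw0 twA gh s'K gK Kg.
have ah := shom_gact tw0 (repJ W) s.
apply/embedsP => //; exists (fun v => gact s (f (g' v))); split.
  have h1 : shom tw s' false (rK V') (jbc iota (repJ W)) (fun v => f (g' v)) by apply: (shom_comp twA g'h fh).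
  by apply: (shom_comp twA h1 ah) => // x; rewrite s'K.
exists (g v0); rewrite gK; apply: contraNneq fv0 => h0.
by rewrite -[f v0](gactK tw0 twA sK) h0 (shom0 (shom_gact tw0 (repJ W) s')).
Qed.

Lemma embeds_unique (W : rep G) (V V' : rep B) :
  irreducible W -> irreducible V -> irreducible V' ->
  embeds V (base_changeR iota W) -> embeds V' (base_changeR iota W) -> gal_orbit V = gal_orbit V'.
Proof.
move=> Wi Vi V'i /(embedsP _ Vi)[f [fh fn]] /(embedsP _ V'i)[f' [f'h f'n]].
apply/gal_orbitP; apply: (conjugate_of_embeddings tw0 twA sepK _ _ _ fh fn f'h f'n).
- exact/irreducible_jirr.
- exact/irreducible_jirrK.
- exact/irreducible_jirrK.
Qed.

Lemma irreducible_embeds (W : rep G) : irreducible W ->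
  exists2 V : rep B, irreducible V & embeds V (base_changeR iota W).
Proof.
move=> [[w w0] _].
have bw : (bj iota w : base_changeR iota W) != 0.
  have [l ll l1] : exists2 l : rscal iota K^o -> F, scalar l & l 1 = 1.
    by apply: functional_neq0; exact: oner_neq0.
  apply: contraNneq w0 => h; apply/eqP.
  have := bproj_bj ll (w : repJ W); rewrite l1 scale1r => <-.
  by rewrite h (addmap0 (bprojD ll)).
by have [V [f [Vi fh fi]]] := irreducible_exists bw; exists V => //; exists f.
Qed.

Lemma embeds_iso (W W' : rep G) (V : rep B) : iso W W' ->
  embeds V (base_changeR iota W) -> embeds V (base_changeR iota W').
Proof.
move=> [g /HomG_shom gh [g' gK Kg]] [f /HomG_base_change fh fi].
have bh := shom_bc tw0 twA iota gh; exists (fun v => bclift iota (fun w => bj iota (g w) : jbc iota (repJ W')) (f v)).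
  by apply/HomG_base_change; apply: (shom_comp twA fh bh).
have g'h := shom_inv (s := idfun) tw0 twA gh (fun=> erefl) gK Kg.
have b'h := shom_bc tw0 twA iota g'h.
have bK : cancel (bclift iota (fun w => bj iota (g w) : jbc iota (repJ W')))
    (bclift iota (fun w => bj iota (g' w) : jbc iota (repJ W))).
  have h := shom_comp (u := idfun) (d := false) twA bh b'h (fun=> erefl) erefl.
  by apply: (shom_bc_ext h (shom_id tw0 _)) => w; rewrite (bcE tw0 twA iota gh) (bcE tw0 twA iota g'h) gK.
by apply: inj_comp fi; exact: can_inj bK.
Qed.

Lemma embeds_class (W W' : rep G) (V : rep B) : irreducible W -> irreducible W' -> irreducible V ->
  embeds V (base_changeR iota W) -> embeds V (base_changeR iota W') -> iso W W'.
Proof.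
move=> Wi W'i Vi /(embedsP _ Vi)[f [fh fn]] /(embedsP _ Vi)[f' [f'h f'n]].
have [|||g gh gb] := iso_of_common_constituent tw0 twA sepK _ _ _ fh fn f'h f'n.
- exact/irreducible_jirr.
- exact/irreducible_jirr.
- exact/irreducible_jirrK.
by exists g => //; exact/HomG_shom.
Qed.

Lemma embeds_surjective (V : rep B) : irreducible V ->
  exists2 W : rep G, irreducible W & embeds V (base_changeR iota W).
Proof.
move=> Vi; have [v v0] := Vi.1.
have [W [k [Wi /HomG_shom kh ki]]] := irreducible_exists (V := restriction V) v0.
exists W => //; apply/embedsP => //.
have [V' V'i /(embedsP _ V'i)[f' [f'h f'n]]] := irreducible_embeds Wi.
have kh' : shom tw iota false (repJ W) (rK V) k by case: kh => kS ka; split.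
have kn : exists w, k w != 0.
  have [w w0] := Wi.1; exists w; apply: contraNneq w0 => kw; apply/eqP/ki.
  by rewrite kw (shom0 kh').
apply: (constituent_of_quotient tw0 twA sepK _ _ _ kh' kn f'h f'n).
- exact/irreducible_jirr.
- exact/irreducible_jirrK.
- exact/irreducible_jirrK.
Qed.

Lemma corresponds_embeds (W : rep G) (V : rep B) : irreducible V -> corresponds W V ->
  embeds V (base_changeR iota W).
Proof. by move=> Vi [_ [V0 [V0i V0e V0o]]]; exact: embeds_orbit V0o V0e. Qed.

Lemma shom_parity_change (s : K -> K) b (V V' : rep B) g :
  shom tw s b (rK V) (rK (parity_change V')) g <-> shom tw s (~~ b) (rK V) (rK V') g.
Proof.
split=> -[gS ga]; split=> // -[l|i] v; try exact: (ga (inl l) v).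
  by have := ga (inr i) v => /= ->; rewrite /opactK /= /par_comp addbN.
by have := ga (inr i) v => /= ->; rewrite /opactK /= /par_comp addbN.
Qed.

Lemma gal_twist_parity (s : galaut iota) (V : rep B) : irreducible V ->
  iso (gal_twist s V) (parity_change V) <->
  exists g, shom tw s true (rK V) (rK V) g /\ exists v, g v != 0.
Proof.
move=> Vi; have Vj := (irreducible_jirrK (iota := iota) V).1 Vi.
have [s' [sK s'K]] := galaut_inv s; rewrite gal_twist_iso.
split=> -[g [gh gb]]; exists g; split; try exact/(shom_parity_change s false).
  by apply: injective_nz gh Vj _; exact: bij_inj.
have [g' [gK Kg _]] := schur_inverse tw0 twA gh s'K Vj Vj gb.
by exists g'.
Qed.

Lemma gal_twist_self (s : galaut iota) (V : rep B) : irreducible V ->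
  iso (gal_twist s V) V <-> exists g, shom tw s false (rK V) (rK V) g /\ exists v, g v != 0.
Proof.
move=> Vi; have Vj := (irreducible_jirrK (iota := iota) V).1 Vi.
have [s' [sK s'K]] := galaut_inv s; rewrite gal_twist_iso.
split=> -[g [gh gb]]; exists g; split=> //.
  by apply: injective_nz gh Vj _; exact: bij_inj.
have [g' [gK Kg _]] := schur_inverse tw0 twA gh s'K Vj Vj gb.
by exists g'.
Qed.

(** The bit [bb] treats the endomorphism algebra and superalgebra together. A nonzero odd map
    semilinear along [s] stands for an isomorphism of the twist with the parity change of [V]. *)
Lemma graded_center_iff (bb : bool) (W : rep G) (V : rep B) :
  2%N \notin [pchar F] -> irreducible W -> irreducible V -> embeds V (base_changeR iota W) ->
  (forall z, graded_center tw bb (V := repJ W) z -> scalar_map z) <->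
  HomG V V = scalars V /\
  (forall s : galaut iota, exists b g,
     [/\ b ==> bb, shom tw s b (rK V) (rK V) g & exists v, g v != 0]).
Proof.
move=> charF Wi Vi /(embedsP _ Vi)[f0 [f0h f0n]].
have Wj := (irreducible_jirr W).1 Wi; have Vj := (irreducible_jirrK (iota := iota) V).1 Vi.
have two0 : 2%:R != 0 :> K.
  by rewrite -(rmorph_nat iota) fmorph_eq0; apply: contra charF => h; rewrite inE.
rewrite End_scalar; split=> [Zs|[Vs Vt]].
  split; last by move=> s; exact: (conjugate_scalar tw0 twA sepK Wj Vj f0h f0n Zs s).
  move=> f /(HomG_shomK (iota := iota)) fh.
  exact: (endomorphism_scalar tw0 twA sepK Wj Vj f0h f0n Zs two0 (irreducible_fin_dim Vi) fh).
apply: (graded_center_scalar tw0 twA sepK Wj Vj f0h f0n _ Vt) => f fh.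
by apply: Vs; exact/(HomG_shomK (iota := iota)).
Qed.
End Correspondence.

(** * Descent to the even part of the center *)

Section EvenCenterField.
Variables (F F' K : fieldType) (iota : {rmorphism F -> K}) (iF : {rmorphism F -> F'}).
Variable G : hopf_superalg F.
Hypotheses (sepK : separable_closure iota) (sepF : separable_over iF).
Notation B := (base_changeH iota G).
Notation tw := (@twist F G).
Notation tw0 := (@twist0 F G).
Notation twA := (@twistA F G).
Variables (V : rep B) (W : rep G) (theta : F' -> W -> W).
Hypotheses (Vi : irreducible V) (WV : corresponds W V).
Hypothesis thc : is_even_center iF theta.

Let thE c : even_center (End_superalg W) (theta c).
Proof. by case: thc => -[h _ _] _ _ _; exact: h. Qed.
Let thh c : HomG W W (theta c).
Proof. by case: (thE c). Qed.

(** An endomorphism of [W] is only linear over [F]; it becomes linear over F' on [W'] because it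
    commutes with every [theta c], by centrality. *)
Lemma End_superalg_transfer (W' : rep (base_changeH iF G)) (r : W -> W') (r' : W' -> W) :
  cancel r r' -> cancel r' r -> semilin iF r -> (forall c w, r (theta c w) = c *: r w) ->
  HomG W (restriction W') r ->
  forall i (f : W' -> W') (g : W -> W), (forall v, f (r v) = r (g v)) ->
  End_superalg W' i f <-> End_superalg W i g.
Proof.
move=> rK r'K rS rth rh i f g fg.
have ra j w : r (@jact _ _ (repJ W) j w) = @jact _ _ (repK iF W') j (r w).
  by have := ((HomG_shom _).1 rh).2 j w; rewrite twist0.
have fE x : f x = r (g (r' x)) by rewrite -fg r'K.
have gE w : g w = r' (f (r w)) by rewrite fg rK.
have r'D x y : r' (x + y) = r' x + r' y by apply: (can_inj rK); rewrite (semilinD rS) !r'K.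
have r'Z c x : r' (c *: x) = theta c (r' x) by apply: (can_inj rK); rewrite rth !r'K.
have r'ZF c x : r' (iF c *: x) = c *: r' x by apply: (can_inj rK); rewrite (semilinZ rS) !r'K.
have fK : End_superalg W' i f <-> shom tw idfun i (repK iF W') (repK iF W') f.
  by case: i; [exact: HomG_parity_shomK|exact: HomG_shomK].
split.
  move=> /fK[fS fa]; apply/End_superalg_shom; split=> [c u v|j v]; rewrite !gE.
    by rewrite rS fS r'D r'ZF.
  by apply: (can_inj rK); rewrite !r'K ra fa ra r'K.
move=> gi; apply/fK; have [gS ga] := (End_superalg_shom i g).1 gi.
have gth c w : g (theta c w) = theta c (g w).
  by have := congr1 (fun k => k w) ((thE c).2 i g gi).
split=> [c u v|j v]; rewrite !fE.
  by rewrite r'D r'Z (semilinD (iota := idfun) gS) gth (semilinD rS) rth.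
have r'a : r' (@jact _ _ (repK iF W') j v) = @jact _ _ (repJ W) j (r' v).
  by apply: (can_inj rK); rewrite ra !r'K.
by rewrite r'a ga ra.
Qed.

Lemma even_center_descent :
  exists (e : {rmorphism F' -> K}) (he : forall c, e (iF c) = iota c)
         (W' : rep (base_changeH iF G)) (r : W -> W'),
  [/\ corresponds W' (pushforward (bc_unfold he G) V),
      HomG W (restriction W') r /\ bijective r,
      forall c v, r (theta c v) = c *: r v,
      central (End_superalg W') &
      forall i (f : W' -> W') (g : W -> W),
        (forall v, f (r v) = r (g v)) ->
        End_superalg W' i f <-> End_superalg W i g].
Proof.
have Wi : irreducible W by case: WV.
have [[_ thinj thsurj] thD thM thF] := thc.
have Wj := (irreducible_jirr W).1 Wi.
have /(embedsP _ Vi)[f0 [f0h f0n]] := corresponds_embeds Vi WV.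
have thJ c : shom tw idfun false (repJ W) (repJ W) (theta c) by exact/HomG_shom.
have [e [f [he fh fn fe]]] := common_eigenvector tw0 twA sepK sepF Wj (irreducible_fin_dim Wi) thJ
  (fun c d w => thD c d w) (fun c d w => thM c d w) (fun c w => thF c w) f0h f0n.
have [W' [r [r' [rK r'K rS rth rh]]]] := rep_of_action thh thD thM thF.
have tr := End_superalg_transfer rK r'K rS rth rh.
exists e, he, W', r; split=> //; last 1 first.
- apply/seteqP; split=> z.
    move=> [z0 zc]; pose g w := r' (z (r w)).
    have zg v : z (r v) = r (g v) by rewrite /g r'K.
    have gc : even_center (End_superalg W) g.
      split; first exact: (tr false _ _ zg).1 z0.
      move=> i h hi; pose k x := r (h (r' x)).
      have kh v : k (r v) = r (h v) by rewrite /k rK.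
      have := zc i k ((tr i _ _ kh).2 hi) => zk; apply/funext => w /=.
      apply: (can_inj rK); rewrite -zg -!kh -zg.
      exact: (congr1 (fun m => m (r w)) zk).
    have [c _ cE] := thsurj _ gc.
    apply/scalars_mem; exists c => x.
    by rewrite -{1}(r'K x) zg -cE rth r'K.
  move=> /scalars_mem[c zE]; split.
    have -> : z = (fun x => c *: x) by apply/funext.
    exact: (HomG_scale W' c).
  move=> i h hi; apply/funext => x; rewrite /= !zE.
  by case: i hi => -[hl _ _]; rewrite (semilinZ (iota := idfun) (hl : semilin idfun h)).
- split.
  + apply/(irreducible_jirrK (iota := iF)).
    have rJ : shom tw iF false (repJ W) (repK iF W') r.
      by have [_ ra] := (HomG_shom _).1 rh; split.
    split; first by have [w w0] := Wj.1; exists (r w); apply: contraNneq w0 => rw; apply/eqP/(can_inj rK); rewrite rw (semilin0 rS).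
    move=> U Us [u Uu u0] x; rewrite -(r'K x).
    apply: (Wj.2 _ (shom_preimage rJ Us)); exists (r' u); first by rewrite /preimage /= r'K.
    by apply: contraNneq u0 => ru; rewrite -(r'K u) ru (semilin0 rS).
  have Pi := irreducible_unfold he Vi.
  exists (pushforward (bc_unfold he G) V); split=> //.
  (* The embedding of [V] is [f] followed by the quotient map. It stays nonzero because [f] takes
     values in the common eigenvectors of F' with eigenvalues [e c], on which the quotient map is
     injective. *)
  have qh := HomG_quot he rS rh fh.
  exists (fun v => quot (iota := iota) e r (f v)) => //.
  have /(HomG_shomK (iota := e)) qhK := qh.
  apply: (schur_injective qhK); first exact/irreducible_jirrK.
  have [v fv] := fn; exists v; apply: contraNneq fv => qv; apply/eqP.
  exact: (eigenspace_quotient tw0 twA sepF Wj (irreducible_fin_dim Wi) thJ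
    (fun c d w => thD c d w) (fun c d w => thM c d w) (fun c w => thF c w) he rS rK r'K rth (fun c => fe c v) qv).
- by split=> //; exists r'.
Qed.
End EvenCenterField.

Section Bijection.
Variables (F K : fieldType) (iota : {rmorphism F -> K}) (G : hopf_superalg F).
Hypothesis sepK : separable_closure iota.

(** A union over all choices of [W] and [V], so that no representative is chosen; uniqueness of
    constituents makes it a single orbit on irreducible classes, and elsewhere it is empty. *)
Definition orbit_of_class (C : rep G -> Prop) : (rep (base_changeH iota G) -> Prop) -> Prop :=
  fun C' => exists W V, [/\ irreducible W, irreducible V, embeds V (base_changeR iota W),
    C = iso_class W & gal_orbit V C'].

Lemma orbit_of_classE (W : rep G) V : irreducible W -> irreducible V ->
  embeds V (base_changeR iota W) -> orbit_of_class (iso_class W) = gal_orbit V.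
Proof.
move=> Wi Vi VW; apply/funext => C'; apply/propext; split; last by exists W, V.
move=> [W1 [V1 [W1i V1i V1W1 /iso_classP W1W V1C]]].
by rewrite (embeds_unique sepK Wi Vi V1i VW (embeds_iso (iso_sym W1W) V1W1)).
Qed.

Lemma embeds_of_orbit (W : rep G) V : irreducible W -> irreducible V ->
  orbit_of_class (iso_class W) = gal_orbit V -> embeds V (base_changeR iota W).
Proof.
move=> Wi Vi WV; have [V1 V1i V1W] := irreducible_embeds iota Wi.
by apply: (embeds_orbit V1i Vi _ V1W); rewrite -WV; exact: esym (orbit_of_classE Wi V1i V1W).
Qed.

Lemma orbit_of_class_bij : bij_between (irr_classes G) (irr_orbits iota G) orbit_of_class.
Proof.
split.
- move=> _ [W Wi ->]; have [V Vi VW] := irreducible_embeds iota Wi.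
  by exists V => //; exact: orbit_of_classE.
- move=> _ _ [W Wi ->] [W' W'i ->] WW'; have [V Vi VW] := irreducible_embeds iota Wi.
  apply/iso_classP; apply: (embeds_class sepK Wi W'i Vi VW).
  by apply: embeds_of_orbit => //; rewrite -WW'; exact: orbit_of_classE.
- move=> _ [V Vi ->]; have [W Wi VW] := embeds_surjective sepK Vi.
  by exists (iso_class W); [exists W|exact: orbit_of_classE].
Qed.
End Bijection.

Theorem theorem1p2 (F K : fieldType) (iota : {rmorphism F -> K})
    (G : hopf_superalg F)
    (charF : 2%N \notin [pchar F]) (sepK : separable_closure iota) :
  (exists Phi : (rep G -> Prop) -> ((rep (base_changeH iota G) -> Prop) -> Prop),
    [/\ bij_between (irr_classes G) (irr_orbits iota G) Phi,
        forall W : rep G, irreducible W ->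
          exists2 V, irreducible V & embeds V (base_changeR iota W),
        forall (W : rep G) V, irreducible W -> irreducible V ->
          embeds V (base_changeR iota W) -> Phi (iso_class W) = gal_orbit V &
        forall (W : rep G) V, irreducible W -> irreducible V ->
          Phi (iso_class W) = gal_orbit V ->
          Phi (iso_class (parity_change W)) = gal_orbit (parity_change V)])
  /\
  (forall (V : rep (base_changeH iota G)) (VF : rep G),
    irreducible V -> corresponds VF V ->
    [/\ central (End_alg VF) <->
          HomG V V = scalars V /\
          (forall s : galaut iota, iso (gal_twist s V) V),
        central (End_superalg VF) <->
          HomG V V = scalars V /\
          (forall s : galaut iota,
            iso (gal_twist s V) V \/ iso (gal_twist s V) (parity_change V)) &
        forall (F' : fieldType) (iF : {rmorphism F -> F'}) (theta : F' -> VF -> VF),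
          is_even_center iF theta -> separable_over iF ->
          exists (e : {rmorphism F' -> K}) (he : forall c, e (iF c) = iota c)
                 (VF' : rep (base_changeH iF G)) (r : VF -> VF'),
          [/\ corresponds VF' (pushforward (bc_unfold he G) V),
              HomG VF (restriction VF') r /\ bijective r,
              forall c v, r (theta c v) = c *: r v,
              central (End_superalg VF') &
              forall i (f : VF' -> VF') (g : VF -> VF),
                (forall v, f (r v) = r (g v)) ->
                End_superalg VF' i f <-> End_superalg VF i g]]).
Proof.
split.
  exists (@orbit_of_class F K iota G); split.
  - exact: orbit_of_class_bij.
  - exact: irreducible_embeds.
  - by move=> W V; exact: orbit_of_classE.
  (* The same [f] embeds the parity changes: parity change alters neither the coaction nor the
     space, and it commutes with base change by conversion. *)
  move=> W V Wi Vi WV; have [f [fl fg fc] fi] := embeds_of_orbit sepK Wi Vi WV.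
  apply: (orbit_of_classE sepK); try exact: irreducible_parity.
  by exists f => //; split=> // i v; exact: fg.
move=> V VF Vi VFV; have VFi : irreducible VF by case: VFV.
have VVF := corresponds_embeds Vi VFV; split.
- rewrite (central_iff (bb := false)); last exact: End_alg_center.
  rewrite (graded_center_iff sepK false charF VFi Vi VVF); split=> -[h1 h2]; split=> // s.
    have [[|] [g [b0 gh gn]]] := h2 s; first by [].
    by apply/gal_twist_self => //; exists g.
  by have /(gal_twist_self _ Vi)[g [gh gn]] := h2 s; exists false, g.
- rewrite (central_iff (bb := true)); last exact: End_superalg_center.
  rewrite (graded_center_iff sepK true charF VFi Vi VVF); split=> -[h1 h2]; split=> // s.
    have [[|] [g [_ gh gn]]] := h2 s.
      by right; apply/gal_twist_parity => //; exists g.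
    by left; apply/gal_twist_self => //; exists g.
  have [/(gal_twist_self _ Vi)|/(gal_twist_parity _ Vi)] := h2 s => -[g [gh gn]].
    by exists false, g.
  by exists true, g.
- by move=> F' iF theta thc sepF; exact: even_center_descent sepK sepF _ _ _ Vi VFV thc.
Qed.
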